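(* Let $\Omega\subset\mathbb W$ be open and let $v\in C(\Omega)$ with $\mathcal Bv\in L^\infty_{loc}(\Omega)$. Assume: (i) for every $\tilde v\in C(\Omega)$ with $\mathrm{spt}(v-\tilde v)\Subset\Omega$ one has $\mathcal A_H(v)\le\mathcal A_H(\tilde v)$; (ii) for every $w_0=(y_0,t_0)\in\Omega$ there exists $r>0$ such that $B_r(w_0)\subset\Omega$ and $\lim_{\rho\to0^+}\rho\,\ell^v_r(\rho;w_0)=0$. Then $v\in\mathrm{Lip}_{loc}(\Omega)\cap C^{1,1}_{H,loc}(\Omega)$ and its left intrinsic graph $S_v$ is foliated by horizontal straight lines.
   Context: $\mathbb H$ is $\mathbb R^3$ with product $(x,y,t)\cdot(\xi,\eta,\tau)=(x+\xi,y+\eta,t+\tau+2(y\xi-x\eta))$; $X=\partial_x+2y\partial_t$, $Y=\partial_y-2x\partial_t$; a horizontal straight line is a straight line in $\mathbb R^3$ whose direction at each of its points $p$ lies in $\mathrm{span}\{X(p),Y(p)\}$. $\mathbb W=\{x=0\}$ with coordinates $(y,t)$; $S_v=\{(v(y,t),y,t+2yv(y,t)):(y,t)\in\Omega\}$. $\mathcal Bv=\partial_yv-2\partial_t(v^2)$ (distributionally); $\mathcal A_H(v)=\int_\Omega\sqrt{1+(\mathcal Bv)^2}\,dy\,dt$; $v\in C^{1,1}_{H,loc}(\Omega)$ means $v$ continuous with $\mathcal Bv$ locally Lipschitz in $\Omega$. For $0<\rho<r$ let $\gamma_{r,\rho}(s)=\frac{\rho}{r^2}s(2r-s)$ for $s\in(0,2r)$,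 $D_{r,\rho}=\{(y,t-r)\in\mathbb W: t\in(0,2r),\ |y|<\gamma_{r,\rho}(t)\}$, and $D_{r,\rho}(w_0)=w_0+D_{r,\rho}$. $B_r(w_0)$ is the Euclidean disc in $\mathbb W$ of radius $r$ centered at $w_0$, $B_r^+(w_0)=\{(y,t)\in B_r(w_0):y>y_0\}$, $B_r^-(w_0)=\{(y,t)\in B_r(w_0):y<y_0\}$. For $\rho\in(0,r)$, $\ell^v_r(\rho;w_0)=\max\{\mathrm{Lip}(v,B_r^+(w_0)\setminus D_{r,\rho}(w_0)),\mathrm{Lip}(v,B_r^-(w_0)\setminus D_{r,\rho}(w_0))\}\in[0,\infty]$, where $\mathrm{Lip}(v,A)$ is the Lipschitz constant of $v$ on $A$.
   Formalization: In (i), areas are compared over each compact K in Ω outside which ṽ = v, not over all Ω; this follows from (i) if A_H(v) is finite, and is needed if A_H(v) is infinite, where (i) is vacuous (Ω = 𝕎, v = y² is a counterexample). *)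

(* Defs.v *)
From HB Require Import structures.
From mathcomp Require Import all_boot all_order all_algebra.
From mathcomp Require Import all_classical all_reals all_analysis.
Set Implicit Arguments. Unset Strict Implicit. Unset Printing Implicit Defensive.
Import Order.TTheory GRing.Theory Num.Theory.
Import numFieldNormedType.Exports.
Local Open Scope classical_set_scope.
Local Open Scope ring_scope.

Section Heis.
Variable R : realType.

(* ---------- The plane W = {x = 0} with coordinates (y,t): points p : R * R,
   y = p.1, t = p.2 ---------- *)

Definition leb2 := (@lebesgue_measure R \x @lebesgue_measure R)%E.

Definition edist (p q : R * R) : R :=
  Num.sqrt ((p.1 - q.1) ^+ 2 + (p.2 - q.2) ^+ 2).

Definition dir (b : bool) : R * R := if b then (0, 1) else (1, 0).
Definition pd_y (f : R * R -> R) : R * R -> R := fun p => 'D_(dir false) f p.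
Definition pd_t (f : R * R -> R) : R * R -> R := fun p => 'D_(dir true) f p.

Fixpoint dpart (ds : seq bool) (f : R * R -> R) : R * R -> R :=
  match ds with
  | [::] => f
  | b :: ds' => fun p => 'D_(dir b) (dpart ds' f) p
  end.

Definition smooth (f : R * R -> R) : Prop :=
  forall ds : seq bool, continuous (dpart ds f) /\
    (forall (b : bool) (p : R * R), derivable (dpart ds f) p (dir b)).

Definition test_fun (Om : set (R * R)) (phi : R * R -> R) : Prop :=
  smooth phi /\ exists K, [/\ compact K, K `<=` Om & forall p, ~ K p -> phi p = 0].

Definition L1_loc (Om : set (R * R)) (g : R * R -> R) : Prop :=
  measurable_fun Om g /\
  forall K, compact K -> K `<=` Om -> (\int[leb2]_(p in K) `|(g p)%:E| < +oo)%E.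

Definition Linf_loc (Om : set (R * R)) (g : R * R -> R) : Prop :=
  measurable_fun Om g /\
  forall K, compact K -> K `<=` Om ->
    exists M : R, {ae leb2, forall p, K p -> `|g p| <= M}.

(* The function g is (a representative of) the distribution
   Bv = d_y v - 2 d_t (v^2) in Om:
   for every test function phi,  int g phi = int (- v d_y phi + 2 v^2 d_t phi). *)
Definition Bweak (Om : set (R * R)) (v g : R * R -> R) : Prop :=
  L1_loc Om g /\
  forall phi, test_fun Om phi ->
    (\int[leb2]_(p in Om) (g p * phi p)%:E =
     \int[leb2]_(p in Om) (- v p * pd_y phi p + 2 * (v p) ^+ 2 * pd_t phi p)%:E)%E.

(* Horizontal area  int_K sqrt(1 + (Bv)^2) on a set K, g a representative of Bv *)
Definition areaH (K : set (R * R)) (g : R * R -> R) : \bar R :=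
  (\int[leb2]_(p in K) (Num.sqrt (1 + (g p) ^+ 2))%:E)%E.

Definition LipC (v : R * R -> R) (A : set (R * R)) : \bar R :=
  ereal_sup ([set 0%E] `|`
    [set z | exists p q, [/\ A p, A q, p <> q & z = (`|v p - v q| / edist p q)%:E]]).

Definition ball_e (r : R) (w0 : R * R) : set (R * R) :=
  [set w | edist w w0 < r].
Definition ball_p (r : R) (w0 : R * R) : set (R * R) :=
  [set w | ball_e r w0 w /\ w.1 > w0.1].
Definition ball_m (r : R) (w0 : R * R) : set (R * R) :=
  [set w | ball_e r w0 w /\ w.1 < w0.1].

Definition gam (r rho s : R) : R := rho / r ^+ 2 * s * (2 * r - s).

Definition Dset (r rho : R) (w0 : R * R) : set (R * R) :=
  [set w | exists s, [/\ 0 < s, s < 2 * r, w.2 - w0.2 = s - r &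
                         `|w.1 - w0.1| < gam r rho s]].

Definition ell (v : R * R -> R) (r rho : R) (w0 : R * R) : \bar R :=
  Order.max (LipC v (ball_p r w0 `\` Dset r rho w0))
            (LipC v (ball_m r w0 `\` Dset r rho w0)).

Definition Lip_loc (Om : set (R * R)) (v : R * R -> R) : Prop :=
  forall K, compact K -> K `<=` Om ->
    exists L : R, forall p q, K p -> K q -> `|v p - v q| <= L * edist p q.

Definition C11H_loc (Om : set (R * R)) (v : R * R -> R) : Prop :=
  {within Om, continuous v} /\
  exists g, Bweak Om v g /\ Lip_loc Om g.

(* ---------- Heisenberg group H = R^3, points ((x, y), t) ---------- *)
Definition hX (q : R * R * R) : R * R * R := (1, 0, 2 * q.1.2).
Definition hY (q : R * R * R) : R * R * R := (0, 1, - 2 * q.1.1).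

Definition padd (p q : R * R * R) : R * R * R :=
  (p.1.1 + q.1.1, p.1.2 + q.1.2, p.2 + q.2).
Definition pscale (s : R) (p : R * R * R) : R * R * R :=
  (s * p.1.1, s * p.1.2, s * p.2).

Definition horiz_line (p d : R * R * R) : Prop :=
  d <> (0, 0, 0) /\
  forall s : R, exists a b : R,
    d = padd (pscale a (hX (padd p (pscale s d)))) (pscale b (hY (padd p (pscale s d)))).

Definition line_set (p d : R * R * R) : set (R * R * R) :=
  [set padd p (pscale s d) | s in [set: R]].

Definition Sv (Om : set (R * R)) (v : R * R -> R) : set (R * R * R) :=
  [set (v w, w.1, w.2 + 2 * w.1 * v w) | w in Om].

Definition foliated (S : set (R * R * R)) : Prop :=
  forall p, S p ->
    exists d, [/\ horiz_line p d,
      (exists e : R, 0 < e /\ forall s, `|s| < e -> S (padd p (pscale s d))) &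
      forall d', horiz_line p d' ->
        (exists e : R, 0 < e /\ forall s, `|s| < e -> S (padd p (pscale s d'))) ->
        line_set p d' = line_set p d].

End Heis.

(* Main.v *)
(* Where v is Lipschitz, Bv = v_y - 2 (v^2)_t holds almost everywhere and minimality gives
   the Euler-Lagrange equation int F(Bv) (phi_y - 4 (v phi)_t) = 0, F(a) = a / sqrt (1 + a^2).
   Testing it with phi = theta(y) eta((t - X(y)) / d), where X' = -4 v(y, X) is a
   characteristic, and letting d tend to 0, one finds that F(Bv), hence Bv, is constant along
   almost every characteristic; so v is affine and X quadratic along it, and by continuity
   along every characteristic. These parabolas are the projections of horizontal lines.
   By (ii), v is Lipschitz off every vertical line {y = y0}, with a constant that blows up
   more slowly than 1 / |y - y0|. The difference D of two characteristics is a quadratic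
   polynomial on one side of the line, and |D'| = 4 |v - v| is small compared with |D| / y at
   two heights y; this forces |D'| <= C |D| up to the line, so v is Lipschitz across it. *)

Require Import Defs.
From HB Require Import structures.
From mathcomp Require Import all_boot all_order all_algebra.
From mathcomp Require Import all_classical all_reals all_analysis.
From mathcomp Require Import measurable_realfun.
From mathcomp Require Import ring lra.
Import Order.TTheory GRing.Theory Num.Theory.
Import numFieldNormedType.Exports.
Local Open Scope classical_set_scope.
Local Open Scope ring_scope.
Set Implicit Arguments. Unset Strict Implicit. Unset Printing Implicit Defensive.

(** * Ordinary differential equations *)

(** [v] has no second derivatives, so the Euler-Lagrange equation cannot be differentiated along the
    flow. The first variation is thus bounded uniformly in [d], and division by [d] leads to a line
    integral wherever the curve meets one-sided Lebesgue points of the slices. Fubini and the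
    bi-Lipschitz flow give this for almost every curve, the continuity of the flow extends the
    result to all. Locally [v] is extended from a rectangle to the plane by clamping the
    coordinates, so that characteristics exist for all [y]. Near an exceptional line the Lipschitz
    constants enter only as a smallness condition at two fixed distances; the number 32 there is the
    4 of [X' = -4 v] times the 8 that the estimate for quadratic polynomials asks for. *)

Lemma is_derive1P (R : realType) (f : R -> R) (x l : R) :
  derivable f x 1 -> derive1 f x = l -> is_derive x 1 f l.
Proof. by move=> df <-; apply: DeriveDef; [exact: df|rewrite derive1E]. Qed.

Lemma is_derive_near (R : realType) (f g : R -> R) (x l : R) :
  (\forall z \near x, f z = g z) -> is_derive x 1 f l -> is_derive x 1 g l.
Proof. by move=> fg; apply: near_eq_is_derive. Qed.

Lemma le_of_derive (R : realType) (f f' : R -> R) (a b : R) :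
  a <= b -> (forall x, a <= x <= b -> is_derive x 1 f (f' x)) ->
  (forall x, a <= x <= b -> 0 <= f' x) -> f a <= f b.
Proof.
move=> ab df f0.
have [c cab E] : exists2 c, c \in `[a, b] & f b - f a = f' c * (b - a).
  apply: MVT_segment => // [x|].
    by rewrite in_itv/= => /andP[ax xb]; apply: df; rewrite !ltW.
  apply: derivable_within_continuous => x; rewrite in_itv/= => xab.
  by have := df x xab; case.
by rewrite -subr_ge0 E mulr_ge0 ?subr_ge0// f0//; move: cab; rewrite in_itv.
Qed.

(** Mean value inequality with a majorant [w] in place of a constant: [w - f] and [w + f] are both
    nondecreasing. Exponential majorants serve the Picard iteration, affine ones the Lipschitz
    bounds. *)
Lemma norm_le_of_derive (R : realType) (f f' w w' : R -> R) (a b : R) :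
  a <= b -> (forall x, a <= x <= b -> is_derive x 1 f (f' x)) ->
  (forall x, a <= x <= b -> is_derive x 1 w (w' x)) ->
  (forall x, a <= x <= b -> `|f' x| <= w' x) -> `|f b - f a| <= w b - w a.
Proof.
move=> ab df dw fw.
have h1 : (w \- f) a <= (w \- f) b.
  apply: (@le_of_derive _ _ (w' \- f')) => // x xab /=.
    by have ? := df x xab; have ? := dw x xab; apply: is_deriveB.
  by rewrite subr_ge0; apply: le_trans (fw x xab); apply: ler_norm.
have h2 : (w \+ f) a <= (w \+ f) b.
  apply: (@le_of_derive _ _ (w' \+ f')) => // x xab /=.
    by have ? := df x xab; have ? := dw x xab; apply: is_deriveD.
  have := fw x xab; rewrite ler_norml => /andP[]; lra.
move: h1 h2 => /= h1 h2; rewrite ler_norml; apply/andP; split; lra.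
Qed.

Lemma derive0_const (R : realType) (f f' : R -> R) (a b : R) :
  a <= b -> (forall x, a <= x <= b -> is_derive x 1 f (f' x)) ->
  (forall x, a <= x <= b -> f' x = 0) -> f a = f b.
Proof.
move=> ab df f0.
have : `|f b - f a| <= (cst 0 b : R) - cst 0 a.
  apply: (@norm_le_of_derive _ _ _ _ (cst 0)) => // x xab.
  by rewrite f0 // normr0.
by rewrite subrr normr_le0 subr_eq0 => /eqP.
Qed.

(** The integral from [- n] is a primitive only to the right of [- n]. Normalised to vanish at 0,
    these primitives agree where two of them are defined, so they glue to one on the whole line. *)
Lemma primitive_exists (R : realType) (h : R -> R) :
  continuous h -> exists H : R -> R, forall y : R, is_derive y 1 H (h y).
Proof.
move=> ch.
pose F (n : nat) (y : R) : R := \int[lebesgue_measure]_(t in `[- n%:R, y]) h t.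
have dF n (y : R) : - n%:R < y -> is_derive y 1 (F n) (h y).
  move=> ny.
  have y1 : y < y + 1 by rewrite ltrDl.
  have ih : lebesgue_measure.-integrable `[- n%:R, y + 1] (EFin \o h).
    apply: continuous_compact_integrable; first exact: segment_compact.
    exact: continuous_subspaceT.
  have [d1 d2] := continuous_FTC1_closed y1 ih ny (ch y).
  exact: is_derive1P d1 d2.
pose G n y := F n y - F n 0.
have dG n (y : R) : - n%:R < y -> is_derive y 1 (G n) (h y).
  move=> /dF d; rewrite -[h y]subr0 /G.
  by apply: is_deriveB.
have GE n m (y : R) : (0 < n)%N -> (0 < m)%N -> - n%:R < y -> - m%:R < y -> G n y = G m y.
  move=> n0 m0 ny my.
  have G0 k : G k 0 = 0 by rewrite /G subrr.
  have nn0 : - n%:R < 0 :> R by rewrite oppr_lt0 ltr0n.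
  have mm0 : - m%:R < 0 :> R by rewrite oppr_lt0 ltr0n.
  apply/eqP; rewrite -subr_eq0; apply/eqP.
  have dd (x : R) : - n%:R < x -> - m%:R < x -> is_derive x 1 (G n \- G m) (h x - h x).
    by move=> /dG d1 /dG d2; apply: is_deriveB.
  have [y0|y0] := leP 0 y.
    transitivity ((G n \- G m) 0); last by rewrite /= !G0 subrr.
    apply/esym; apply: (@derive0_const _ _ (fun x => h x - h x)) => // x /andP[x0 xy].
      by apply: dd; [apply: lt_le_trans nn0 x0|apply: lt_le_trans mm0 x0].
    by rewrite subrr.
  transitivity ((G n \- G m) 0); last by rewrite /= !G0 subrr.
  apply: (@derive0_const R (G n \- G m) (fun x => h x - h x)) => [|x /andP[x0 xy]|x _].
  - exact: ltW.
  - by apply: dd; [apply: lt_le_trans ny x0|apply: lt_le_trans my x0].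
  - by rewrite subrr.
(* The index depends on [y], but near [y] it may be replaced by the single index [m] below. *)
pose N (y : R) := (Num.bound `|y|).+1.
have Ny (y : R) : - (N y)%:R < y.
  rewrite ltrNl; apply: (@le_lt_trans _ _ `|y|); first by rewrite -normrN ler_norm.
  by rewrite (lt_trans (archi_boundP (normr_ge0 _)))// /N ltr_nat.
exists (fun y => G (N y) y) => y.
pose m := (N (`|y| + 1)).
have ym : \forall z \near y, G (N z) z = G m z.
  near=> z; apply: GE => //.
  have h1 : `|y| + 1 < m%:R.
    rewrite /m /N (ger0_norm (addr_ge0 (normr_ge0 y) ler01)).
    by rewrite (lt_trans (archi_boundP (addr_ge0 (normr_ge0 y) ler01)))// ltr_nat.
  rewrite ltrNl (lt_trans _ h1)//.
  have : `|y - z| < 1 by near: z; apply: (@cvgr_dist_lt _ _ _ (nbhs y) _ id) => //; apply: cvg_id.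
  have := ler_norm (- z + y); have := ler_norm (-y); rewrite normrN (addrC (- z)); lra.
have dm : is_derive y 1 (G m) (h y).
  apply: dG; rewrite ltrNl.
  have := archi_boundP (addr_ge0 (normr_ge0 y) ler01).
  rewrite /m /N (ger0_norm (addr_ge0 (normr_ge0 y) ler01)) -natr1; have := ler_norm (- y); rewrite normrN; lra.
apply: is_derive_near dm.
by apply: filterS ym => z ->.
Unshelve. all: by end_near. Qed.

Section pointwise_derivatives.
Variable R : realType.
Implicit Types (f g : R -> R) (x a b c : R).

Lemma der_eq f x a b : is_derive x 1 f a -> a = b -> is_derive x 1 f b.
Proof. by move=> ? <-. Qed.

Lemma der_add f g x a b : is_derive x 1 f a -> is_derive x 1 g b ->
  is_derive x 1 (fun z => f z + g z) (a + b).
Proof. by move=> ? ?; apply: is_deriveD. Qed.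

Lemma der_sub f g x a b : is_derive x 1 f a -> is_derive x 1 g b ->
  is_derive x 1 (fun z => f z - g z) (a - b).
Proof. by move=> ? ?; apply: is_deriveB. Qed.

Lemma der_cst x c : is_derive x 1 (fun=> c) 0.
Proof. exact: is_derive_cst. Qed.

Lemma der_id x : is_derive x 1 (fun z => z) 1.
Proof. exact: is_derive_id. Qed.

Lemma der_mul f g x a b : is_derive x 1 f a -> is_derive x 1 g b ->
  is_derive x 1 (fun z => f z * g z) (a * g x + f x * b).
Proof.
move=> df dg.
have h : is_derive x 1 (fun z => f z * g z) (f x *: b + g x *: a) := is_deriveM df dg.
apply: der_eq h _.
by rewrite /GRing.scale/=; ring.
Qed.

Lemma der_scale f x a c : is_derive x 1 f a ->
  is_derive x 1 (fun z => c * f z) (c * a).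
Proof. by move=> df; apply: der_eq (der_mul (der_cst x c) df) _; ring. Qed.

Lemma der_comp f g x a b : is_derive (g x) 1 f a -> is_derive x 1 g b ->
  is_derive x 1 (fun z => f (g z)) (a * b).
Proof. exact: is_derive1_comp. Qed.

Lemma der_affine x a b : is_derive x 1 (fun z => a * (z - b)) a.
Proof.
by apply: der_eq (der_scale a (der_sub (der_id x) (der_cst x b))) _; ring.
Qed.

Lemma der_continuous f x a : is_derive x 1 f a -> {for x, continuous f}.
Proof. by move=> [df _]; apply/differentiable_continuous/derivable1_diffP. Qed.

Lemma der_uniq f x a b : is_derive x 1 f a -> is_derive x 1 f b -> a = b.
Proof. by move=> [_ <-] [_ <-]. Qed.

End pointwise_derivatives.

(** [|d|] need not be differentiable, so the argument runs with [d ^ 2 expR (c (z - a))]: for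
    [c = - 2 L] it is nonincreasing, for [c = 2 L] nondecreasing. Both bounds are needed, since
    characteristics are compared forwards and backwards. *)
Lemma gronwall (R : realType) (d d' : R -> R) (a b L : R) :
  a <= b -> (forall x, a <= x <= b -> is_derive x 1 d (d' x)) ->
  (forall x, a <= x <= b -> `|d' x| <= L * `|d x|) ->
  `|d b| <= expR (L * (b - a)) * `|d a| /\ `|d a| <= expR (L * (b - a)) * `|d b|.
Proof.
move=> ab dd dL.
have dE (c x : R) : a <= x <= b ->
    is_derive x 1 (fun z => (d z * d z) * expR (c * (z - a)))
      ((2 * d x * d' x + c * (d x * d x)) * expR (c * (x - a))).
  move=> xab; apply: der_eq (der_mul (der_mul (dd x xab) (dd x xab))
    (der_comp (is_derive_expR _) (der_affine x c a))) _; ring.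
have key x : a <= x <= b -> `|d x * d' x| <= L * (d x * d x).
  move=> xab; rewrite normrM; apply: le_trans (ler_wpM2l (normr_ge0 _) (dL x xab)) _.
  by rewrite mulrCA -normrM ger0_norm ?sqr_ge0// -expr2 sqr_ge0.
have sq (u w : R) (k : R) : u * u <= expR (k * 2) * (w * w) -> `|u| <= expR k * `|w|.
  move=> h; rewrite -(@ler_pXn2r _ 2) ?nnegrE ?mulr_ge0 ?expR_ge0//.
  rewrite exprMn -!normrX !ger0_norm ?sqr_ge0// -expRM_natr !expr2.
  exact: h.
split; apply: sq.
- have : - ((d a * d a) * expR (- (2 * L) * (a - a))) <=
      - ((d b * d b) * expR (- (2 * L) * (b - a))).
    apply: (@le_of_derive _ (fun z => - ((d z * d z) * expR (- (2 * L) * (z - a))))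
    (fun x => - ((2 * d x * d' x + - (2 * L) * (d x * d x)) * expR (- (2 * L) * (x - a)))))
      => // x xab.
      by apply: is_deriveN; exact: dE.
    rewrite -mulNr mulr_ge0 ?expR_ge0//.
    have := key x xab; rewrite ler_norml => /andP[]; lra.
  rewrite subrr mulr0 expR0 mulr1 lerN2 => h.
  have -> : d b * d b = (d b * d b * expR (- (2 * L) * (b - a))) * expR (L * (b - a) * 2).
    by rewrite -mulrA -expRD (_ : _ + _ = 0) ?expR0 ?mulr1//; ring.
  by rewrite mulrC ler_wpM2l ?expR_ge0.
- have : (d a * d a) * expR ((2 * L) * (a - a)) <=
      (d b * d b) * expR ((2 * L) * (b - a)).
    apply: (@le_of_derive _ (fun z => (d z * d z) * expR ((2 * L) * (z - a)))
    (fun x => (2 * d x * d' x + (2 * L) * (d x * d x)) * expR ((2 * L) * (x - a)))) => // x xab.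
    rewrite mulr_ge0 ?expR_ge0//.
    have := key x xab; rewrite ler_norml => /andP[]; lra.
  rewrite subrr mulr0 expR0 mulr1 => h; apply: le_trans h _.
  by rewrite mulrC (_ : 2 * L * (b - a) = L * (b - a) * 2)//; ring.
Qed.

Lemma le_of_eq (R : realType) (a b : R) : a = b -> a <= b.
Proof. by move=> ->. Qed.

Lemma le_of_geo (R : realType) (a b c : R) :
  (forall n : nat, a <= b + c / 2 ^+ n) -> a <= b.
Proof.
move=> h; apply/ler_addgt0Pr => e e0.
have c0 : 0 <= `|c| / e by rewrite divr_ge0// ltW.
have := archi_boundP c0; set n := Num.bound _ => nb.
apply: le_trans (h n) _; rewrite lerD2l ler_pdivrMr ?exprn_gt0//.
apply: le_trans (ler_norm c) _.
rewrite -ler_pdivrMl// mulrC; apply: ltW (lt_le_trans nb _).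
by rewrite -natrX ler_nat ltnW// ltn_expl.
Qed.

(** [a] increases, [b] decreases and every [a m] is below every [b n], so the supremum of [a] lies
    in all the intervals; this gives the limit together with its rate. *)
Lemma geometric_limit (R : realType) (u : nat -> R) (C : R) :
  (forall n, `|u n.+1 - u n| <= C / 2 ^+ n) ->
  exists l, forall n, `|l - u n| <= 2 * C / 2 ^+ n.
Proof.
move=> uC.
pose a n := u n - 2 * C / 2 ^+ n; pose b n := u n + 2 * C / 2 ^+ n.
have C0 : 0 <= C by have := uC 0%N; rewrite expr0 divr1; apply: le_trans.
have h n : 2 * C / 2 ^+ n.+1 = C / 2 ^+ n :> R.
  by rewrite exprS; field; rewrite expf_neq0.
have h2 n : 2 * C / 2 ^+ n = C / 2 ^+ n + C / 2 ^+ n :> R.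
  by field; rewrite expf_neq0.
have amono : {homo a : n m / (n <= m)%N >-> n <= m}.
  apply: homo_leq => [//|x y z|n]; first exact: le_trans.
  rewrite /a h h2; have := uC n; rewrite ler_norml => /andP[]; lra.
have bmono : {homo b : n m / (n <= m)%N >-> m <= n}.
  apply: homo_leq => [//|x y z yx zy|n]; first exact: le_trans zy yx.
  rewrite /b h h2; have := uC n; rewrite ler_norml => /andP[]; lra.
have ab m n : a m <= b n.
  apply: le_trans (amono _ _ (leq_maxl m n)) _.
  apply: le_trans (bmono _ _ (leq_maxr m n)).
  by rewrite /a /b lerD2l ge0_cp// divr_ge0 ?exprn_ge0 ?mulr_ge0.
pose A := [set a n | n in [set: nat]].
have hA : has_sup A.
  split; first by exists (a 0%N), 0%N.
  by exists (b 0%N) => _ [m _ <-]; exact: ab.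
exists (sup A) => n; rewrite ler_distl; apply/andP; split.
  by apply: ub_le_sup; [case: hA|exists n].
by apply: ge_sup; [case: hA|move=> _ [m _ <-]; exact: ab].
Qed.

Lemma der_expR_affine (R : realType) (C k y0 x : R) :
  is_derive x 1 (fun z => C * expR (k * (z - y0))) (C * (expR (k * (x - y0)) * k)).
Proof. exact: der_scale (der_comp (is_derive_expR _) (der_affine x k y0)). Qed.

(** In the norm weighted by [expR (k |y - y0|)] integration from [y0] gains a factor [1 / k] on the
    whole line at once. The Picard map is then a contraction without any shrinking of the
    interval. *)
Lemma exp_norm_bound (R : realType) (F F' : R -> R) (y0 C k : R) :
  0 <= C -> F y0 = 0 -> (forall y : R, is_derive y 1 F (F' y)) ->
  (forall y, `|F' y| <= C * k * expR (k * `|y - y0|)) ->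
  forall y, `|F y| <= C * expR (k * `|y - y0|).
Proof.
move=> C0 F0 dF bF y; have [y0y|yy0] := leP y0 y.
  have : `|F y - F y0| <= C * expR (k * (y - y0)) - C * expR (k * (y0 - y0)).
    apply: (@norm_le_of_derive _ _ F' (fun z => C * expR (k * (z - y0)))
      (fun z => C * (expR (k * (z - y0)) * k))) => // x /andP[xy0 _].
      exact: der_expR_affine.
    by apply: le_trans (bF x) _; rewrite ger0_norm ?subr_ge0// mulrAC mulrA.
  rewrite F0 subr0 subrr mulr0 expR0 mulr1 [`|y - y0|]ger0_norm ?subr_ge0//; lra.
have : `|F y0 - F y| <= - C * expR (- k * (y0 - y0)) - - C * expR (- k * (y - y0)).
  apply: (@norm_le_of_derive _ _ F' (fun z => - C * expR (- k * (z - y0)))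
      (fun z => - C * (expR (- k * (z - y0)) * - k))) => [|//|]; first exact: ltW.
    by move=> x xy0; exact: der_expR_affine.
  move=> x /andP[_ xy0]; apply: le_trans (bF x) _.
  rewrite ler0_norm ?subr_le0// (_ : k * - (x - y0) = - k * (x - y0)); last by ring.
  by apply: le_of_eq; ring.
rewrite F0 sub0r normrN subrr mulr0 expR0 mulr1 [`|y - y0|]ltr0_norm ?subr_lt0//.
move=> h; apply: le_trans h _.
have -> : k * - (y - y0) = - k * (y - y0) by ring.
lra.
Qed.

Section ode.
Variables (R : realType) (f : R * R -> R) (L M : R).
Hypothesis fL : forall p q, `|f p - f q| <= L * (`|p.1 - q.1| + `|p.2 - q.2|).
Hypothesis fM : forall p, `|f p| <= M.

Lemma ode_field_continuous (X : R -> R) :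
  continuous X -> continuous (fun y => f (y, X y)).
Proof.
move=> cX y; apply/cvgrPdist_le => e e0.
have L0 : 0 <= `|L| + 1 by rewrite addr_ge0.
have L1 : 0 < `|L| + 1 by rewrite ltr_pwDr.
near=> z; apply: le_trans (fL _ _) _ => /=.
have : `|y - z| <= e / (2 * (`|L| + 1)).
  near: z; apply: (@cvgr_dist_le _ _ _ (nbhs y) _ id); first exact: cvg_id.
  by rewrite divr_gt0// mulr_gt0.
have : `|X y - X z| <= e / (2 * (`|L| + 1)).
  near: z; apply: (@cvgr_dist_le _ _ _ (nbhs y) _ X); first exact: cX.
  by rewrite divr_gt0// mulr_gt0.
move=> h1 h2; apply: le_trans (_ : (`|L| + 1) * (e / (2 * (`|L| + 1)) + e / (2 * (`|L| + 1))) <= _).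
  apply: ler_pM => //.
  - by have := le_trans (normr_ge0 _) (fL (0, 0) (1, 0)); rewrite /= subrr normr0 addr0 sub0r normrN1 mulr1.
  - by rewrite (le_trans (ler_norm _))// lerDl.
  - exact: lerD.
by apply: le_of_eq; field; rewrite gt_eqF.
Unshelve. all: by end_near. Qed.

(** The value [cst 0] at discontinuous [h] only makes [prim] total, so that the iteration can be
    defined before its terms are known to be continuous. *)
Let prim (h : R -> R) : R -> R :=
  if pselect (continuous h) is left c then sval (cid (primitive_exists c)) else cst 0.

Let primP h : continuous h -> forall y : R, is_derive y 1 (prim h) (h y).
Proof.
by move=> ch; rewrite /prim; case: pselect => // c; exact: (svalP (cid (primitive_exists c))).
Qed.

Variables (y0 s : R).

Let P (X : R -> R) (y : R) := let H := prim (fun y => f (y, X y)) in s + H y - H y0.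

Let PP X : continuous X -> forall y : R, is_derive y 1 (P X) (f (y, X y)).
Proof.
move=> cX y; have := primP (ode_field_continuous cX) y => d.
by apply: der_eq (der_sub (der_add (der_cst y s) d) (der_cst y _)) _; ring.
Qed.

Let P0 X : P X y0 = s. Proof. by rewrite /P addrK. Qed.

Fixpoint picard n := if n is n'.+1 then P (picard n') else cst s.

Let cpicard n : continuous (picard n).
Proof.
elim: n => [|n IH] /=; first by move=> y; exact: cvg_cst.
by move=> y; exact: der_continuous (PP IH y).
Qed.

Let dpicard n (z : R) : is_derive z 1 (picard n.+1) (f (z, picard n z)).
Proof. exact: PP. Qed.

Let dpicard0 (z : R) : is_derive z 1 (picard 0) 0.
Proof. exact: der_cst. Qed.

Lemma ode_exists : exists X : R -> R,
  X y0 = s /\ forall y : R, is_derive y 1 X (f (y, X y)).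
Proof.
have L0 : 0 <= L.
  by have := le_trans (normr_ge0 _) (fL (0, 0) (1, 0)); rewrite /= subrr normr0 addr0 sub0r normrN1 mulr1.
have M0 : 0 <= M by exact: le_trans (fM 0).
(* The [+ 1] keeps the weight positive when [L = 0]. With [k = 2 K] each iteration halves the
   distance; [A = M / k] bounds the first step, whose derivative is at most [M]. *)
pose K := L + 1; have K0 : 0 < K by rewrite /K; lra.
pose k := 2 * K; have k0 : 0 < k by rewrite mulr_gt0.
pose A := M / k; have A0 : 0 <= A by rewrite divr_ge0// ltW.
pose W y := expR (k * `|y - y0|).
have W1 y : 1 <= W y by rewrite -expR0 ler_expR mulr_ge0// ltW.
have fK (y a b : R) : `|f (y, a) - f (y, b)| <= K * `|a - b|.
  apply: le_trans (fL _ _) _; rewrite /= subrr normr0 add0r.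
  by rewrite ler_wpM2r// /K lerDl.
have step n y : `|picard n.+1 y - picard n y| <= A * W y / 2 ^+ n.
  elim: n y => [|n IH] y.
    rewrite expr0 divr1.
    apply: (@exp_norm_bound _ (fun y => picard 1 y - picard 0 y)
      (fun y => f (y, picard 0 y) - 0)) => // [|z|z].
    - by rewrite /= P0 subrr.
    - exact: (der_sub (dpicard 0 z) (dpicard0 z)).
    - rewrite subr0; apply: le_trans (fM _) _.
      by rewrite /A divfK ?gt_eqF// ler_peMr//; exact: W1.
  have -> : A * W y / 2 ^+ n.+1 = A / 2 ^+ n.+1 * W y by ring.
  apply: (@exp_norm_bound _ (fun y => picard n.+2 y - picard n.+1 y)
      (fun y => f (y, picard n.+1 y) - f (y, picard n y))) => [|||z].
  - by rewrite divr_ge0.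
  - by rewrite /= !P0 subrr.
  - by move=> z; exact: (der_sub (dpicard n.+1 z) (dpicard n z)).
  - apply: le_trans (fK _ _ _) _.
    apply: le_trans (ler_wpM2l (ltW K0) (IH z)) _.
    apply: le_of_eq; rewrite /k /W exprS.
    by field; rewrite expf_neq0.
have /choice[X XP] : forall y, exists l, forall n, `|l - picard n y| <= 2 * (A * W y) / 2 ^+ n.
  by move=> y; apply: geometric_limit => n; exact: step.
have halfE n y : 2 * (A * W y) / 2 ^+ n.+1 = A * W y / 2 ^+ n.
  by rewrite exprS; field; rewrite expf_neq0.
(* The iterates are [M]-Lipschitz and this passes to the limit, so [X] is continuous and the
   integral operator [P] may be applied to it. *)
have lip_picard n a b : a <= b -> `|picard n.+1 b - picard n.+1 a| <= M * (b - a).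
  move=> ab.
  have -> : M * (b - a) = M * (b - a) - M * (a - a) by rewrite subrr mulr0 subr0.
  apply: (@norm_le_of_derive _ _ (fun y => f (y, picard n y)) (fun z => M * (z - a)) (cst M)) => //.
  by move=> x _; exact: der_affine.
have lipX a b : a <= b -> `|X b - X a| <= M * (b - a).
  move=> ab; apply: (@le_of_geo _ _ _ (A * W b + A * W a)) => n.
  have := lip_picard n a b ab; have := XP a n.+1; have := XP b n.+1.
  rewrite !halfE mulrDl.
  move=> h1 h2 h3.
  have -> : X b - X a =
    (X b - picard n.+1 b) + (picard n.+1 b - picard n.+1 a) - (X a - picard n.+1 a) by ring.
  apply: le_trans (ler_normB _ _) _; apply: le_trans (lerD (ler_normD _ _) (lexx _)) _.
  lra.
have cX : continuous X.
  move=> y; apply/cvgrPdist_le => e e0.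
  near=> z; have : `|X y - X z| <= M * `|y - z|.
    have [yz|zy] := leP y z.
      by rewrite distrC (distrC y) (ger0_norm (_ : 0 <= z - y)) ?subr_ge0// lipX.
    by rewrite (gtr0_norm (_ : 0 < y - z)) ?subr_gt0// lipX// ltW.
  move/le_trans; apply.
  apply: le_trans (_ : (M + 1) * (e / (M + 1)) <= _); last first.
    by rewrite mulrC divfK// gt_eqF// ltr_wpDl.
  apply: ler_pM => //; first by rewrite lerDl.
  near: z; apply: (@cvgr_dist_le _ _ _ (nbhs y) _ id); first exact: cvg_id.
  by rewrite divr_gt0// ltr_wpDl.
have XE y : X y = P X y.
  apply/eqP; rewrite -subr_eq0 -normr_le0.
  apply: (@le_of_geo _ _ _ (2 * (A * W y))) => n; rewrite add0r.
  have h1 : `|P X y - picard n.+1 y| <= A / 2 ^+ n * W y.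
    apply: (@exp_norm_bound _ (fun y => P X y - picard n.+1 y)
      (fun y => f (y, X y) - f (y, picard n y))) => [|||z].
    - by rewrite divr_ge0.
    - by rewrite /= !P0 subrr.
    - by move=> z; exact: (der_sub (PP cX z) (dpicard n z)).
    - apply: le_trans (fK _ _ _) _.
      apply: le_trans (ler_wpM2l (ltW K0) (XP z n)) _.
      by apply: le_of_eq; rewrite /k /W; ring.
  have := XP y n.+1.
  rewrite halfE.
  have -> : X y - P X y = (X y - picard n.+1 y) - (P X y - picard n.+1 y) by ring.
  move=> h2; apply: le_trans (ler_normB _ _) _; apply: le_trans (lerD h2 h1) _.
  by apply: le_of_eq; ring.
have XPX : X = P X by exact/funext.
exists X; split; first by rewrite XPX P0.
by move=> y; rewrite {1}XPX; exact: PP.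
Unshelve. all: by end_near. Qed.

End ode.

(** * Derivatives of Lipschitz functions *)

(** Absolute continuity is tested on intervals only: a null set is covered by half-open intervals of
    total length below [e / (C + 1)], whose [nu]-measures add up to at most [e]. *)
Lemma null_of_interval_bound (R : realType)
    (nu : {measure set (measurableTypeR R) -> \bar R}) (C : R) :
  (forall a b : R, a <= b -> (nu `]a, b]%classic <= (C * (b - a))%:E)%E) ->
  forall A, measurable A -> lebesgue_measure A = 0%E -> nu A = 0%E.
Proof.
move=> nuC A mA A0; apply/eqP; rewrite eq_le measure_ge0 andbT.
have C0 : 0 <= C.
  have := nuC 0 1 ler01; rewrite subr0 mulr1 => h.
  by rewrite -lee_fin; apply: le_trans h.
apply/lee_addgt0Pr => e e0; rewrite add0e.
have C1 : 0 < C + 1 by rewrite ltr_wpDl.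
have eC : 0 < e / (C + 1) by rewrite divr_gt0.
have : lebesgue_measure A \is a fin_num by rewrite A0.
move/lb_ereal_inf_adherent => /(_ _ eC)[_ [F [mF AF] <-]].
rewrite [X in (_ < X + _)%E](_ : _ = lebesgue_measure A) // A0.
rewrite add0e => sF.
apply: le_trans (_ : (\sum_(0 <= k <oo) nu (F k) <= _)%E).
  apply: measure_sigma_subadditive => //.
  by move=> i; apply: sub_sigma_algebra; exact: mF.
apply: le_trans (_ : (\sum_(0 <= k <oo) C%:E * wlength idfun (F k) <= _)%E).
  apply: lee_nneseries => // i _.
  have [[a b]/= _ <-] := mF i.
  have [ab|ba] := ltP a b.
    have ab' := ltW ab.
    by rewrite (wlength_itv_bnd idfun false false ab')/= -EFinM; exact: nuC.
  by rewrite set_itv_ge ?bnd_simp -?leNgt// measure0 wlength0 mule0.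
rewrite nneseriesZl; last by move=> i _; exact: wlength_ge0.
apply: le_trans (_ : (C%:E * (e / (C + 1))%:E <= _)%E).
  by apply: lee_wpmul2l => //; exact: ltW.
rewrite -EFinM lee_fin mulrCA ger_pMr// ler_pdivrMr// mul1r.
by rewrite lerDl.
Qed.

Lemma lipschitz_continuous (R : realType) (z : R -> R) (L : R) :
  (forall a b, `|z a - z b| <= L * `|a - b|) -> continuous z.
Proof.
move=> zL y; apply/cvgrPdist_le => e e0.
have L0 : 0 <= L by have := le_trans (normr_ge0 _) (zL 1 0); rewrite subr0 normr1 mulr1.
near=> x; apply: le_trans (zL _ _) _.
apply: le_trans (_ : (L + 1) * (e / (L + 1)) <= _); last first.
  by rewrite mulrC divfK// gt_eqF// ltr_wpDl.
apply: ler_pM => //; first by rewrite lerDl.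
near: x; apply: (@cvgr_dist_le _ _ _ (nbhs y) _ id); first exact: cvg_id.
by rewrite divr_gt0// ltr_wpDl.
Unshelve. all: by end_near. Qed.

(** [F = z + L t] is nondecreasing and defines a Lebesgue-Stieltjes measure; the measure of an
    interval is at most [2 L] times its length, so Radon-Nikodym applies, and subtracting [L] from
    the density of [F] gives that of [z]. The cut to []- N, N]] makes everything integrable. *)
Lemma lipschitz_density (R : realType) (z : R -> R) (L N : R) :
  (forall a b, `|z a - z b| <= L * `|a - b|) ->
  exists w : R -> R, lebesgue_measure.-integrable setT (EFin \o w) /\
    forall a b, - N <= a -> a <= b -> b <= N ->
      \int[lebesgue_measure]_(x in `]a, b]) w x = z b - z a.
Proof.
move=> zL; pose F t := z t + L * t.
have Fnd : nondecreasing F.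
  move=> a b ab; rewrite /F.
  have := zL a b; rewrite distrC (distrC a) (ger0_norm (_ : 0 <= b - a)) ?subr_ge0//.
  rewrite ler_norml => /andP[]; lra.
have cF : continuous F.
  move=> x; apply: cvgD; first exact: lipschitz_continuous zL x.
  by apply: cvgM; [exact: cvg_cst|exact: cvg_id].
have Frc : right_continuous F by move=> x; apply: cvg_at_right_filter; exact: cF.
pose Fc : cumulative R R := HB.pack F (isCumulative.Build R _ R F Fnd Frc).
pose nu : {measure set (measurableTypeR R) -> \bar R} := lebesgue_stieltjes_measure Fc.
have nuE a b : a <= b -> nu `]a, b]%classic = (F b - F a)%:E.
  move=> ab; have := @measurable_mu_extE _ R (ocitv_type R) (wlength Fc) _ (is_ocitv a b).
  by move=> h; apply: (etrans h); exact: (wlength_itv_bnd F false false ab).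
pose D : set (measurableTypeR R) := `]- N, N]%classic.
have mD : measurable D by exact: measurable_itv.
have nuD : (nu D < +oo)%E.
  have [NN|NN] := leP (- N) N; first by rewrite nuE// ltry.
  have -> : D = set0 by rewrite /D set_itv_ge// bnd_simp -leNgt ltW.
  by rewrite measure0.
pose nuf := mfrestr mD nuD.
have dom : nuf `<< (@lebesgue_measure R).
  apply/null_content_dominatesP => A mA A0.
  have /le_trans h : (nuf A <= nu A)%E.
    by rewrite /nuf /mfrestr/= /mrestr le_measure ?inE//; exact: measurableI.
  apply/eqP; rewrite eq_le measure_ge0 andbT h//.
  rewrite (@null_of_interval_bound R nu (L + L))// => a b ab.
  rewrite nuE// lee_fin /F.
  have := zL b a; rewrite (ger0_norm (_ : 0 <= b - a)) ?subr_ge0//.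
  rewrite ler_norml => /andP[]; lra.
have [f [f0 ffin fint fE]] := radon_nikodym_sigma_finite dom.
have fK : EFin \o (fine \o f) = f by apply/funext => x /=; rewrite fineK.
have cint : lebesgue_measure.-integrable D (cst L%:E).
  apply/integrableP; split; first exact: measurable_cst.
  rewrite integral_cst//= lebesgue_measure_itv/=.
  by case: ifP => _; rewrite ?mule0// -EFinD -EFinM ltry.
exists ((fine \o f) \- (cst L) \_ D); split.
  rewrite (_ : EFin \o _ = ((EFin \o (fine \o f)) \- ((cst L%:E) \_ D))%E); last first.
    by apply/funext => x /=; rewrite /patch; case: ifP => _; rewrite ?subr0 ?sube0 ?EFinB.
  apply: integrableB => //; first by rewrite fK.
  by apply/(integrable_mkcond _ mD).
move=> a b Na ab bN.
have abD : `]a, b] `<=` D.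
  by move=> x; rewrite /D /= !in_itv/= => /andP[ax xb]; rewrite (le_lt_trans Na ax) (le_trans xb bN).
have mab : measurable (`]a, b]%classic : set (measurableTypeR R)) by exact: measurable_itv.
transitivity (\int[lebesgue_measure]_(x in `]a, b]) (fine (f x) - L)).
  by apply: eq_Rintegral => x; rewrite inE /= => xab; rewrite patchE mem_set//; exact: abD.
have fi : lebesgue_measure.-integrable `]a, b] (EFin \o (fine \o f)).
  by rewrite fK; apply: integrableS fint.
rewrite RintegralB//; last first.
  by apply: integrableS cint.
rewrite Rintegral_cst//= lebesgue_measure_itv/= /Rintegral.
have -> : (\int[lebesgue_measure]_(x in `]a, b]) (fine (f x))%:E)%E = (F b - F a)%:E.
  transitivity (\int[lebesgue_measure]_(x in `]a, b]) f x)%E.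
    by apply: eq_integral => x _; rewrite fineK.
  rewrite -fE// -(nuE _ _ ab) /=.
  by apply: etrans (_ : nu (`]a, b]%classic `&` D) = _) => //; rewrite setIidl.
rewrite /= /F; case: ifPn => /=; rewrite lte_fin ?ab; first by move=> _; ring.
rewrite -leNgt => ba; have -> : a = b by apply/eqP; rewrite eq_le ab ba.
by ring.
Qed.

Lemma ae_sub d (T : measurableType d) (R : realType) (mu : {measure set T -> \bar R})
    (P Q : T -> Prop) : (forall x, P x -> Q x) ->
  {ae mu, forall x, P x} -> {ae mu, forall x, Q x}.
Proof. by apply: filterS; exact: (ae_filter_ringOfSetsType mu). Qed.

Section weak_derivative.
Variable R : realType.
Implicit Types (u : R -> R) (t L : R).
Local Notation mu := (@lebesgue_measure R).

Definition dquot u t (n : nat) : R := n.+1%:R * (u (t + n.+1%:R^-1) - u t).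

(* [fine] of a limsup: on Lipschitz functions it is the derivative almost everywhere, and it is measurable in all parameters at once. *)
Definition wder u t : R := fine (limn_esup (fun n => (dquot u t n)%:E)).

Lemma cvg_wder u t (l : R) : dquot u t @ \oo --> l -> wder u t = l.
Proof.
move=> ul; rewrite /wder; have h : (fun n => (dquot u t n)%:E) @ \oo --> l%:E.
  by apply: cvg_EFin; [exact: nearW|exact: ul].
by have [_ ->] := cvg_limn_einf_sup h.
Qed.

Lemma derive_dquot u t l : is_derive t 1 u l -> dquot u t @ \oo --> l.
Proof.
move=> [du ul].
have h : h^-1 *: ((u \o shift t) (h *: 1) - u t) @[h --> 0^'] --> l.
  by rewrite -ul; exact: du.
have := (cvgr_dnbhsP _ _ _).1 h (fun n => n.+1%:R^-1 : R).
have h0 : (forall n : nat, n.+1%:R^-1 != 0 :> R) /\ n.+1%:R^-1 @[n --> \oo] --> (0 : R).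
  split; first by move=> n; rewrite invr_neq0// pnatr_eq0.
  exact: cvg_harmonic.
move=> /(_ h0); apply: cvg_trans; apply: near_eq_cvg; near=> n.
by rewrite /dquot invrK /= /GRing.scale/= mulr1 [n.+1%:R^-1 + t]addrC.
Unshelve. all: by end_near. Qed.

Lemma derive_wder u t l : is_derive t 1 u l -> wder u t = l.
Proof. by move=> /derive_dquot /cvg_wder. Qed.

(** Valid at every point, whether or not [u] is differentiable there: all quotients lie in
    [[- L, L]], hence so does their upper limit, and [fine] meets no infinite value. This makes
    [wder] a bounded factor under every integral. *)
Lemma wder_bound u t L : (forall a b, `|u a - u b| <= L * `|a - b|) ->
  `|wder u t| <= L.
Proof.
move=> uL; have qL n : `|dquot u t n| <= L.
  rewrite /dquot normrM; apply: le_trans (ler_wpM2l (normr_ge0 _) (uL _ _)) _.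
  by rewrite addrAC subrr add0r mulrCA -normrM divff ?pnatr_eq0// normr1 mulr1.
have h1 : (limn_esup (fun n => (dquot u t n)%:E) <= L%:E)%E.
  rewrite limn_esup_lim; apply: lime_le; first exact: is_cvg_esups.
  apply: nearW => n; apply: ge_ereal_sup => _ [m _ <-].
  by rewrite lee_fin (le_trans (ler_norm _)).
have h2 : ((- L)%:E <= limn_esup (fun n => (dquot u t n)%:E))%E.
  rewrite limn_esup_lim; apply: lime_ge; first exact: is_cvg_esups.
  apply: nearW => n; apply: le_trans (_ : (dquot u t n)%:E <= _)%E.
    by rewrite lee_fin; have := qL n; rewrite ler_norml => /andP[].
  by apply: ereal_sup_ubound; exists n => /=.
rewrite /wder ler_norml -!lee_fin fineK ?h1 ?h2//.
by rewrite fin_numE; apply/andP; split; apply/eqP => E; rewrite E in h1 h2.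
Qed.

(** Rademacher's theorem in dimension one: by Lebesgue differentiation the density from
    [lipschitz_density] is the derivative almost everywhere. *)
Lemma lipschitz_density_derive u L (N : R) :
  (forall a b, `|u a - u b| <= L * `|a - b|) ->
  exists w : R -> R, [/\ mu.-integrable setT (EFin \o w),
    (forall a b, - N <= a -> a <= b -> b <= N ->
      \int[mu]_(x in `]a, b]) w x = u b - u a) &
    {ae mu, forall x : R, - N < x < N -> is_derive x 1 u (w x)}].
Proof.
move=> uL; have [w [wi wE]] := lipschitz_density N uL.
exists w; split => //.
have wl : locally_integrable setT w.
  split => //; first by case/integrableP : wi => /measurable_EFinP.
    exact: openT.
  move=> K _ cK; have /integrableP[mw] := wi; apply: le_lt_trans.
  apply: ge0_subset_integral => //; first exact: compact_measurable.
  by apply/measurable_EFinP; apply: measurableT_comp => //; exact/measurable_EFinP.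
have wi' y : mu.-integrable [set` Interval (BRight (- N)) (BRight y)] (EFin \o w).
  by apply: integrableS wi => //; exact: measurable_itv.
have := FTC1 wi' wl; apply: ae_sub.
move=> x + /andP[Nx xN].
move=> /(_ _)[|d1 d2]; first by rewrite /= lte_fin.
have := is_derive1P d1 d2 => d.
have d' : is_derive x 1 (fun y => (u y - u (- N)) + u (- N)) (w x).
  apply: der_eq (der_add _ (der_cst x _)) (addr0 _).
  apply: is_derive_near d; near=> y; apply: wE => //.
  - by apply: ltW; near: y; exact: lt_nbhsr.
  - by apply: ltW; near: y; exact: lt_nbhsl.
rewrite (_ : u = fun y => u y - u (- N) + u (- N))//.
by apply/funext => y; rewrite subrK.
Unshelve. all: by end_near. Qed.

Lemma wder_ae u L : (forall a b, `|u a - u b| <= L * `|a - b|) ->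
  {ae mu, forall x : R, is_derive x 1 u (wder u x)}.
Proof.
move=> uL.
have h (n : nat) : {ae mu, forall x : R, - n%:R < x < n%:R -> is_derive x 1 u (wder u x)}.
  have [w [_ _]] := lipschitz_density_derive n%:R uL.
  by apply: ae_sub => x h nx; have d := h nx; rewrite (derive_wder d).
have : {ae mu, forall x : R, forall n : nat, - n%:R < x < n%:R -> is_derive x 1 u (wder u x)}.
  by apply/ae_foralln.
apply: ae_sub => x /(_ (Num.bound `|x|).+1); apply.
by rewrite -ltr_norml (lt_trans (archi_boundP (normr_ge0 x)))// ltr_nat.
Qed.

Lemma measurable_wder u : measurable_fun setT u -> measurable_fun setT (wder u).
Proof.
move=> mu'; rewrite /wder; apply: measurableT_comp => //.
apply: measurable_fun_limn_esup => n; apply/measurable_EFinP.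
apply: measurable_funM => //; apply: measurable_funB => //.
by apply: measurableT_comp => //; exact: measurable_funD.
Qed.

Lemma wder_FTC u L a b : (forall a b, `|u a - u b| <= L * `|a - b|) -> a <= b ->
  \int[mu]_(x in `]a, b]) wder u x = u b - u a.
Proof.
move=> uL ab; pose N := `|a| + `|b| + 1.
have [w [wi wE wd]] := lipschitz_density_derive N uL.
have Na : - N <= a by rewrite /N; have := ler_norm (- a); have := normr_ge0 b; rewrite normrN; lra.
have Nb : b <= N by rewrite /N; have := ler_norm b; have := normr_ge0 a; lra.
rewrite -(wE a b Na ab Nb) /Rintegral; congr fine.
have cu : measurable_fun setT u by apply: continuous_measurable_fun; exact: lipschitz_continuous uL.
apply: ae_eq_integral => //.
- by apply/measurable_EFinP; apply: measurable_funTS; exact: measurable_wder.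
- by apply: measurable_funTS; case/integrableP : wi.
- apply: ae_sub wd => x h /=; rewrite in_itv/= => /andP[ax xb]; congr EFin.
  apply: derive_wder; apply: h; rewrite (le_lt_trans Na ax) (le_lt_trans xb)//.
  by rewrite /N; have := ler_norm b; have := normr_ge0 a; lra.
Qed.

End weak_derivative.

(** * Smooth bump functions *)

Lemma der_exp (R : realType) (f : R -> R) (x a : R) n : is_derive x 1 f a ->
  is_derive x 1 (fun z => f z ^+ n) (n%:R * f x ^+ n.-1 * a).
Proof.
move=> df; elim: n => [|n IH]; first by rewrite !mul0r; exact: (der_cst x 1).
have -> : (fun z => f z ^+ n.+1) = (fun z => f z * f z ^+ n).
  by apply/funext => z; rewrite exprS.
apply: der_eq (der_mul df IH) _; case: n {IH} => [|n] /=.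
  by rewrite expr0; ring.
by rewrite -[n.+2]addn2 -[n.+1]addn1 !natrD exprD; ring.
Qed.

Section partial_derivatives.
Variable R : realType.
Implicit Types (f : R * R -> R) (p : R * R).

Lemma partial_tP f p l :
  is_derive p (dir R true) f l <-> is_derive p.2 1 (fun t => f (p.1, t)) l.
Proof.
have E : (fun h : R => h^-1 *: ((f \o shift p) (h *: dir R true) - f p)) =
  (fun h : R => h^-1 *: (((fun t => f (p.1, t)) \o shift p.2) (h *: 1) - f (p.1, p.2))).
  apply/funext => h; congr (_ *: (f _ - f _)); last by case: p.
  case: p => a b; rewrite /dir/=.
  by apply: etrans (_ : (h *: 0 + a, h *: 1 + b) = _) => //; rewrite scaler0 add0r.
have Ed : derivable f p (dir R true) = derivable (fun t => f (p.1, t)) p.2 1.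
  by rewrite /derivable E.
have Ev : 'D_(dir R true) f p = 'D_1 (fun t => f (p.1, t)) p.2 by rewrite /derive E.
split=> -[d e].
  by split; [rewrite -Ed|rewrite -Ev].
by split; [rewrite Ed|rewrite Ev].
Qed.

Lemma partial_yP f p l :
  is_derive p (dir R false) f l <-> is_derive p.1 1 (fun y => f (y, p.2)) l.
Proof.
have E : (fun h : R => h^-1 *: ((f \o shift p) (h *: dir R false) - f p)) =
  (fun h : R => h^-1 *: (((fun y => f (y, p.2)) \o shift p.1) (h *: 1) - f (p.1, p.2))).
  apply/funext => h; congr (_ *: (f _ - f _)); last by case: p.
  case: p => a b; rewrite /dir/=.
  by apply: etrans (_ : (h *: 1 + a, h *: 0 + b) = _) => //; rewrite scaler0 add0r.
have Ed : derivable f p (dir R false) = derivable (fun y => f (y, p.2)) p.1 1.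
  by rewrite /derivable E.
have Ev : 'D_(dir R false) f p = 'D_1 (fun y => f (y, p.2)) p.1 by rewrite /derive E.
split=> -[d e].
  by split; [rewrite -Ed|rewrite -Ev].
by split; [rewrite Ed|rewrite Ev].
Qed.

End partial_derivatives.

Section smooth_functions.
Variable R : realType.

(** A whole tower of derivatives as witness: every mixed partial derivative of a tensor product is
    then a product of one term from each tower. *)
Definition smooth1 (f : R -> R) := exists F : nat -> R -> R,
  F 0%N = f /\ forall n (x : R), is_derive x 1 (F n) (F n.+1 x).

(** A class closed under differentiation consists of smooth functions: choice picks a derivative
    inside the class, and iteration yields the tower. *)
Lemma smooth1_closed (P : (R -> R) -> Prop) :
  (forall f, P f -> exists f', P f' /\ forall x : R, is_derive x 1 f (f' x)) ->
  forall f, P f -> smooth1 f.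
Proof.
move=> PD f Pf.
have /choice[next nextP] : forall g : {g | P g}, exists g' : {g | P g},
    forall x : R, is_derive x 1 (sval g) (sval g' x).
  by move=> [g Pg]; have [g' [Pg' dg]] := PD g Pg; exists (exist _ g' Pg').
exists (fun n => sval (iter n next (exist _ f Pf))); split.
  by [].
by move=> n x; exact: nextP.
Qed.

Lemma smooth_tensor (a b : R -> R) : smooth1 a -> smooth1 b ->
  smooth (fun p : R * R => a p.1 * b p.2).
Proof.
move=> [A [<- dA]] [B [<- dB]] ds.
have dT i j (c : bool) (p : R * R) :
    is_derive p (dir R c) (fun p => A i p.1 * B j p.2)
      (if c then A i p.1 * B j.+1 p.2 else A i.+1 p.1 * B j p.2).
  case: c; first by apply/partial_tP => /=; exact: der_scale (dB j _).
  apply/partial_yP => /=.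
  by apply: der_eq (der_mul (dA i _) (der_cst _ _)) _; rewrite mulr0 addr0.
have [i [j ->]] : exists i j, dpart ds (fun p => A 0%N p.1 * B 0%N p.2) = fun p => A i p.1 * B j p.2.
  elim: ds => [|c ds [i [j E]]]; first by exists 0%N, 0%N.
  exists (if c then i else i.+1), (if c then j.+1 else j); apply/funext => p /=.
  by rewrite E; have [_ ->] := dT i j c p; case: c.
split=> [p|c p]; last by have [] := dT i j c p.
apply: cvgM.
  apply: (@cvg_comp _ _ _ fst (A i)); first exact: cvg_fst.
  exact: der_continuous (dA i p.1).
apply: (@cvg_comp _ _ _ snd (B j)); first exact: cvg_snd.
exact: der_continuous (dB j p.2).
Qed.

(** The factor [x ^- k] makes the family stable under differentiation: the derivatives of the
    classical function [flat 0] are linear combinations of its members. *)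
Definition flat (k : nat) (x : R) : R := if 0 < x then x ^- k * expR (- x^-1) else 0.

(** From [expR (1 / x) = expR (1 / ((k + 1) x)) ^ (k + 1)] and [expR u >= 1 + u >= u]. A linear
    bound is what differentiability at 0 takes, since [flat k z / z = flat k.+1 z]. *)
Lemma flat_linear_bound k : exists C, forall x, `|flat k x| <= C * `|x|.
Proof.
exists (k.+1%:R ^+ k.+1) => x; rewrite /flat; case: ifPn => [x0|_]; last first.
  by rewrite normr0 mulr_ge0// exprn_ge0.
have k0 : 0 < k.+1%:R :> R by rewrite ltr0n.
have x0' := ltW x0; have xV0 : 0 <= x^-1 by rewrite invr_ge0.
have k0' := ltW k0.
rewrite (gtr0_norm x0) ger0_norm ?mulr_ge0 ?expR_ge0// ?invr_ge0 ?exprn_ge0//.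
rewrite ler_pdivrMl ?exprn_gt0// mulrCA mulrC -exprSr -exprMn.
rewrite expRN -[leRHS]invrK lef_pV2 ?posrE ?expR_gt0 ?invr_gt0 ?exprn_gt0 ?mulr_gt0//.
have -> : expR x^-1 = expR (x^-1 / k.+1%:R) ^+ k.+1.
  by rewrite -expRM_natr divfK// gt_eqF.
rewrite -exprVn lerXn2r ?nnegrE ?expR_ge0 ?invr_ge0 ?mulr_ge0//.
by rewrite invfM; apply: le_trans (expR_ge1Dx _); rewrite lerDr.
Qed.

Lemma flat_derive k (x : R) : is_derive x 1 (flat k) (flat k.+2 x - k%:R * flat k.+1 x).
Proof.
have [x0|x0|->] := ltgtP x 0.
- rewrite /flat !ltNge (ltW x0)/= mulr0 subr0.
  apply: (is_derive_near _ (der_cst x 0)).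
  near=> y; rewrite ltNge (_ : y <= 0)//.
  by apply: ltW; near: y; exact: lt_nbhsl.
- rewrite /flat x0.
  apply: (@is_derive_near _ (fun y => y ^- k * expR (- y^-1))).
    by near=> y; rewrite (_ : 0 < y)//; near: y; exact: lt_nbhsr.
  have xn0 : x != 0 by rewrite gt_eqF.
  have dV : is_derive x 1 (fun y : R => y^-1) (- x ^- 2).
    have := @is_deriveV R id x 1 1 xn0 (is_derive_id _ _).
    by rewrite /GRing.scale/= mulr1.
  have dVk : is_derive x 1 (fun y : R => y ^- k) (- k%:R * x ^- k.+1).
    have -> : (fun y : R => y ^- k) = (fun y => (y^-1) ^+ k).
      by apply/funext => y; rewrite exprVn.
    apply: der_eq (der_exp k dV) _.
    case: k => [|k] /=; first by rewrite oppr0 !mul0r.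
    by rewrite exprVn !exprS; field; rewrite xn0 expf_neq0.
  have dE : is_derive x 1 (fun y => expR (- y^-1)) (expR (- x^-1) * x ^- 2).
    have dN : is_derive x 1 (fun y : R => - y^-1) (x ^- 2).
      by rewrite -[x ^- 2]opprK; exact: is_deriveN.
    exact: (der_comp (is_derive_expR _) dN).
  apply: der_eq (der_mul dVk dE) _.
  rewrite !exprS; field; rewrite xn0 /=.
  by rewrite expf_neq0.
have f0 m : flat m 0 = 0 by rewrite /flat ltxx.
rewrite !f0 mulr0 subr0.
have [C CP] := flat_linear_bound k.+1.
have C0 : 0 <= C by have := le_trans (normr_ge0 _) (CP 1); rewrite normr1 mulr1.
have h : h^-1 *: ((flat k \o shift 0) (h *: (1:R)) - flat k 0) @[h --> 0^'] --> (0:R).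
  apply/cvgrPdist_le => e e0; near=> z.
  have z0 : z != 0 by near: z; exact: nbhs_dnbhs_neq.
  rewrite f0 subr0 sub0r normrN /= /GRing.scale/= mulr1 addr0.
  have -> : z^-1 * flat k z = flat k.+1 z.
    rewrite /flat; case: ifP => _; last by rewrite mulr0.
    by rewrite exprS invfM mulrA.
  apply: le_trans (CP _) _; apply: le_trans (_ : (C + 1) * (e / (C + 1)) <= _); last first.
    by rewrite mulrC divfK// gt_eqF// ltr_wpDl.
  apply: ler_pM => //; first by rewrite lerDl.
  near: z; apply: dnbhs0_le; by rewrite divr_gt0// ltr_wpDl.
by apply: DeriveDef; [apply/cvg_ex; exists 0|apply/cvg_lim].
Unshelve. all: by end_near. Qed.

End smooth_functions.

Section bump_functions.
Variable R : realType.
Variables (c a b : R).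

(** The linear span of the products of two flat functions facing each other from [a] and [b]: it
    contains the bump functions and is closed under differentiation. *)
Inductive flat_product : (R -> R) -> Prop :=
| FlatBase i j : flat_product (fun t => flat i (c * (t - a)) * flat j (- c * (t - b)))
| FlatAdd f g : flat_product f -> flat_product g -> flat_product (fun t => f t + g t)
| FlatScale k f : flat_product f -> flat_product (fun t => k * f t).

Lemma flat_product_smooth1 f : flat_product f -> smooth1 f.
Proof.
apply: smooth1_closed => {}f; elim => [i j|{}f g _ [f' [Pf df]] _ [g' [Pg dg]]|k {}f _ [f' [Pf df]]].
- pose e i j := (fun t => flat i (c * (t - a)) * flat j (- c * (t - b))).
  exists (fun t => (c * e i.+2 j t + (- c * i%:R) * e i.+1 j t) +
            (- c * e i j.+2 t + (c * j%:R) * e i j.+1 t)); split.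
    by repeat apply: FlatAdd; apply: FlatScale; exact: FlatBase.
  move=> x; apply: der_eq (der_mul (der_comp (flat_derive i _) (der_affine x c a))
    (der_comp (flat_derive j _) (der_affine x (- c) b))) _.
  by rewrite /e; ring.
- exists (fun t => f' t + g' t); split; first exact: FlatAdd.
  by move=> x; exact: der_add.
- exists (fun t => k * f' t); split; first exact: FlatScale.
  by move=> x; exact: der_scale.
Qed.

End bump_functions.

Section bump.
Variable R : realType.
Implicit Types (a b t : R).

(** [n] is a steepness: the support stays in [[a, b]] while the values inside tend to 1, so test
    integrals converge to integrals over open rectangles. *)
Definition bump (n : nat) a b t : R :=
  flat 0 (n.+1%:R * (t - a)) * flat 0 (- n.+1%:R * (t - b)).

Lemma smooth1_bump n a b : smooth1 (bump n a b).
Proof. by apply: (@flat_product_smooth1 R n.+1%:R a b); exact: FlatBase. Qed.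

Lemma flat0_bound t : 0 <= flat 0 t <= 1.
Proof.
rewrite /flat; case: ifPn => t0; last by rewrite lexx ler01.
by rewrite expr0 invr1 mul1r expR_ge0/= -expR0 ler_expR lerNl oppr0 invr_ge0 ltW.
Qed.

Lemma bump_bound n a b t : 0 <= bump n a b t <= 1.
Proof.
have /andP[h1 h2] := flat0_bound (n.+1%:R * (t - a)).
have /andP[h3 h4] := flat0_bound (- n.+1%:R * (t - b)).
by rewrite /bump mulr_ge0//= mulr_ile1.
Qed.

Lemma bump_out n a b t : ~~ (a < t < b) -> bump n a b t = 0.
Proof.
rewrite negb_and -!leNgt /bump => /orP[ta|bt].
  by rewrite {1}/flat ltNge pmulr_rle0// subr_le0 ta mul0r.
by rewrite {2}/flat ltNge mulNr oppr_le0 pmulr_rge0// subr_ge0 bt mulr0.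
Qed.

Lemma flat0_cvg (x : R) : 0 < x -> flat 0 (n.+1%:R * x) @[n --> \oo] --> (1 : R).
Proof.
move=> x0; have E n : flat 0 (n.+1%:R * x) = expR (- x^-1 * n.+1%:R^-1).
  by rewrite /flat mulr_gt0// expr0 invr1 mul1r invfM mulrC mulNr.
have h : expR (- x^-1 * n.+1%:R^-1) @[n --> \oo] --> expR (- x^-1 * 0).
  apply: continuous_cvg; first exact: continuous_expR.
  by apply: cvgM; [exact: cvg_cst|exact: cvg_harmonic].
by rewrite mulr0 expR0 in h; under eq_fun do rewrite E.
Qed.

Lemma bump_cvg a b t : bump n a b t @[n --> \oo] --> (\1_(`]a, b[%classic) t : R).
Proof.
have [tab|tab] := boolP (a < t < b); last first.
  rewrite indicE memNset/=; last by rewrite in_itv/=; exact/negP.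
  under eq_fun do rewrite bump_out//.
  exact: cvg_cst.
rewrite indicE mem_set/=; last by rewrite in_itv/=.
case/andP : tab => ta tb.
rewrite -(mulr1 1); apply: cvgM.
  by apply: flat0_cvg; rewrite subr_gt0.
under eq_fun do rewrite mulNr -mulrN opprB.
by apply: flat0_cvg; rewrite subr_gt0.
Qed.

Lemma test_fun_bump (Om : set (R * R)) n m a b c d :
  `[a, b]%classic `*` `[c, d]%classic `<=` Om ->
  test_fun Om (fun p => bump n a b p.1 * bump m c d p.2).
Proof.
move=> Q; split; first by apply: smooth_tensor; exact: smooth1_bump.
exists (`[a, b]%classic `*` `[c, d]%classic); split => //.
  by apply: compact_setX; exact: segment_compact.
move=> p /not_andP[] /= /negP; rewrite in_itv/= => h.
- rewrite (@bump_out n a b) ?mul0r//; apply: contra h => /andP[? ?].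
  by rewrite !ltW.
- rewrite (@bump_out m c d) ?mulr0//; apply: contra h => /andP[? ?].
  by rewrite !ltW.
Qed.

Lemma smooth1_continuous (f : R -> R) : smooth1 f -> continuous f.
Proof. by move=> [F [<- dF]] x; exact: der_continuous (dF 0%N x). Qed.

End bump.

(** * Integration by parts in the plane *)

Lemma invn_lt (R : realType) (e : R) : 0 < e -> exists n : nat, n.+1%:R^-1 < e.
Proof.
move=> e0; exists (Num.bound e^-1).
have h := archi_boundP (ltW (_ : 0 < e^-1)); rewrite invr_gt0 in h.
rewrite -[ltRHS]invrK ltf_pV2 ?posrE ?invr_gt0 ?ltr0n//.
by apply: lt_le_trans (h e0) _; rewrite ler_nat.
Qed.

Section plane_measurability.
Variable R : realType.
Local Notation mR := (measurableTypeR R).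

(** The product sigma-algebra is generated by rectangles, so an open set has to be exhibited as a
    countable union of them: boxes with rational centres and half-sides [1 / (n + 1)]. *)
Lemma open_measurable2 (U : set (R * R)) : open U -> measurable (U : set (mR * mR)).
Proof.
move=> oU.
pose box (q1 q2 : rat) (n : nat) : set (mR * mR) :=
  `]ratr q1 - n.+1%:R^-1, ratr q1 + n.+1%:R^-1[%classic `*`
  `]ratr q2 - n.+1%:R^-1, ratr q2 + n.+1%:R^-1[%classic.
pose G q1 q2 n : set (mR * mR) := if `[< box q1 q2 n `<=` U >] then box q1 q2 n else set0.
have -> : U = \bigcup_q1 \bigcup_q2 \bigcup_n G q1 q2 n.
  apply/seteqP; split => [p Up|p [q1 _ [q2 _ [n _]]]]; last first.
    by rewrite /G; case: ifPn => // /asboolP; exact.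
  have := oU; rewrite openE => /(_ _ Up)/nbhs_ballP[e /= e0 eU].
  have [n ne] : exists n : nat, n.+1%:R^-1 < e / 2.
    by apply: invn_lt; rewrite divr_gt0.
  have [d [dE d0 de]] : exists d, [/\ d = n.+1%:R^-1, 0 < d & d < e / 2].
    by exists n.+1%:R^-1; rewrite invr_gt0 ltr0n.
  have rat_near (x : R) : exists q, x - d < ratr q < x + d.
    have /rat_in_itvoo[q] : x - d < x + d by lra.
    by rewrite in_itv/= => h; exists q.
  have [q1 /andP[h1 h2]] := rat_near p.1; have [q2 /andP[h3 h4]] := rat_near p.2.
  exists q1 => //; exists q2 => //; exists n => //; rewrite /G.
  have bp : box q1 q2 n p.
    by rewrite /box -dE; split => /=; rewrite in_itv/=; apply/andP; split; lra.
  rewrite (_ : `[< _ >] = true)//; apply/asboolP => z; rewrite /box -dE => -[].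
  rewrite /= !in_itv/= => /andP[z1 z2] /andP[z3 z4]; apply: eU.
  by split; rewrite /ball/= ltr_norml; apply/andP; split; lra.
apply: bigcupT_measurable_rat => q1; apply: bigcupT_measurable_rat => q2.
apply: bigcupT_measurable => n; rewrite /G; case: ifP => // _.
by apply: measurableX; exact: measurable_itv.
Qed.

Lemma continuous_measurable2 (f : R * R -> R) : continuous f ->
  measurable_fun [set: mR * mR] f.
Proof.
move=> /continuousP cf; apply: (measurability _ (RGenOpens.measurableE R)).
move=> _ [_ [a [b ->] <-]]; rewrite setTI; apply: open_measurable2.
exact/cf/interval_open.
Qed.

End plane_measurability.

Section nice_functions.
Variable R : realType.
Local Notation mR := (measurableTypeR R).
Local Notation mu := (@lebesgue_measure R).
Local Notation mu2 := (@leb2 R).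

(** Bounded, measurable and zero far away: stable under the operations used below and always
    integrable, hence a class in which linearity and Fubini hold without side conditions. *)
Definition nice1 (f : R -> R) := measurable_fun [set: mR] f /\
  exists M N : R, (forall x, `|f x| <= M) /\ (forall x, N < `|x| -> f x = 0).

Definition nice2 (f : R * R -> R) := measurable_fun [set: mR * mR] f /\
  exists M N : R, (forall p, `|f p| <= M) /\
    (forall p, (N < `|p.1|) || (N < `|p.2|) -> f p = 0).

Lemma nice1_integrable f : nice1 f -> mu.-integrable setT (EFin \o f).
Proof.
move=> [mf [M [N [fM fN]]]]; apply/integrableP; split; first exact/measurable_EFinP.
have M0 : 0 <= M by exact: le_trans (fM 0).
pose D : set mR := `[- N, N]%classic.
have mD : measurable D by exact: measurable_itv.
apply: (@le_lt_trans _ _ (\int[mu]_x (M * \1_D x)%:E)%E).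
  apply: ge0_le_integral => //.
  - by apply: measurableT_comp => //; exact/measurable_EFinP.
  - by apply/measurable_EFinP; apply: measurable_funM => //; apply: measurable_indic.
  move=> x _; rewrite lee_fin indicE; case: (boolP (x \in D)) => [_|xD].
    by rewrite mulr1.
  rewrite mulr0 fN ?normr0//; move: xD; apply: contraNT; rewrite -leNgt ler_norml => h.
  by rewrite inE /D /= in_itv.
under eq_integral do rewrite EFinM.
rewrite ge0_integralZl//; last by apply/measurable_EFinP; apply: measurable_indic.
rewrite integral_indic//= setIT lebesgue_measure_itv/=.
by case: ifP => _; rewrite ?mule0 ?ltry// -EFinD -EFinM ltry.
Qed.

Lemma nice2_integrable f : nice2 f -> mu2.-integrable setT (EFin \o f).
Proof.
move=> [mf [M [N [fM fN]]]]; apply/integrableP; split; first exact/measurable_EFinP.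
have M0 : 0 <= M by exact: le_trans (fM 0).
pose D : set mR := `[- N, N]%classic.
have mD : measurable D by exact: measurable_itv.
apply: (@le_lt_trans _ _ (\int[mu2]_x (M * \1_(D `*` D) x)%:E)%E).
  apply: ge0_le_integral => //.
  - by apply: measurableT_comp => //; exact/measurable_EFinP.
  - apply/measurable_EFinP; apply: measurable_funM => //; apply: measurable_indic.
    exact: measurableX.
  move=> x _; rewrite lee_fin indicE; case: (boolP (x \in D `*` D)) => [_|xD].
    by rewrite mulr1.
  rewrite mulr0 fN ?normr0//; move: xD; apply: contraNT.
  rewrite negb_or -!leNgt !ler_norml => /andP[h1 h2].
  by rewrite inE /D; split; rewrite /= in_itv.
under eq_integral do rewrite EFinM.
rewrite ge0_integralZl//; last first.
  by apply/measurable_EFinP; apply: measurable_indic; exact: measurableX.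
rewrite integral_indic//=; last exact: measurableX.
rewrite setIT product_measure1E//= lebesgue_measure_itv/=.
by case: ifP => _; rewrite ?mule0 ?ltry// -EFinD -!EFinM ltry.
Qed.

Lemma nice2_slice1 f y : nice2 f -> nice1 (fun t => f (y, t)).
Proof.
move=> [mf [M [N [fM fN]]]]; split; first exact: measurable_fun_pair2.
by exists M, N; split => // x h; apply: fN; rewrite h orbT.
Qed.

Lemma nice2_slice2 f t : nice2 f -> nice1 (fun y => f (y, t)).
Proof.
move=> [mf [M [N [fM fN]]]]; split; first exact: (measurable_fun_pair1 t).
by exists M, N; split => // x h; apply: fN; rewrite h.
Qed.

Lemma EFin_Rintegral1 f : nice1 f -> (\int[mu]_x f x)%:E = (\int[mu]_x (f x)%:E)%E.
Proof.
move=> nf; rewrite /Rintegral fineK//; apply: integrable_fin_num => //.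
exact: nice1_integrable.
Qed.

Lemma EFin_Rintegral2 f : nice2 f -> (\int[mu2]_x f x)%:E = (\int[mu2]_x (f x)%:E)%E.
Proof.
move=> nf; rewrite /Rintegral fineK//; apply: integrable_fin_num => //.
exact: nice2_integrable.
Qed.

Lemma nice2_fubini f : nice2 f -> \int[mu2]_p f p = \int[mu]_y \int[mu]_t f (y, t).
Proof.
move=> nf; rewrite /Rintegral; congr fine.
rewrite -(integral12_prod_meas1 (nice2_integrable nf)).
by apply: eq_integral => y _; exact: (esym (EFin_Rintegral1 (nice2_slice1 y nf))).
Qed.

Lemma nice2_fubini' f : nice2 f -> \int[mu2]_p f p = \int[mu]_t \int[mu]_y f (y, t).
Proof.
move=> nf; rewrite /Rintegral; congr fine.
rewrite -(integral21_prod_meas1 (nice2_integrable nf)).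
by apply: eq_integral => y _; exact: (esym (EFin_Rintegral1 (nice2_slice2 y nf))).
Qed.

Lemma nice1M f (g : R -> R) C : nice1 f -> measurable_fun [set: mR] g -> (forall x, `|g x| <= C) ->
  nice1 (fun x => g x * f x).
Proof.
move=> [mf [M [N [fM fN]]]] mg gC; split; first exact: measurable_funM.
exists (C * M), N; split=> [x|x h]; last by rewrite fN// mulr0.
by rewrite normrM ler_pM.
Qed.

Lemma nice1Z f c : nice1 f -> nice1 (fun x => c * f x).
Proof. by move=> nf; apply: (@nice1M _ _ `|c|). Qed.

Lemma nice2D f g : nice2 f -> nice2 g -> nice2 (fun x => f x + g x).
Proof.
move=> [mf [M [N [fM fN]]]] [mg [M' [N' [gM gN]]]]; split; first exact: measurable_funD.
exists (M + M'), (Num.max N N'); split=> [x|x].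
  by apply: le_trans (ler_normD _ _) _; exact: lerD.
by move=> /orP[]; rewrite gt_max => /andP[h1 h2]; rewrite fN ?gN ?addr0 ?h1 ?h2 ?orbT.
Qed.

Lemma nice2M f (g : R * R -> R) C : nice2 f -> measurable_fun [set: mR * mR] g -> (forall x, `|g x| <= C) ->
  nice2 (fun x => g x * f x).
Proof.
move=> [mf [M [N [fM fN]]]] mg gC; split; first exact: measurable_funM.
exists (C * M), N; split=> [x|x h]; last by rewrite fN// mulr0.
by rewrite normrM ler_pM.
Qed.

Lemma nice2Z f c : nice2 f -> nice2 (fun x => c * f x).
Proof. by move=> nf; apply: (@nice2M _ _ `|c|). Qed.

Lemma nice1_intD f g : nice1 f -> nice1 g ->
  \int[mu]_x (f x + g x) = \int[mu]_x f x + \int[mu]_x g x.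
Proof. by move=> nf ng; rewrite RintegralD//; exact: nice1_integrable. Qed.

Lemma nice1_intZ f c : nice1 f -> \int[mu]_x (c * f x) = c * \int[mu]_x f x.
Proof. by move=> nf; rewrite RintegralZl//; exact: nice1_integrable. Qed.

Lemma nice2_intD f g : nice2 f -> nice2 g ->
  \int[mu2]_x (f x + g x) = \int[mu2]_x f x + \int[mu2]_x g x.
Proof. by move=> nf ng; rewrite RintegralD//; exact: nice2_integrable. Qed.

Lemma nice2_intZ f c : nice2 f -> \int[mu2]_x (c * f x) = c * \int[mu2]_x f x.
Proof. by move=> nf; rewrite RintegralZl//; exact: nice2_integrable. Qed.

Lemma nice2_swap f : nice2 f -> nice2 (fun p => f (p.2, p.1)).
Proof.
move=> [mf [M [N [fM fN]]]]; split.
  by apply: (measurableT_comp mf); apply: measurable_fun_pair; [exact: measurable_snd|exact: measurable_fst].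
by exists M, N; split => // -[a b] /= h; apply: fN; rewrite /= orbC.
Qed.

Lemma nice2_int_swap f : nice2 f -> \int[mu2]_p f (p.2, p.1) = \int[mu2]_p f p.
Proof. by move=> nf; rewrite (nice2_fubini (nice2_swap nf)) (nice2_fubini' nf). Qed.

End nice_functions.

Section integration_by_parts_weak.
Variable R : realType.
Local Notation mR := (measurableTypeR R).
Local Notation mu := (@lebesgue_measure R).
Local Notation mu2 := (@leb2 R).

(** The product [u psi] is Lipschitz and vanishes at both ends of an interval that contains the
    supports, so its [wder] integrates to 0; almost everywhere that [wder] is given by the product
    rule. *)
Lemma ibp1 (u psi psi' : R -> R) (L Mu : R) :
  (forall a b, `|u a - u b| <= L * `|a - b|) -> (forall a, `|u a| <= Mu) ->
  (forall x : R, is_derive x 1 psi (psi' x)) -> nice1 psi -> nice1 psi' ->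
  \int[mu]_x (wder u x * psi x + u x * psi' x) = 0.
Proof.
move=> uL uM dpsi [mpsi [Mq [N [psiM psiN]]]] [mpsi' [Mp [N' [psi'M psi'N]]]].
have psiL a b : `|psi a - psi b| <= Mp * `|a - b|.
  wlog ab : a b / a <= b.
    move=> H; have [/H//|ba] := leP a b.
    by rewrite distrC (distrC a); apply: H; exact: ltW.
  rewrite distrC (distrC a) (ger0_norm (_ : 0 <= b - a)) ?subr_ge0//.
  have -> : Mp * (b - a) = Mp * (b - a) - Mp * (a - a) by rewrite subrr mulr0 subr0.
  apply: (@norm_le_of_derive _ _ psi' (fun z => Mp * (z - a)) (cst Mp)) => //.
  by move=> x _; exact: der_affine.
have Mu0 : 0 <= Mu by exact: le_trans (uM 0).
have Mq0 : 0 <= Mq by exact: le_trans (psiM 0).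
pose z x := u x * psi x.
have zL a b : `|z a - z b| <= (Mu * Mp + Mq * L) * `|a - b|.
  have -> : z a - z b = u a * (psi a - psi b) + psi b * (u a - u b) by rewrite /z; ring.
  apply: le_trans (ler_normD _ _) _; rewrite !normrM mulrDl -!mulrA.
  by apply: lerD; apply: ler_pM.
pose N1 := Num.max 0 (Num.max N N').
have N10 : 0 <= N1 by rewrite le_max lexx.
pose D : set mR := `]- (N1 + 1), N1 + 1]%classic.
have out x : ~ D x -> psi x = 0 /\ psi' x = 0.
  move=> Dx; have h : N1 < `|x|.
    rewrite ltNge; apply/negP; rewrite ler_norml => /andP[h1 h2]; apply: Dx.
    by rewrite /D /= in_itv/=; apply/andP; split; lra.
  by split; [apply: psiN|apply: psi'N]; apply: le_lt_trans h; rewrite /N1 !le_max lexx ?orbT.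
have zD : z (N1 + 1) = 0 /\ z (- (N1 + 1)) = 0.
  by split; rewrite /z psiN ?mulr0// ?normrN ger0_norm ?addr_ge0//;
    apply: (@le_lt_trans _ _ N1); rewrite ?ltrDl// /N1 !le_max lexx ?orbT.
have N11 : - (N1 + 1) <= N1 + 1 by lra.
have := wder_FTC zL N11; rewrite zD.1 zD.2 subrr => <-.
rewrite [RHS]Rintegral_mkcond /Rintegral; congr fine.
have mD : measurable D by exact: measurable_itv.
have mwu : measurable_fun [set: mR] (wder u).
  apply: measurable_wder; apply: continuous_measurable_fun.
  exact: lipschitz_continuous uL.
have mu' : measurable_fun [set: mR] u.
  by apply: continuous_measurable_fun; exact: lipschitz_continuous uL.
apply: ae_eq_integral => //.
- apply/measurable_EFinP; apply: measurable_funD; exact: measurable_funM.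
- apply/measurable_EFinP; apply/(measurable_restrictT _ mD).
  by apply: measurable_funTS; apply: measurable_wder; exact: measurable_funM.
- apply: ae_sub (wder_ae uL) => x dx _; congr EFin.
  rewrite patchE; case: ifPn => [_|]; last first.
    by move=> /negP; rewrite inE => /out[-> ->]; rewrite !mulr0 addr0.
  by rewrite (derive_wder (der_mul dx (dpsi x))).
Qed.

Definition wder_t (u : R * R -> R) (p : R * R) := wder (fun t => u (p.1, t)) p.2.
Definition wder_y (u : R * R -> R) (p : R * R) := wder (fun y => u (y, p.2)) p.1.

Lemma measurable_wder_t (u : R * R -> R) : measurable_fun [set: mR * mR] u ->
  measurable_fun [set: mR * mR] (wder_t u).
Proof.
move=> mu'; rewrite /wder_t /wder; apply: measurableT_comp => //.
apply: measurable_fun_limn_esup => n; apply/measurable_EFinP.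
apply: measurable_funM => //; apply: measurable_funB => //.
  apply: (measurableT_comp mu'); apply: measurable_fun_pair; first exact: measurable_fst.
  by apply: measurable_funD => //; exact: measurable_snd.
by apply: (measurableT_comp mu'); apply: measurable_fun_pair; [exact: measurable_fst|exact: measurable_snd].
Qed.

Lemma measurable_wder_y (u : R * R -> R) : measurable_fun [set: mR * mR] u ->
  measurable_fun [set: mR * mR] (wder_y u).
Proof.
move=> mu'.
have mswap : measurable_fun [set: mR * mR] (fun p : mR * mR => (p.2, p.1)).
  by apply: measurable_fun_pair; [exact: measurable_snd|exact: measurable_fst].
have h := measurableT_comp (measurable_wder_t (measurableT_comp mu' mswap)) mswap.
exact: h.
Qed.

Lemma ibp_t (u psi psit : R * R -> R) (L Mu : R) :
  measurable_fun [set: mR * mR] u ->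
  (forall y a b, `|u (y, a) - u (y, b)| <= L * `|a - b|) -> (forall p, `|u p| <= Mu) ->
  (forall p : R * R, is_derive p.2 1 (fun t => psi (p.1, t)) (psit p)) ->
  nice2 psi -> nice2 psit ->
  \int[mu2]_p (wder_t u p * psi p) = - \int[mu2]_p (u p * psit p).
Proof.
move=> mu' uL uM dpsi npsi npsit.
have n1 : nice2 (fun p => wder_t u p * psi p).
  by apply: (nice2M npsi (measurable_wder_t mu')) => p; apply: (@wder_bound _ _ _ L) => a b; exact: uL.
have n2 : nice2 (fun p => u p * psit p) by exact: (nice2M npsit mu' uM).
apply/eqP; rewrite -subr_eq0 opprK -nice2_intD//; apply/eqP.
rewrite nice2_fubini//; last exact: nice2D.
have key (y : R) : \int[mu]_t (wder_t u (y, t) * psi (y, t) + u (y, t) * psit (y, t)) = 0.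
  apply: (@ibp1 (fun t => u (y, t)) (fun t => psi (y, t)) (fun t => psit (y, t)) L Mu) => //.
  - by move=> x; exact: (dpsi (y, x)).
  - exact: nice2_slice1.
  - exact: nice2_slice1.
under eq_Rintegral do rewrite key.
by rewrite Rintegral_cst// mul0r.
Qed.

Lemma ibp_y (u psi psiy : R * R -> R) (L Mu : R) :
  measurable_fun [set: mR * mR] u ->
  (forall t a b, `|u (a, t) - u (b, t)| <= L * `|a - b|) -> (forall p, `|u p| <= Mu) ->
  (forall p : R * R, is_derive p.1 1 (fun y => psi (y, p.2)) (psiy p)) ->
  nice2 psi -> nice2 psiy ->
  \int[mu2]_p (wder_y u p * psi p) = - \int[mu2]_p (u p * psiy p).
Proof.
move=> mu' uL uM dpsi npsi npsiy.
have mswap : measurable_fun [set: mR * mR] (fun p : mR * mR => (p.2, p.1)).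
  by apply: measurable_fun_pair; [exact: measurable_snd|exact: measurable_fst].
have n1 : nice2 (fun p => wder_y u p * psi p).
  by apply: (nice2M npsi (measurable_wder_y mu')) => p; apply: (@wder_bound _ _ _ L) => a b; exact: uL.
have n2 : nice2 (fun p => u p * psiy p) by exact: (nice2M npsiy mu' uM).
rewrite -(nice2_int_swap n1) -(nice2_int_swap n2).
apply: (@ibp_t (fun p => u (p.2, p.1)) (fun p => psi (p.2, p.1)) (fun p => psiy (p.2, p.1)) L Mu) => //.
- exact: measurableT_comp mu' mswap.
- by move=> [a b]; exact: (dpsi (b, a)).
- exact: nice2_swap.
- exact: nice2_swap.
Qed.

End integration_by_parts_weak.

(** * The first variation of the area *)

(** Dynkin's theorem: the sets over whose preimage the integral vanishes are closed under
    complements and disjoint countable unions. The map [phi] allows its use in one coordinate at a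
    time. *)
Lemma integral_preimage_eq0 d d' (X : measurableType d) (T : measurableType d')
    (R : realType) (m : {measure set X -> \bar R}) (f : X -> \bar R) (D : set X)
    (phi : X -> T) (G : set (set T)) :
  setI_closed G -> G `<=` measurable -> measurable `<=` <<s G >> ->
  measurable_fun setT phi -> measurable D -> m.-integrable setT f ->
  (\int[m]_(x in D) f x = 0)%E ->
  (forall A, G A -> \int[m]_(x in D `&` phi @^-1` A) f x = 0)%E ->
  (forall A, measurable A -> \int[m]_(x in D `&` phi @^-1` A) f x = 0)%E.
Proof.
move=> GI Gm mG mphi mD fi D0 G0 A mA.
have mpre B : measurable B -> measurable (D `&` phi @^-1` B).
  by move=> mB; apply: measurableI => //; rewrite -[X in measurable X]setTI; exact: mphi.
pose H : set (set T) := [set B | measurable B /\ (\int[m]_(x in D `&` phi @^-1` B) f x = 0)%E].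
suff : H A by case.
have : <<s G >> A by exact: mG.
rewrite -(setI_closed_g_dynkin_g_sigma_algebra GI); apply: smallest_sub; last first.
  by move=> B GB; split; [exact: Gm|exact: G0].
split.
- by split => //; rewrite preimage_setT setIT.
- move=> B [mB B0]; split; first exact: measurableC.
  have : D = (D `&` phi @^-1` B) `|` (D `&` phi @^-1` (~` B)).
    by rewrite -setIUr -preimage_setU setUv preimage_setT setIT.
  move=> DE; rewrite DE integral_setU in D0.
  + by move: D0; rewrite B0 add0e.
  + exact: mpre.
  + by apply: mpre; exact: measurableC.
  + by apply: measurable_funTS; case/integrableP : fi.
  + by rewrite disj_set2E -setIIr -preimage_setI setICr preimage_set0 setI0.
- move=> F tF HF; split; first by apply: bigcupT_measurable => n; have [] := HF n.
  rewrite preimage_bigcup setI_bigcupr integral_bigcup.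
  + by rewrite eseries0// => n _ _; have [] := HF n.
  + move=> i j _ _ [x [[_ xi] [_ xj]]]; apply: tF => //; by exists (phi x).
  + by move=> n; apply: mpre; have [] := HF n.
  + apply: integrableS fi => //; apply: bigcupT_measurable => n.
    by apply: mpre; have [] := HF n.
Qed.

Section rectangles.
Variable R : realType.
Local Notation mR := (measurableTypeR R).
Local Notation mu2 := (@leb2 R).

Lemma opens_setI : setI_closed (@RGenOpens.G R).
Proof.
move=> _ _ [a [b ->]] [c [d ->]]; exists (Num.max a c), (Num.min b d).
by apply/seteqP; split=> x /=; rewrite !in_itv/= gt_max lt_min;
  [move=> [/andP[-> ->] /andP[-> ->]]|move=> /andP[/andP[-> ->] /andP[-> ->]]].
Qed.

(** Three applications of the Dynkin argument: the first side of the rectangle becomes an arbitrary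
    measurable set, then the second, and finally the rectangle an arbitrary measurable set of the
    plane. *)
Lemma ae_eq0_of_rectangles (f : R * R -> \bar R) (N : R) :
  mu2.-integrable setT f ->
  (forall p, ~ (`]- N, N[%classic `*` `]- N, N[%classic) p -> f p = 0%E) ->
  (forall a b c d : R, \int[mu2]_(p in `]a, b[%classic `*` `]c, d[%classic) f p = 0)%E ->
  ae_eq mu2 setT f (cst 0%E).
Proof.
move=> fi fN f0.
(* Since [f] lives in the square, the whole line can be traded for []- N, N[], which the hypothesis
   on open rectangles covers. *)
have supp (A B : set (R * R)) :
    (forall p, (`]- N, N[%classic `*` `]- N, N[%classic) p -> A p <-> B p) ->
    (\int[mu2]_(p in A) f p = \int[mu2]_(p in B) f p)%E.
  move=> AB; rewrite integral_mkcond [RHS]integral_mkcond; apply: eq_integral => p _.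
  rewrite !patchE; have [pN|/fN->] := pselect ((`]- N, N[%classic `*` `]- N, N[%classic) p).
    have [h1 h2] := AB p pN.
    by case: ifPn; case: ifPn => //; rewrite ?notin_setE !inE; tauto.
  by case: ifP; case: ifP.
have mitv (c d : R) : measurable (`]c, d[%classic : set mR) by exact: measurable_itv.
have Gm : @RGenOpens.G R `<=` (measurable : set (set mR)).
  by move=> _ [a [b ->]]; exact: mitv.
have mG : (measurable : set (set mR)) `<=` <<s @RGenOpens.G R >>.
  by move=> A mA; have := mA; rewrite [measurable]RGenOpens.measurableE.
have S1 (A : set mR) c d : measurable A ->
    (\int[mu2]_(p in A `*` `]c, d[%classic) f p = 0)%E.
  move=> mA; have -> : A `*` `]c, d[%classic = (setT `*` `]c, d[%classic) `&` fst @^-1` A.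
    by apply/seteqP; split => -[y t] /=; tauto.
  apply: (@integral_preimage_eq0 _ _ _ mR _ mu2 f _ fst (@RGenOpens.G R)) => //.
  - exact: opens_setI.
  - by apply: measurableX.
  - rewrite -[RHS](f0 (- N) N c d); apply: supp => -[y t] [/= h1 h2]; tauto.
  - move=> _ [a [b ->]]; rewrite -[RHS](f0 a b c d); congr (integral _ _ _).
    by apply/seteqP; split => -[y t] /=; tauto.
have S2 (A B : set mR) : measurable A -> measurable B ->
    (\int[mu2]_(p in A `*` B) f p = 0)%E.
  move=> mA mB; have -> : A `*` B = (A `*` setT) `&` snd @^-1` B.
    by apply/seteqP; split => -[y t] /=; tauto.
  apply: (@integral_preimage_eq0 _ _ _ mR _ mu2 f _ snd (@RGenOpens.G R)) => //.
  - exact: opens_setI.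
  - by apply: measurableX.
  - rewrite -[RHS](S1 A (- N) N mA); apply: supp => -[y t] [/= h1 h2]; tauto.
  - move=> _ [a [b ->]]; rewrite -[RHS](S1 A a b mA); congr (integral _ _ _).
    by apply/seteqP; split => -[y t] /=; tauto.
pose G : set (set (mR * mR)) := [set A `*` B | A in measurable & B in measurable].
have S3 (E : set (mR * mR)) : measurable E -> (\int[mu2]_(p in E) f p = 0)%E.
  move=> mE; rewrite -(setTI E).
  apply: (@integral_preimage_eq0 _ _ _ (mR * mR)%type _ mu2 f _ id G) => //.
  - move=> _ _ [A mA [B mB <-]] [C mC [D mD <-]]; exists (A `&` C); first exact: measurableI.
    exists (B `&` D); first exact: measurableI.
    by apply/seteqP; split => -[y t] /=; tauto.
  - by move=> _ [A mA [B mB <-]]; exact: measurableX.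
  - by move=> F mF; have := mF; rewrite [measurable]measurable_prod_measurableType.
  - by rewrite -(S2 setT setT) // -setXTT.
  - by move=> _ [A mA [B mB <-]]; rewrite setTI; exact: S2.
apply: integral_ae_eq => // E _ mE.
by rewrite S3// integral0.
Qed.

End rectangles.

Section compact_support.
Variable R : realType.
Local Notation mR := (measurableTypeR R).
Local Notation mu := (@lebesgue_measure R).
Local Notation mu2 := (@leb2 R).

Lemma compact_bounded2 (K : set (R * R)) : compact K ->
  exists N : R, forall p, K p -> `|p.1| <= N /\ `|p.2| <= N.
Proof.
move=> cK; have [N [_ NK]] := compact_bounded cK.
exists (N + 1) => p Kp; have := NK (N + 1); rewrite ltrDl => /(_ ltr01 p Kp).
by rewrite /= prod_normE/= ge_max => /andP[].
Qed.

Lemma continuous_nice2 (F : R * R -> R) (K : set (R * R)) :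
  continuous F -> compact K -> (forall p, ~ K p -> F p = 0) -> nice2 F.
Proof.
move=> cF cK F0; split; first exact: continuous_measurable2.
have [N NK] := compact_bounded2 cK.
have : compact (F @` K) by apply: continuous_compact => //; exact: continuous_subspaceT.
move=> /compact_bounded[M [_ MF]].
exists (Num.max (M + 1) 0), N; split => p.
  have [Kp|/F0->] := pselect (K p); last by rewrite normr0 le_max lexx orbT.
  rewrite le_max; apply/orP; left; apply: (MF (M + 1)); first by rewrite ltrDl.
  by exists p.
move=> h; apply: F0 => /NK[h1 h2]; move: h; rewrite !ltNge h1 h2.
by [].
Qed.

Lemma partial_vanish (F : R * R -> R) (K : set (R * R)) (b : bool) p :
  closed K -> (forall p, ~ K p -> F p = 0) -> ~ K p -> 'D_(dir R b) F p = 0.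
Proof.
move=> cK F0 Kp; have d0 : is_derive p (dir R b) (cst 0 : R * R -> R) 0 by exact: is_derive_cst.
have nK : \forall q \near p, cst 0 q = F q.
  have := closed_openC cK; rewrite openE => /(_ p Kp).
  by apply: filterS => q /F0 ->.
have v0 : dir R b != 0.
  by apply/eqP => -[]; case: b {d0} => -[] /eqP; rewrite oner_eq0.
have [_ //] := near_eq_is_derive nK d0.
Qed.

Lemma smooth_pd (F : R * R -> R) : smooth F ->
  [/\ continuous F, continuous (pd_y F), continuous (pd_t F),
    forall p : R * R, is_derive p.1 1 (fun y => F (y, p.2)) (pd_y F p) &
    forall p : R * R, is_derive p.2 1 (fun t => F (p.1, t)) (pd_t F p)].
Proof.
move=> sF; have [c0 d0] := sF [::]; have [c1 _] := sF [:: false]; have [c2 _] := sF [:: true].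
split; [exact: c0|exact: c1|exact: c2| |] => p.
  by apply/partial_yP; apply: DeriveDef => //; exact: (d0 false p).
by apply/partial_tP; apply: DeriveDef => //; exact: (d0 true p).
Qed.

Lemma integral_supported (A : set (R * R)) (F G : R * R -> R) :
  (forall p, A p -> F p = G p) -> (forall p, ~ A p -> G p = 0) ->
  (\int[mu2]_(p in A) (F p)%:E = \int[mu2]_p (G p)%:E)%E.
Proof.
move=> AF G0; rewrite integral_mkcond; apply: eq_integral => p _; rewrite patchE.
case: ifPn => [|/negP]; rewrite inE => Ap; first by rewrite AF.
by rewrite G0.
Qed.

(** Dominated convergence: the bumps tend to the indicator of the open rectangle, and [|G|]
    dominates. *)
Lemma rectangle_of_bumps (G : R * R -> R) (a b c d : R) :
  mu2.-integrable setT (EFin \o G) ->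
  (forall n, \int[mu2]_p (G p * (bump n a b p.1 * bump n c d p.2))%:E = 0)%E ->
  (\int[mu2]_(p in `]a, b[%classic `*` `]c, d[%classic) (G p)%:E = 0)%E.
Proof.
move=> Gi G0; set A := _ `*` _.
have mG : measurable_fun [set: mR * mR] G by case/integrableP : Gi => /measurable_EFinP.
have mA : measurable (A : set (mR * mR)) by apply: measurableX; exact: measurable_itv.
have mb n : measurable_fun [set: mR * mR] (fun p => bump n a b p.1 * bump n c d p.2).
  apply: measurable_funM.
    apply: (measurableT_comp _ measurable_fst).
    by apply: continuous_measurable_fun; apply: smooth1_continuous; exact: smooth1_bump.
  apply: (measurableT_comp _ measurable_snd).
  by apply: continuous_measurable_fun; apply: smooth1_continuous; exact: smooth1_bump.
have [] := @dominated_convergence _ _ _ mu2 setT measurableT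
  (fun n p => (G p * (bump n a b p.1 * bump n c d p.2))%:E)
  (fun p => (G p * \1_A p)%:E) (fun p => `|(G p)%:E|%E).
- by move=> n; apply/measurable_EFinP; exact: measurable_funM.
- by apply/measurable_EFinP; apply: measurable_funM => //; exact: measurable_indic.
- apply: aeW => p _; apply: cvg_EFin; first exact: nearW.
  apply: cvgM; first exact: cvg_cst.
  have -> : \1_A p = \1_(`]a, b[%classic) p.1 * \1_(`]c, d[%classic) p.2 :> R.
    by rewrite /A !indicE in_setX; case: (_ \in _); case: (_ \in _); rewrite ?mulr1 ?mulr0.
  by apply: cvgM; exact: bump_cvg.
- by have := integrable_norm Gi.
- apply: aeW => p n _; rewrite /= lee_fin normrM ler_piMr// normrM.
  have /andP[h1 h2] := bump_bound n a b p.1; have /andP[h3 h4] := bump_bound n c d p.2.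
  by rewrite !ger0_norm// mulr_ile1.
move=> _ _ h.
have : (\int[mu2]_p (G p * \1_A p)%:E = 0)%E.
  rewrite -(cvg_lim _ h)//; apply: cvg_lim => //.
  rewrite (_ : [sequence _]_n = cst 0%E); first exact: cvg_cst.
  by apply/funext => n; exact: G0.
move=> <-; apply: integral_supported => p Ap.
  by rewrite indicE mem_set// mulr1.
by rewrite indicE memNset// mulr0.
Qed.

End compact_support.

(** The sum distance adds up exactly along paths of horizontal and vertical segments. It is compared
    with [edist] only where the hypothesis on [ell] and the final Lipschitz claims are
    translated. *)
Definition lip2 (R : realType) (V : R * R -> R) (L : R) :=
  forall p q, `|V p - V q| <= L * (`|p.1 - q.1| + `|p.2 - q.2|).

(* A pointwise representative of the paper's [B V], for [V] Lipschitz. *)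
Definition igrad (R : realType) (V : R * R -> R) (p : R * R) : R :=
  wder_y V p - 2 * wder_t (fun q => V q ^+ 2) p.

Section intrinsic_gradient.
Variables (R : realType) (V : R * R -> R) (L M : R).
Hypotheses (VL : lip2 V L) (VM : forall p, `|V p| <= M).
Local Notation mR := (measurableTypeR R).
Local Notation mu := (@lebesgue_measure R).
Local Notation mu2 := (@leb2 R).

Lemma lip2_ge0 : 0 <= L.
Proof.
by have := le_trans (normr_ge0 _) (VL (0, 0) (1, 0)); rewrite /= subrr normr0 addr0 sub0r normrN1 mulr1.
Qed.

Lemma bound_ge0 : 0 <= M. Proof. exact: le_trans (VM 0). Qed.

Lemma lip2_y t a b : `|V (a, t) - V (b, t)| <= L * `|a - b|.
Proof. by have := VL (a, t) (b, t); rewrite /= subrr normr0 addr0. Qed.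

Lemma lip2_t y a b : `|V (y, a) - V (y, b)| <= L * `|a - b|.
Proof. by have := VL (y, a) (y, b); rewrite /= subrr normr0 add0r. Qed.

Lemma lip2_continuous : continuous V.
Proof.
move=> p; apply/cvgrPdist_le => e e0.
have L0 := lip2_ge0; have L1 : 0 < L + 1 by rewrite ltr_wpDl.
have e1 : 0 < e / (2 * (L + 1)) by rewrite divr_gt0// mulr_gt0.
near=> q; apply: le_trans (VL _ _) _.
have : `|p.1 - q.1| <= e / (2 * (L + 1)).
  near: q; apply: (@cvgr_dist_le _ _ _ (nbhs p) _ fst) => //; exact: cvg_fst.
have : `|p.2 - q.2| <= e / (2 * (L + 1)).
  near: q; apply: (@cvgr_dist_le _ _ _ (nbhs p) _ snd) => //; exact: cvg_snd.
move=> h1 h2; apply: le_trans (_ : (L + 1) * (e / (2 * (L + 1)) + e / (2 * (L + 1))) <= _).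
  by apply: ler_pM => //; [rewrite lerDl|exact: lerD].
by apply: le_of_eq; field; rewrite gt_eqF.
Unshelve. all: by end_near. Qed.

Lemma lip2_measurable : measurable_fun [set: mR * mR] V.
Proof. apply: continuous_measurable2; exact: lip2_continuous. Qed.

Lemma lip2_sqr_t y a b : `|V (y, a) ^+ 2 - V (y, b) ^+ 2| <= (2 * M * L) * `|a - b|.
Proof.
rewrite subr_sqr normrM mulrC -mulrA; apply: ler_pM => //; last exact: lip2_t.
by apply: le_trans (ler_normD _ _) _; rewrite mulr_natl mulr2n lerD.
Qed.

Lemma igrad_measurable : measurable_fun [set: mR * mR] (igrad V).
Proof.
apply: measurable_funB; first by apply: measurable_wder_y; exact: lip2_measurable.
apply: measurable_funM => //; apply: measurable_wder_t.
by apply: measurable_funX; exact: lip2_measurable.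
Qed.

Lemma igrad_bound p : `|igrad V p| <= L + 2 * (2 * M * L).
Proof.
apply: le_trans (ler_normB _ _) _; apply: lerD.
  by apply: wder_bound => a b; exact: lip2_y.
rewrite normrM (ger0_norm (_ : 0 <= 2))// ler_wpM2l//.
apply: (@wder_bound _ (fun t => V (p.1, t) ^+ 2)) => a b; exact: lip2_sqr_t.
Qed.

Lemma igrad_weak (psi psiy psit : R * R -> R) :
  (forall p : R * R, is_derive p.1 1 (fun y => psi (y, p.2)) (psiy p)) ->
  (forall p : R * R, is_derive p.2 1 (fun t => psi (p.1, t)) (psit p)) ->
  nice2 psi -> nice2 psiy -> nice2 psit ->
  \int[mu2]_p (igrad V p * psi p) = \int[mu2]_p (- V p * psiy p + 2 * V p ^+ 2 * psit p).
Proof.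
move=> dy dt n0 ny nt.
have mV := lip2_measurable.
have mV2 : measurable_fun [set: mR * mR] (fun q => V q ^+ 2) by exact: measurable_funX.
have V2M p : `|V p ^+ 2| <= M ^+ 2 by rewrite normrX lerXn2r ?nnegrE ?bound_ge0.
have h1 := ibp_y mV lip2_y VM dy n0 ny.
have h2 := ibp_t mV2 lip2_sqr_t V2M dt n0 nt.
have nwy : nice2 (fun p => wder_y V p * psi p).
  by apply: (nice2M n0 (measurable_wder_y mV)) => p; apply: wder_bound => a b; exact: lip2_y.
have nwt : nice2 (fun p => wder_t (fun q => V q ^+ 2) p * psi p).
  apply: (nice2M n0 (measurable_wder_t mV2)) => p.
  by apply: (@wder_bound _ (fun t => V (p.1, t) ^+ 2)) => a b; exact: lip2_sqr_t.
have n1 : nice2 (fun p => V p * psiy p) by exact: (nice2M ny mV VM).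
have n2 : nice2 (fun p => V p ^+ 2 * psit p) by exact: (nice2M nt mV2 V2M).
transitivity (\int[mu2]_p ((wder_y V p * psi p) + (-2) * (wder_t (fun q => V q ^+ 2) p * psi p))).
  by apply: eq_Rintegral => p _; rewrite /igrad; ring.
rewrite nice2_intD//; last exact: nice2Z.
rewrite nice2_intZ// h1 h2.
transitivity (\int[mu2]_p ((-1) * (V p * psiy p) + 2 * (V p ^+ 2 * psit p))); last first.
  by apply: eq_Rintegral => p _; ring.
rewrite nice2_intD//; [|exact: nice2Z|exact: nice2Z].
by rewrite !nice2_intZ//; ring.
Qed.

End intrinsic_gradient.

(** * Identification of the distribution [Bv] on a rectangle *)

Section fundamental.
Variables (R : realType) (Om : set (R * R)) (v g V : R * R -> R) (L M : R).
Hypotheses (oOm : open Om) (Bvg : Bweak Om v g) (VL : lip2 V L) (VM : forall p, `|V p| <= M).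
Variables (c1 c2 d1 d2 : R).
Local Notation Q := (`[c1, c2]%classic `*` `[d1, d2]%classic).
Hypotheses (QOm : Q `<=` Om) (vV : forall p, Q p -> v p = V p).
Local Notation mR := (measurableTypeR R).
Local Notation mu2 := (@leb2 R).

Lemma weak_gradient_igrad (psi : R * R -> R) (K : set (R * R)) :
  smooth psi -> compact K -> K `<=` Q -> (forall p, ~ K p -> psi p = 0) ->
  (\int[mu2]_(p in Om) (g p * psi p)%:E = (\int[mu2]_p (igrad V p * psi p))%:E)%E.
Proof.
move=> spsi cK KQ psi0.
have [c0 cy ct dy dt] := smooth_pd spsi.
have clK : closed K by apply: compact_closed => //.
have [_ /(_ psi) ->] := Bvg; last first.
  by split => //; exists K; split => //; exact: subset_trans QOm.
have y0 p : ~ K p -> pd_y psi p = 0 by move=> Kp; exact: (partial_vanish false clK psi0 Kp).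
have t0 p : ~ K p -> pd_t psi p = 0 by move=> Kp; exact: (partial_vanish true clK psi0 Kp).
have n0 := continuous_nice2 c0 cK psi0.
have ny := continuous_nice2 cy cK y0.
have nt := continuous_nice2 ct cK t0.
rewrite (igrad_weak VL VM dy dt n0 ny nt).
rewrite (@integral_supported _ _ _ (fun p => - V p * pd_y psi p + 2 * V p ^+ 2 * pd_t psi p)).
- rewrite EFin_Rintegral2//.
  have mV := lip2_measurable VL.
  apply: nice2D.
    apply: (@nice2M _ _ (fun p => - V p) M ny) => [|p]; last by rewrite normrN.
    by apply: measurableT_comp mV.
  apply: (@nice2M _ _ _ (2 * M ^+ 2) nt); first by apply: measurable_funM => //; exact: measurable_funX.
  move=> p; rewrite normrM normrX (ger0_norm (_ : 0 <= 2))// ler_wpM2l// lerXn2r ?nnegrE//.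
  exact: le_trans (VM 0).
- move=> p Op; have [Kp|Kp] := pselect (K p); first by rewrite vV//; exact: KQ.
  by rewrite y0// t0// !mulr0.
- move=> p Op; have Kp : ~ K p by move=> /KQ/QOm.
  by rewrite y0// t0// !mulr0 addr0.
Qed.

(** Fundamental lemma of the calculus of variations: [g] and [igrad V] have equal integrals against
    all bumps inside [Q], so their difference, cut off to [Qo], has zero integral over every open
    rectangle. *)
Lemma gradient_ae :
  {ae mu2, forall p, (`]c1, c2[%classic `*` `]d1, d2[%classic) p -> g p = igrad V p}.
Proof.
pose Qo : set (mR * mR) := `]c1, c2[%classic `*` `]d1, d2[%classic.
have QoQ : Qo `<=` Q.
  by move=> [y t] [] /=; rewrite !in_itv/= => /andP[? ?] /andP[? ?]; split; rewrite !ltW.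
have mQo : measurable Qo by apply: measurableX; exact: measurable_itv.
have mQ : measurable (Q : set (mR * mR)) by apply: measurableX; exact: measurable_itv.
have cQ : compact Q by apply: compact_setX; exact: segment_compact.
pose g1 := g \_ Qo.
have mg : measurable_fun Qo g.
  have [[mg _] _] := Bvg.
  apply: (@measurable_funS _ _ (mR * mR)%type R Om) => //; first exact: open_measurable2.
  exact: subset_trans QOm.
have gi : mu2.-integrable setT (EFin \o g1).
  rewrite (_ : EFin \o g1 = (EFin \o g) \_ Qo); last by rewrite /g1 restrict_EFin.
  apply/(integrable_mkcond _ mQo)/integrableP; split; first exact/measurable_EFinP.
  have [[_ /(_ _ cQ QOm) h] _] := Bvg; apply: (le_lt_trans _ h).
  apply: ge0_subset_integral => //.
  have [[mg' _] _] := Bvg.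
  apply: (@measurable_funS _ _ (mR * mR)%type _ Om) => //; first exact: open_measurable2.
  by apply/measurable_EFinP; apply: measurableT_comp.
pose D1 : R * R -> R := igrad V \_ Qo.
have nD1 : nice2 D1.
  split; first by apply/(measurable_restrictT _ mQo); apply: measurable_funTS; exact: igrad_measurable VL.
  have [N NQ] := compact_bounded2 cQ.
  exists (L + 2 * (2 * M * L)), N; split => p.
    rewrite /D1 patchE; case: ifP => _; first exact: igrad_bound.
    by rewrite normr0; apply: le_trans (igrad_bound VL VM p).
  rewrite /D1 patchE; case: ifPn => //; rewrite inE => /QoQ/NQ[h1 h2].
  by rewrite !ltNge h1 h2.
pose G p := g1 p - D1 p.
have Gi : mu2.-integrable setT (EFin \o G).
  rewrite (_ : EFin \o G = ((EFin \o g1) \- (EFin \o D1))%E); last by apply/funext => p.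
  by apply: integrableB => //; exact: nice2_integrable.
have [N NQ] := compact_bounded2 cQ.
have Gout p : ~ Qo p -> G p = 0.
  by move=> Qp; rewrite /G /g1 /D1 !patchE memNset// subrr.
have Gbump n a b c d : c1 <= a -> b <= c2 -> d1 <= c -> d <= d2 ->
    (\int[mu2]_p (G p * (bump n a b p.1 * bump n c d p.2))%:E = 0)%E.
  move=> ca bc dc dd; set psi := fun p : R * R => bump n a b p.1 * bump n c d p.2.
  have [spsi _] := @test_fun_bump R setT n n a b c d (@subsetT _ _).
  have KQ : `[a, b]%classic `*` `[c, d]%classic `<=` Q.
    move=> [y t] [] /=; rewrite !in_itv/= => /andP[y1 y2] /andP[t1 t2].
    by split; apply/andP; split; lra.
  have cK : compact (`[a, b]%classic `*` `[c, d]%classic) by apply: compact_setX; exact: segment_compact.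
  have psi0 p : ~ (`]a, b[%classic `*` `]c, d[%classic) p -> psi p = 0.
    move=> /not_andP[] /= /negP; rewrite in_itv/= => h; rewrite /psi.
      by rewrite bump_out// mul0r.
    by rewrite (@bump_out _ n c d)// mulr0.
  have psi0' p : ~ (`[a, b]%classic `*` `[c, d]%classic) p -> psi p = 0.
    move=> Kp; apply: psi0; apply: contra_not Kp => -[] /=.
    by rewrite !in_itv/= => /andP[? ?] /andP[? ?]; split; rewrite !ltW.
  have psiQo p : ~ Qo p -> psi p = 0.
    move=> Qp; apply: psi0; apply: contra_not Qp => -[] /=.
    rewrite !in_itv/= => /andP[? ?] /andP[? ?]; split; rewrite /= in_itv/=; apply/andP; split; lra.
  have wg := weak_gradient_igrad spsi cK KQ psi0'.
  have cpsi : continuous psi by have [] := smooth_pd spsi.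
  have npsi := continuous_nice2 cpsi cK psi0'.
  have psi1 p : `|psi p| <= 1.
    rewrite /psi normrM.
    have /andP[h1 h2] := bump_bound n a b p.1; have /andP[h3 h4] := bump_bound n c d p.2.
    by rewrite !ger0_norm// mulr_ile1.
  have gpsi : mu2.-integrable setT (EFin \o (fun p => g1 p * psi p)).
    apply: (le_integrable measurableT _ _ gi).
      apply/measurable_EFinP; apply: measurable_funM; last by case: npsi.
      by case/integrableP : gi => /measurable_EFinP.
    by move=> p _; rewrite /= lee_fin normrM ler_piMr.
  have Dpsi : nice2 (fun p => D1 p * psi p).
    by case: nD1 => mD1 [M' [_ [D1M _]]]; exact: (nice2M npsi mD1 D1M).
  pose F1 : R * R -> R := fun p => g1 p * psi p.
  pose F2 : R * R -> R := fun p => D1 p * psi p.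
  transitivity (\int[mu2]_p ((EFin \o F1) p - (EFin \o F2) p))%E.
    by apply: eq_integral => p _; rewrite /= -EFinB /F1 /F2 -mulrBl.
  rewrite integralB//; last exact: nice2_integrable.
  rewrite -(EFin_Rintegral2 Dpsi).
  have -> : \int[mu2]_p F2 p = \int[mu2]_p (igrad V p * psi p).
    apply: eq_Rintegral => p _; rewrite /F2 /D1 patchE; case: ifPn => //.
    by rewrite notin_setE => /psiQo ->; rewrite !mulr0.
  rewrite -wg (@integral_supported R Om _ F1).
  - rewrite subee//; exact: integrable_fin_num.
  - move=> p Op; rewrite /F1 /g1 patchE; case: ifPn => //.
    by rewrite notin_setE -/(psi p) => /psiQo ->; rewrite !mulr0.
  - move=> p Op; rewrite /F1 psiQo ?mulr0// => /QoQ /QOm; exact: Op.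
have Gsupp (A B : set (R * R)) : (forall p, Qo p -> A p <-> B p) ->
    (\int[mu2]_(p in A) (G p)%:E = \int[mu2]_(p in B) (G p)%:E)%E.
  move=> AB; rewrite integral_mkcond [RHS]integral_mkcond; apply: eq_integral => p _.
  rewrite !patchE; have [pQ|/Gout->] := pselect (Qo p); last by case: ifP; case: ifP.
  have [h1 h2] := AB p pQ.
  by case: ifPn; case: ifPn => //; rewrite ?notin_setE !inE; tauto.
have := @ae_eq0_of_rectangles R (EFin \o G) (N + 1) Gi.
case=> [p Np|a b c d|W [mW W0 WP]].
- congr EFin; apply: Gout; apply: contra_not Np => /QoQ/NQ[].
  rewrite !ler_norml => /andP[? ?] /andP[? ?].
  by split; rewrite /= in_itv/=; apply/andP; split; lra.
- rewrite (@Gsupp _ (`]Num.max a c1, Num.min b c2[%classic `*` `]Num.max c d1, Num.min d d2[%classic)).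
    apply: rectangle_of_bumps => // n; apply: Gbump; rewrite ?le_max ?ge_min lexx ?orbT//.
  move=> [y t] [] /=; rewrite !in_itv/= !gt_max !lt_min => /andP[-> ->] /andP[-> ->].
  by rewrite !andbT.
exists W; split => //; apply: subset_trans WP => p /= h.
apply: contra_not h => h pQ; have := h I => -[].
by rewrite /G /g1 /D1 !patchE mem_set// => /eqP; rewrite subr_eq0 => /eqP.
Qed.

End fundamental.

(** The second derivative of the integrand is at most 1, so this Taylor bound holds globally. It
    turns the first variation into an inequality between integrals, without differentiation under
    the integral sign. *)
Lemma sqrt_convex_bound (R : realType) (a b : R) :
  Num.sqrt (1 + b ^+ 2) <=
  Num.sqrt (1 + a ^+ 2) + a / Num.sqrt (1 + a ^+ 2) * (b - a) + (b - a) ^+ 2 / 2.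
Proof.
set s := Num.sqrt (1 + a ^+ 2); set r := Num.sqrt (1 + b ^+ 2).
have a2 : 0 <= 1 + a ^+ 2 by rewrite addr_ge0// sqr_ge0.
have b2 : 0 <= 1 + b ^+ 2 by rewrite addr_ge0// sqr_ge0.
have s2 : s ^+ 2 = 1 + a ^+ 2 by rewrite sqr_sqrtr.
have r2 : r ^+ 2 = 1 + b ^+ 2 by rewrite sqr_sqrtr.
have s1 : 1 <= s by rewrite -[leLHS]sqrtr1 ler_sqrt// lerDl sqr_ge0.
have s0 : 0 < s by apply: lt_le_trans s1.
(* AM-GM: r <= (r^2 + s^2) / (2 s) *)
have h : r <= (r ^+ 2 + s ^+ 2) / (2 * s).
  rewrite ler_pdivlMr ?mulr_gt0//; have := sqr_ge0 (r - s); rewrite sqrrB.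
  rewrite mulr2n; lra.
apply: le_trans h _.
have -> : (r ^+ 2 + s ^+ 2) / (2 * s) = s + a / s * (b - a) + (b - a) ^+ 2 / 2 / s.
  rewrite r2; have -> : 1 + b ^+ 2 = s ^+ 2 + 2 * a * (b - a) + (b - a) ^+ 2 by rewrite s2; ring.
  by field; rewrite gt_eqF.
by rewrite lerD2l ler_pdivrMr// ler_peMr// divr_ge0// sqr_ge0.
Qed.

Lemma linear_term_zero (R : realType) (A C : R) :
  (forall e : R, `|e| <= 1 -> 0 <= e * A + e ^+ 2 * C) -> A = 0.
Proof.
move=> h; apply/eqP; rewrite -normr_le0; apply/ler_addgt0Pr => d d0; rewrite add0r.
pose C1 := `|C| + 1.
have C10 : 0 < C1 by rewrite ltr_wpDl.
pose e := Num.min 1 (d / C1).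
have e0 : 0 < e by rewrite lt_min ltr01 divr_gt0.
have e1 : e <= 1 by rewrite ge_min lexx.
have eC : e * C <= d.
  apply: le_trans (_ : e * C1 <= _).
    by rewrite ler_pM2l// /C1 (le_trans (ler_norm C))// lerDl.
  by rewrite -ler_pdivlMr// ge_min lexx orbT.
have := h e; rewrite gtr0_norm// => /(_ e1) h1.
have := h (- e); rewrite normrN gtr0_norm// => /(_ e1) h2.
have h3 : 0 <= e * (A + e * C) by move: h1; rewrite expr2 -mulrA -mulrDr.
have h4 : 0 <= e * (- A + e * C).
  by move: h2; rewrite sqrrN expr2 -mulrA mulNr -mulrN -mulrDr.
rewrite pmulr_rge0// in h3; rewrite pmulr_rge0// in h4.
rewrite ler_norml; apply/andP; split; lra.
Qed.

Section first_variation.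
Variables (R : realType) (Om : set (R * R)) (v g V : R * R -> R) (L M : R).
Hypotheses (oOm : open Om) (cv : {within Om, continuous v}).
Hypotheses (Bvg : Bweak Om v g) (VL : lip2 V L) (VM : forall p, `|V p| <= M).
Variables (c1 c2 d1 d2 : R).
Local Notation Q := (`[c1, c2]%classic `*` `[d1, d2]%classic).
Hypotheses (QOm : Q `<=` Om) (vV : forall p, Q p -> v p = V p).
Hypothesis hmin : forall (vt gt : R * R -> R) (K : set (R * R)),
  {within Om, continuous vt} -> compact K -> K `<=` Om ->
  (forall p, Om p -> ~ K p -> vt p = v p) -> Bweak Om vt gt ->
  (areaH K g <= areaH K gt)%E.
Local Notation mR := (measurableTypeR R).
Local Notation mu2 := (@leb2 R).

Lemma continuous_cutoff (F chi : R * R -> R) (K : set (R * R)) :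
  {within Om, continuous F} -> continuous chi -> closed K -> K `<=` Om ->
  (forall p, ~ K p -> chi p = 0) -> continuous ((fun p => F p * chi p) \_ Om).
Proof.
rewrite continuous_open_subspace// => cF cchi clK KOm chi0 p.
have [Op|Op] := pselect (Om p).
  have E : {near p, (fun p => F p * chi p) =1 ((fun p => F p * chi p) \_ Om)}.
    have := oOm; rewrite openE => /(_ p Op); apply: filterS => q Oq.
    by rewrite patchE mem_set.
  have E0 : ((fun p => F p * chi p) \_ Om) p = F p * chi p by rewrite patchE mem_set.
  rewrite /continuous_at E0; apply: cvg_trans (near_eq_cvg E) _.
  by apply: cvgM; [apply: cF; rewrite inE|exact: cchi].
have E : {near p, cst 0 =1 ((fun p => F p * chi p) \_ Om)}.
  have := closed_openC clK; rewrite openE => /(_ p (fun h => Op (KOm _ h))).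
  apply: filterS => q Kq; rewrite patchE; case: ifP => // _.
  by rewrite chi0 ?mulr0.
have E0 : ((fun p => F p * chi p) \_ Om) p = 0 by rewrite patchE memNset.
rewrite /continuous_at E0; apply: cvg_trans (near_eq_cvg E) _.
exact: cvg_cst.
Qed.

Variables (phi h k : R * R -> R) (K : set (R * R)).
Hypotheses (cphi : continuous phi) (cK : compact K).
Hypothesis (KQ : K `<=` `]c1, c2[%classic `*` `]d1, d2[%classic).
Hypothesis (phi0 : forall p, ~ K p -> phi p = 0).
Hypothesis (h0 : forall p, ~ K p -> h p = 0).
Hypothesis (k0 : forall p, ~ K p -> k p = 0).
Hypotheses (nh : nice2 h) (nk : nice2 k).
Hypothesis weak_h : forall psi, test_fun Om psi ->
  \int[mu2]_p (h p * psi p) =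
  \int[mu2]_p (- phi p * pd_y psi p + 4 * V p * phi p * pd_t psi p).
Hypothesis weak_k : forall psi, test_fun Om psi ->
  \int[mu2]_p (k p * psi p) = \int[mu2]_p (2 * phi p ^+ 2 * pd_t psi p).

Let KOm : K `<=` Om.
Proof.
move=> p /KQ [] /= h1 h2; apply: QOm; move: h1 h2; rewrite /= !in_itv/=.
by move=> /andP[? ?] /andP[? ?]; split; rewrite !ltW.
Qed.

Let vVK p : K p -> v p = V p.
Proof.
move=> /KQ [] /= h1 h2; apply: vV; move: h1 h2; rewrite /= !in_itv/=.
by move=> /andP[? ?] /andP[? ?]; split; rewrite !ltW.
Qed.

Let mOm : measurable (Om : set (mR * mR)). Proof. exact: open_measurable2. Qed.

(** The weak form is quadratic in the function, so the expansion in [e] is exact. By [weak_h] and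
    [weak_k], [h] stands for [phi_y - 4 (V phi)_t] and [k] for [- 2 (phi ^ 2)_t] in the sense of
    distributions; [V] may replace [v] because [phi] vanishes outside [K]. *)
Lemma variation_Bweak (e : R) :
  Bweak Om (fun p => v p + e * phi p) (fun p => g p + (e * h p + e ^+ 2 * k p)).
Proof.
have [[mg gL] gw] := Bvg.
have nhk : nice2 (fun p => e * h p + e ^+ 2 * k p) by apply: nice2D; exact: nice2Z.
have ihk := nice2_integrable nhk.
split.
  split.
    apply: measurable_funD => //; apply: (@measurable_funTS _ _ (mR * mR)%type).
    by case: nhk.
  move=> J cJ JOm.
  have mJ : measurable (J : set (mR * mR)).
    rewrite -[J]setCK; apply: measurableC; apply: open_measurable2.
    by apply: closed_openC; exact: compact_closed.
  have mgJ : measurable_fun (J : set (mR * mR)) g by exact: (@measurable_funS _ _ (mR * mR)%type _ Om).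
  have iJ : mu2.-integrable J (EFin \o (fun p => e * h p + e ^+ 2 * k p)).
    by apply: integrableS ihk.
  have gJ : mu2.-integrable J (EFin \o g).
    by apply/integrableP; split; [exact/measurable_EFinP|exact: gL].
  have /integrableP[_] := integrableD mJ gJ iJ.
  exact.
move=> psi tpsi; have [spsi [J [cJ JOm psi0]]] := tpsi.
have [c0 cy ct dy dt] := smooth_pd spsi.
have clJ : closed J by exact: compact_closed.
have y0 p : ~ J p -> pd_y psi p = 0 by move=> Jp; exact: (partial_vanish false clJ psi0 Jp).
have t0 p : ~ J p -> pd_t psi p = 0 by move=> Jp; exact: (partial_vanish true clJ psi0 Jp).
have n0 := continuous_nice2 c0 cJ psi0.
have ny := continuous_nice2 cy cJ y0.
have nt := continuous_nice2 ct cJ t0.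
have mV := lip2_measurable VL.
have mphi : measurable_fun [set: mR * mR] phi by exact: continuous_measurable2.
have [_ [Mphi [_ [phiM _]]]] := continuous_nice2 cphi cK phi0.
pose W1 : R * R -> R := fun p => - phi p * pd_y psi p + 4 * V p * phi p * pd_t psi p.
pose W2 : R * R -> R := fun p => 2 * phi p ^+ 2 * pd_t psi p.
have nW2 : nice2 W2.
  apply: (@nice2M _ _ (fun p => 2 * phi p ^+ 2) (2 * Mphi ^+ 2) nt).
    by apply: measurable_funM => //; exact: measurable_funX.
  move=> p; rewrite normrM normrX (ger0_norm (_ : 0 <= 2))// ler_wpM2l// lerXn2r ?nnegrE//.
  exact: le_trans (phiM 0).
have nW1 : nice2 W1.
  apply: nice2D.
    apply: (@nice2M _ _ (fun p => - phi p) Mphi ny) => [|p]; last by rewrite normrN.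
    by apply: measurableT_comp mphi.
  apply: (@nice2M _ _ (fun p => 4 * V p * phi p) (4 * M * Mphi) nt).
    by apply: measurable_funM => //; exact: measurable_funM.
  move=> p; rewrite !normrM (ger0_norm (_ : 0 <= 4))// ler_pM// ?mulr_ge0//.
  by rewrite ler_wpM2l.
(* Outside [Om] nothing is known of [v]; multiplied by a derivative of [psi], whose support is
   compact in [Om], and extended by 0, it becomes a continuous function on the plane. *)
pose W0 : R * R -> R := (fun p => v p * - pd_y psi p) \_ Om.
pose W0' : R * R -> R := (fun p => (v p ^+ 2) * (2 * pd_t psi p)) \_ Om.
have nW0 : nice2 W0.
  apply: (@continuous_nice2 _ _ J) => // [|p Jp]; last first.
    by rewrite /W0 patchE; case: ifP; rewrite // y0// oppr0 mulr0.
  apply: (@continuous_cutoff _ _ J) => // [|p Jp]; last by rewrite y0 ?oppr0.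
  by move=> p; apply: cvgN; exact: cy.
have nW0' : nice2 W0'.
  apply: (@continuous_nice2 _ _ J) => // [|p Jp]; last first.
    by rewrite /W0' patchE; case: ifP; rewrite // t0// !mulr0.
  apply: (@continuous_cutoff _ _ J) => // [||p Jp]; last by rewrite t0 ?mulr0.
    by move=> p; apply: cvgM; exact: cv.
  by move=> p; apply: cvgM; [exact: cvg_cst|exact: ct].
have nW : nice2 (fun p => W0 p + W0' p) by exact: nice2D.
have Out p : ~ Om p -> [/\ psi p = 0, pd_y psi p = 0 & pd_t psi p = 0].
  move=> Op; have Jp : ~ J p by move=> /JOm.
  by rewrite psi0// y0// t0.
have R0 : (\int[mu2]_(p in Om) (- v p * pd_y psi p + 2 * v p ^+ 2 * pd_t psi p)%:E =
    (\int[mu2]_p (W0 p + W0' p))%:E)%E.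
  rewrite EFin_Rintegral2//; apply: integral_supported => p Op.
    by rewrite /W0 /W0' !patchE mem_set//; ring.
  by rewrite /W0 /W0' !patchE memNset// addr0.
have nR : nice2 (fun p => e * W1 p + e ^+ 2 * W2 p) by apply: nice2D; exact: nice2Z.
have R1 : (\int[mu2]_(p in Om) (- (v p + e * phi p) * pd_y psi p +
      2 * (v p + e * phi p) ^+ 2 * pd_t psi p)%:E =
    (\int[mu2]_p ((W0 p + W0' p) + (e * W1 p + e ^+ 2 * W2 p)))%:E)%E.
  rewrite EFin_Rintegral2; last exact: nice2D.
  apply: integral_supported => p Op.
    rewrite /W0 /W0' !patchE mem_set// /W1 /W2.
    have [Kp|/phi0->] := pselect (K p); last by ring.
    by rewrite (vVK Kp); ring.
  have [_ y1 t1] := Out p Op.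
  by rewrite /W0 /W0' !patchE memNset// /W1 /W2 y1 t1 !mulr0 !addr0 !mulr0 addr0.
rewrite R1 nice2_intD//.
have -> : \int[mu2]_p (e * W1 p + e ^+ 2 * W2 p) = \int[mu2]_p ((e * h p + e ^+ 2 * k p) * psi p).
  have [mpsi [Mpsi [_ [psiM _]]]] := n0.
  have nhpsi : nice2 (fun p => psi p * h p) by exact: (nice2M nh mpsi psiM).
  have nkpsi : nice2 (fun p => psi p * k p) by exact: (nice2M nk mpsi psiM).
  rewrite nice2_intD; [|exact: nice2Z|exact: nice2Z].
  rewrite !nice2_intZ// -(weak_h tpsi) -(weak_k tpsi).
  transitivity (\int[mu2]_p (e * (psi p * h p) + e ^+ 2 * (psi p * k p))); last first.
    by apply: eq_Rintegral => p _; ring.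
  rewrite nice2_intD; [|exact: nice2Z|exact: nice2Z].
  rewrite !nice2_intZ//; congr (_ * _ + _ * _); apply: eq_Rintegral => p _; exact: mulrC.
rewrite EFinD -R0 -(gw _ tpsi).
have npsi2 : nice2 (fun p => (e * h p + e ^+ 2 * k p) * psi p).
  by case: nhk => mhk [M' [_ [hkM _]]]; exact: (nice2M n0 mhk hkM).
rewrite EFin_Rintegral2//.
rewrite -(@integral_supported R Om (fun p => (e * h p + e ^+ 2 * k p) * psi p)) //; last first.
  by move=> p Op; have [-> _ _] := Out p Op; rewrite mulr0.
have mJ : measurable (J : set (mR * mR)).
  rewrite -[J]setCK; apply: measurableC; apply: open_measurable2.
  exact: closed_openC.
have igpsi : mu2.-integrable Om (EFin \o (fun p => g p * psi p)).
  have [mpsi [Mpsi [_ [psiM _]]]] := n0.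
  have Mpsi0 : 0 <= Mpsi by exact: le_trans (psiM 0).
  apply/integrableP; split.
    by apply/measurable_EFinP; apply: measurable_funM => //; apply: (@measurable_funTS _ _ (mR * mR)%type).
  have gJ : mu2.-integrable J (EFin \o g).
    apply/integrableP; split; last exact: gL.
    by apply/measurable_EFinP; exact: (@measurable_funS _ _ (mR * mR)%type _ Om).
  have /integrableP[_] : mu2.-integrable J (EFin \o (fun p => g p * psi p)).
    apply: (le_integrable mJ _ _ (integrableZl mJ Mpsi gJ)).
      apply/measurable_EFinP; apply: measurable_funM; last exact: measurable_funTS.
      exact: (@measurable_funS _ _ (mR * mR)%type _ Om).
    move=> p _ /=; rewrite lee_fin mulrC !normrM ler_wpM2r//.
    by rewrite (ger0_norm Mpsi0).
  apply: le_lt_trans; rewrite integral_mkcond [leRHS]integral_mkcond.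
  rewrite le_eqVlt; apply/orP; left; apply/eqP.
  apply: eq_integral => p _; rewrite !patchE.
  have [Jp|Jp] := pselect (J p); first by rewrite !mem_set//; exact: JOm.
  by rewrite (memNset Jp)/= psi0// mulr0 normr0; case: ifP.
rewrite -integralD_EFin//; last by apply: integrableS (nice2_integrable npsi2).
by apply: eq_integral => p _; rewrite -EFinD mulrDl.
Qed.

End first_variation.

Definition slope_energy (R : realType) (a : R) : R := a / Num.sqrt (1 + a ^+ 2).

Lemma sqrt1D_ge1 (R : realType) (a : R) : 1 <= Num.sqrt (1 + a ^+ 2).
Proof. by rewrite -[leLHS]sqrtr1 ler_sqrt ?addr_ge0 ?sqr_ge0// lerDl sqr_ge0. Qed.

Lemma sqrt1D_le (R : realType) (a : R) : Num.sqrt (1 + a ^+ 2) <= 1 + `|a|.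
Proof.
have h : 0 <= 1 + `|a| by rewrite addr_ge0.
rewrite -[leRHS]ger0_norm// -sqrtr_sqr ler_sqrt ?sqr_ge0//.
by rewrite sqrrD expr1n real_normK ?num_real// mul1r lerD2r lerDl mulrn_wge0.
Qed.

Lemma slope_energy_bound (R : realType) (a : R) : `|slope_energy a| <= 1.
Proof.
rewrite normrM normfV (ger0_norm (sqrtr_ge0 _)) ler_pdivrMr; last first.
  exact: lt_le_trans (sqrt1D_ge1 a).
by rewrite mul1r -sqrtr_sqr ler_sqrt ?addr_ge0 ?sqr_ge0// lerDr.
Qed.

Lemma sqrt1D_continuous (R : realType) : continuous (fun a : R => Num.sqrt (1 + a ^+ 2)).
Proof.
move=> a.
apply: (@continuous_comp _ _ _ (fun a : R => 1 + a ^+ 2) Num.sqrt); last exact: sqrt_continuous.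
by apply: cvgD; [exact: cvg_cst|exact: exprn_continuous].
Qed.

Lemma sqrt1D_measurable (R : realType) :
  measurable_fun [set: measurableTypeR R] (fun a : R => Num.sqrt (1 + a ^+ 2)).
Proof. by apply: continuous_measurable_fun; exact: sqrt1D_continuous. Qed.

Lemma slope_energy_continuous (R : realType) : continuous (@slope_energy R).
Proof.
move=> a; apply: cvgM; first exact: cvg_id.
apply: cvgV; first by rewrite gt_eqF// (lt_le_trans _ (sqrt1D_ge1 a)).
exact: sqrt1D_continuous.
Qed.

Lemma compact_measurable2 (R : realType) (K : set (R * R)) : compact K ->
  measurable (K : set (measurableTypeR R * measurableTypeR R)).
Proof.
move=> cK; rewrite -[K]setCK; apply: measurableC; apply: open_measurable2.
by apply: closed_openC; exact: compact_closed.
Qed.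

Section stationarity.
Variables (R : realType) (Om : set (R * R)) (v g V : R * R -> R) (L M : R).
Hypotheses (oOm : open Om) (cv : {within Om, continuous v}).
Hypotheses (Bvg : Bweak Om v g) (VL : lip2 V L) (VM : forall p, `|V p| <= M).
Variables (c1 c2 d1 d2 : R).
Local Notation Q := (`[c1, c2]%classic `*` `[d1, d2]%classic).
Hypotheses (QOm : Q `<=` Om) (vV : forall p, Q p -> v p = V p).
Hypothesis hmin : forall (vt gt : R * R -> R) (K : set (R * R)),
  {within Om, continuous vt} -> compact K -> K `<=` Om ->
  (forall p, Om p -> ~ K p -> vt p = v p) -> Bweak Om vt gt ->
  (areaH K g <= areaH K gt)%E.
Local Notation mR := (measurableTypeR R).
Local Notation mu2 := (@leb2 R).
Variables (phi h k : R * R -> R) (K : set (R * R)).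
Hypotheses (cphi : continuous phi) (cK : compact K).
Hypothesis (KQ : K `<=` `]c1, c2[%classic `*` `]d1, d2[%classic).
Hypothesis (phi0 : forall p, ~ K p -> phi p = 0).
Hypothesis (h0 : forall p, ~ K p -> h p = 0).
Hypothesis (k0 : forall p, ~ K p -> k p = 0).
Hypotheses (nh : nice2 h) (nk : nice2 k).
Hypothesis weak_h : forall psi, test_fun Om psi ->
  \int[mu2]_p (h p * psi p) =
  \int[mu2]_p (- phi p * pd_y psi p + 4 * V p * phi p * pd_t psi p).
Hypothesis weak_k : forall psi, test_fun Om psi ->
  \int[mu2]_p (k p * psi p) = \int[mu2]_p (2 * phi p ^+ 2 * pd_t psi p).

Let D := igrad V.
Let mD : measurable_fun [set: mR * mR] D. Proof. exact: igrad_measurable VL. Qed.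
Let mK : measurable (K : set (mR * mR)). Proof. exact: compact_measurable2. Qed.
Let KOm : K `<=` Om.
Proof.
move=> p /KQ [] /= h1 h2; apply: QOm; move: h1 h2; rewrite /= !in_itv/=.
by move=> /andP[? ?] /andP[? ?]; split; rewrite !ltW.
Qed.

Let A (r : R * R -> R) (p : R * R) : R := \1_K p * Num.sqrt (1 + (D p + r p) ^+ 2).

Let nice2K (f : R * R -> R) C : measurable_fun [set: mR * mR] f ->
  (forall p, `|f p| <= C) -> nice2 (fun p => \1_K p * f p).
Proof.
move=> mf fC; split.
  by apply: measurable_funM => //; exact: measurable_indic.
have C0 : 0 <= C by exact: le_trans (fC 0).
have [N NK] := compact_bounded2 cK; exists C, N; split => p.
  by rewrite normrM -[leRHS]mul1r ler_pM// indicE; case: (_ \in _); rewrite ?normr1 ?normr0.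
move=> hN; rewrite indicE memNset ?mul0r// => /NK[h1 h2].
by move: hN; rewrite !ltNge h1 h2.
Qed.

Let nA r : nice2 r -> nice2 (A r).
Proof.
move=> [mr [Mr [_ [rM _]]]]; apply: (@nice2K _ (1 + ((L + 2 * (2 * M * L)) + Mr))).
  by apply: (measurableT_comp (@sqrt1D_measurable R)); exact: measurable_funD.
move=> p; rewrite ger0_norm ?sqrtr_ge0//; apply: le_trans (sqrt1D_le _) _.
rewrite lerD2l; apply: le_trans (ler_normD _ _) _; apply: lerD => //.
exact: igrad_bound VL VM p.
Qed.

(** On [K] the representative [g] may be replaced by [igrad V], which is measurable and bounded on
    the plane, so areas become integrals of nice functions. *)
Let areaE r : nice2 r -> areaH K (fun p => g p + r p) = (\int[mu2]_p A r p)%:E.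
Proof.
move=> nr; rewrite (EFin_Rintegral2 (nA nr)) /areaH.
transitivity (\int[mu2]_(p in K) (Num.sqrt (1 + (D p + r p) ^+ 2))%:E)%E.
  have mg : measurable_fun (K : set (mR * mR)) g.
    have [[mg _] _] := Bvg.
    by apply: (@measurable_funS _ _ (mR * mR)%type _ Om) => //; exact: open_measurable2.
  have mr : measurable_fun (K : set (mR * mR)) r by case: nr => mr _; exact: measurable_funTS.
  apply: ae_eq_integral => //.
  - apply/measurable_EFinP; apply: (measurableT_comp (@sqrt1D_measurable R)); exact: measurable_funD.
  - apply/measurable_EFinP; apply: (measurableT_comp (@sqrt1D_measurable R)); apply: measurable_funD => //.
    exact: measurable_funTS.
  - apply: ae_sub (gradient_ae oOm Bvg VL VM QOm vV) => p gp Kp.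
    by rewrite gp//; exact: KQ.
apply: integral_supported => p Kp; first by rewrite /A indicE mem_set// mul1r.
by rewrite /A indicE memNset// mul0r.
Qed.

(** Minimality against [v + e phi] and the convexity bound give an inequality
    [0 <= e alpha + e ^ 2 beta] for [|e| <= 1], with [alpha] the integral in question; small [e] of
    both signs force [alpha = 0]. *)
Lemma stationary : \int[mu2]_p (slope_energy (D p) * h p) = 0.
Proof.
have mF : measurable_fun [set: mR * mR] (fun p => slope_energy (D p)).
  apply: measurableT_comp mD; apply: continuous_measurable_fun.
  exact: slope_energy_continuous.
have nFh : nice2 (fun p => slope_energy (D p) * h p).
  by apply: (nice2M nh mF) => p; exact: slope_energy_bound.
have nFk : nice2 (fun p => slope_energy (D p) * k p).
  by apply: (nice2M nk mF) => p; exact: slope_energy_bound.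
(* For [|e| <= 1] the increment of the gradient satisfies [(e h + e ^ 2 k) ^ 2 <= e ^ 2 S]. *)
pose S p := (`|h p| + `|k p|) ^+ 2.
have nS : nice2 S.
  have [mh [Mh [Nh [hM hN]]]] := nh; have [mk [Mk [Nk [kM kN]]]] := nk.
  have Mh0 : 0 <= Mh by exact: le_trans (hM 0).
  have Mk0 : 0 <= Mk by exact: le_trans (kM 0).
  split.
    by apply: measurable_funX; apply: measurable_funD; apply: measurableT_comp.
  have [N NK] := compact_bounded2 cK; exists ((Mh + Mk) ^+ 2), N; split => p.
    rewrite normrX lerXn2r ?nnegrE ?addr_ge0// ger0_norm ?addr_ge0//.
    exact: lerD.
  move=> hN'; have Kp : ~ K p by move=> /NK[h1 h2]; move: hN'; rewrite !ltNge h1 h2.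
  by rewrite /S h0// k0// normr0 addr0 expr0n.
apply: (@linear_term_zero _ _ (\int[mu2]_p (slope_energy (D p) * k p) + 2^-1 * \int[mu2]_p S p)).
move=> e e1.
pose r p := e * h p + e ^+ 2 * k p.
have nr : nice2 r by apply: nice2D; exact: nice2Z.
have n0 : nice2 (cst 0 : R * R -> R).
  by split; [exact: measurable_cst|exists 0, 0; split => // p; rewrite normr0].
have : (areaH K g <= areaH K (fun p => (g p + r p)%R))%E.
  apply: (hmin (vt := fun p => v p + e * phi p)) => //.
  - move=> p; apply: cvgD; first exact: cv.
    by apply: cvgM; [exact: cvg_cst|exact: (continuous_subspaceT cphi)].
  - by move=> p _ /phi0 ->; rewrite mulr0 addr0.
  - exact: (variation_Bweak oOm cv Bvg VL VM vV cphi cK KQ phi0 nh nk weak_h weak_k e).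
have -> : areaH K g = areaH K (fun p => g p + cst 0 p).
  by congr areaH; apply/funext => p; rewrite addr0.
rewrite (areaE n0) (areaE nr) lee_fin => h1.
pose B p := A (cst 0) p + (e * (slope_energy (D p) * h p) + e ^+ 2 * (slope_energy (D p) * k p + 2^-1 * S p)).
have nB : nice2 B.
  apply: nice2D; first exact: nA.
  by apply: nice2D; apply: nice2Z => //; apply: nice2D => //; exact: nice2Z.
have h2 : \int[mu2]_p A r p <= \int[mu2]_p B p.
  apply: le_Rintegral => //; [exact/nice2_integrable/nA|exact: nice2_integrable|].
  move=> p _; rewrite /B /A; have [Kp|Kp] := pselect (K p); last first.
    by rewrite !indicE memNset// !mul0r add0r h0// k0// /S h0// k0// normr0 addr0 expr0n/= !mulr0 addr0 mulr0 addr0.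
  rewrite indicE mem_set// !mul1r /= addr0.
  apply: le_trans (sqrt_convex_bound (D p) (D p + r p)) _.
  rewrite -addrA lerD2l (addrC (D p)) addrK -/(slope_energy (D p)).
  have -> : e * (slope_energy (D p) * h p) + e ^+ 2 * (slope_energy (D p) * k p + 2^-1 * S p) =
    slope_energy (D p) * r p + e ^+ 2 * S p / 2 by rewrite /r; ring.
  rewrite lerD2l ler_pM2r ?invr_gt0//.
  have -> : r p ^+ 2 = e ^+ 2 * (h p + e * k p) ^+ 2 by rewrite /r; ring.
  rewrite ler_wpM2l ?sqr_ge0// /S -[leLHS]real_normK ?num_real// lerXn2r ?nnegrE ?addr_ge0//.
  apply: le_trans (ler_normD _ _) _; rewrite lerD2l normrM.
  by rewrite ler_piMl.
have := le_trans h1 h2; rewrite /B nice2_intD; [|exact: nA|].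
  rewrite nice2_intD; [|exact: nice2Z|by apply: nice2Z; apply: nice2D => //; exact: nice2Z].
  rewrite lerDl nice2_intZ// nice2_intZ; last by apply: nice2D => //; exact: nice2Z.
  by rewrite nice2_intD//; [rewrite nice2_intZ|exact: nice2Z].
by apply: nice2D; apply: nice2Z => //; apply: nice2D => //; exact: nice2Z.
Qed.

End stationarity.

(** * Variations concentrated along a characteristic *)

Lemma bump_pos (R : realType) n (a b t : R) : a < t < b -> 0 < bump n a b t.
Proof.
move=> /andP[ta tb]; have n0 : 0 < n.+1%:R :> R by rewrite ltr0n.
have h1 : 0 < n.+1%:R * (t - a) by rewrite mulr_gt0// subr_gt0.
have h2 : 0 < - n.+1%:R * (t - b) by rewrite mulNr -mulrN opprB mulr_gt0// subr_gt0.
by rewrite /bump /flat h1 h2 !expr0 invr1 !mul1r mulr_gt0 ?expR_gt0.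
Qed.

(** [eta] is a bump on [[0, 1]], [H] its primitive and [c] its mass. Rescaled to width [d], [eta]
    serves as an approximate identity to the right of a point and [H] as a smooth step. *)
Lemma profile_exists (R : realType) : exists (eta eta' H : R -> R) (c C : R),
  [/\ (forall x : R, is_derive x 1 eta (eta' x)),
      (forall x : R, is_derive x 1 H (eta x)),
      (forall x, ~~ (0 <= x <= 1) -> eta x = 0 /\ eta' x = 0),
      (forall x, x <= 0 -> H x = 0) &
      (forall x, 1 <= x -> H x = c)] /\
  [/\ 0 < c, forall x, `|eta x| <= C, forall x, `|eta' x| <= C & continuous eta'].
Proof.
have [F [F0 dF]] := smooth1_bump 0%N (0 : R) 1.
have out x : ~~ (0 <= x <= 1) -> bump 0 0 1 x = 0.
  by move=> h; apply: bump_out; apply: contra h => /andP[? ?]; rewrite !ltW.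
have [H0 dH0] := @primitive_exists R (bump 0 0 1) (smooth1_continuous (smooth1_bump 0%N (0:R) 1)).
have de (x : R) : is_derive x 1 (bump 0 0 1) (F 1%N x) by rewrite -F0; exact: dF.
have cF1 : continuous (F 1%N) by move=> x; exact: der_continuous (dF 1%N x).
have out' x : ~~ (0 <= x <= 1) -> F 1%N x = 0.
  move=> hx; apply: (der_uniq (de x)); apply: is_derive_near (der_cst x 0).
  move: hx; rewrite negb_and -!ltNge => /orP[x0|x1].
    near=> y; rewrite out// negb_and -!ltNge; apply/orP; left.
    by near: y; exact: lt_nbhsl.
  near=> y; rewrite out// negb_and -!ltNge; apply/orP; right.
  by near: y; exact: lt_nbhsr.
have [M [_ MF]] : bounded_set (F 1%N @` `[0, 1]%classic).
  apply: compact_bounded; apply: continuous_compact; last exact: segment_compact.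
  exact: continuous_subspaceT.
have [C [C0 CF]] : exists C, 1 <= C /\ forall x, `|F 1%N x| <= C.
  exists (Num.max 1 (M + 1)); split; first by rewrite le_max lexx.
  move=> x; have [x01|/out'->] := boolP (0 <= x <= 1); last by rewrite normr0 le_max ler01.
  by rewrite le_max; apply/orP; right; apply: (MF (M + 1)); [rewrite ltrDl|exists x; rewrite //= in_itv].
pose H x := H0 x - H0 0; pose c := H 1.
have dH (x : R) : is_derive x 1 H (bump 0 0 1 x).
  by rewrite -[bump _ _ _ _]subr0; exact: der_sub (dH0 x) (der_cst x _).
have Hmono x y : x <= y -> H x <= H y.
  move=> xy; apply: (le_of_derive xy (fun x _ => dH x)) => z _.
  by have /andP[] := bump_bound 0 0 1 z.
exists (bump 0 0 1), (F 1%N), H, c, C; split; split => //.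
- by move=> x hx; rewrite out// out'.
- move=> x x0; rewrite (derive0_const x0 (fun x _ => dH x)) => [|z /andP[_ z0]].
    by rewrite /H subrr.
  by rewrite bump_out// negb_and -leNgt z0.
- move=> x x1; rewrite /c (derive0_const x1 (fun x _ => dH x))// => z /andP[z1 _].
  by rewrite bump_out// negb_and -!leNgt z1 orbT.
- have H00 : H 0 = 0 by rewrite /H subrr.
  (* If the mass were 0, the monotone [H] would be constant on [[0, 1]], and [eta] would vanish at
     1/2. *)
  rewrite lt_neqAle -{2}H00 (Hmono 0 1)// andbT; apply/eqP => c0.
  have half01 : 0 < (2^-1 : R) < 1 by lra.
  have := bump_pos 0 half01; rewrite (_ : bump 0 0 1 2^-1 = 0) ?ltxx//.
  apply: (der_uniq (dH 2^-1)); apply: is_derive_near (der_cst (2^-1 : R) 0).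
  near=> y; apply/eqP; rewrite eq_le; apply/andP; split.
    rewrite -H00; apply: Hmono; apply: ltW; near: y; apply: lt_nbhsr; lra.
  rewrite [leRHS]c0; apply: Hmono; apply: ltW; near: y; apply: lt_nbhsl; lra.
- move=> x; have /andP[h1 h2] := bump_bound 0 0 1 x; rewrite ger0_norm//; exact: le_trans h2 C0.
Unshelve. all: by end_near. Qed.

(** * One-sided Lebesgue points *)

Section right_lebesgue_points.
Variable R : realType.
Local Notation mR := (measurableTypeR R).
Local Notation mu := (@lebesgue_measure R).
Local Notation mu2 := (@leb2 R).
Implicit Types (f : R -> R) (x : R).

Definition osc f x (n : nat) : \bar R :=
  (n.+1%:R%:E * \int[mu]_t (\1_(`[0, n.+1%:R^-1]%classic : set R) (t - x) * `|f t - f x|)%:E)%E.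

(* Only countably many radii are tested: the set of such points is then measurable even
   when [f] depends on a parameter. *)
Definition right_pt f x := limn_esup (osc f x) = 0%E.

Lemma osc_ge0 f x n : (0 <= osc f x n)%E.
Proof.
by apply: mule_ge0 => //; apply: integral_ge0 => t _; rewrite lee_fin mulr_ge0.
Qed.

Lemma right_pt_cvg f x : right_pt f x -> osc f x n @[n --> \oo] --> 0%E.
Proof.
by move=> h; apply: limn_esup_le_cvg => [|n]; [rewrite h|exact: osc_ge0].
Qed.

Let msub x : measurable_fun [set: mR] (fun t : mR => t - x).
Proof. by apply: measurable_funB => //; exact: measurable_cst. Qed.

Lemma lebesgue_right_pt f x : measurable_fun [set: mR] f -> lebesgue_pt f x -> right_pt f x.
Proof.
(* The interval [[x, x + r]] lies in the ball of radius [2 r], whose length [4 r] is the source of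
   the factor 4. *)
move=> mf fx; have h0 : (fun n => 4%:E * davg f x (2 * n.+1%:R^-1))%E @ \oo --> 0%E.
  rewrite -[X in _ --> X](mule0 4%:E); apply: cvgeM => //; first exact: cvg_cst.
  move/cvge_at_rightP : fx => /(_ (fun n => 2 * n.+1%:R^-1)); apply; split.
    by move=> n; rewrite mulr_gt0// invr_gt0.
  by rewrite -[X in _ --> X](mulr0 2); apply: cvgM; [exact: cvg_cst|exact: cvg_harmonic].
have h1 : osc f x n @[n --> \oo] --> 0%E.
  apply: (@squeeze_cvge _ _ _ _ (cst 0%E) _ (fun n => 4%:E * davg f x (2 * n.+1%:R^-1))%E); last 2 first.
  - exact: cvg_cst.
  - exact: h0.
  apply: nearW => n; rewrite osc_ge0/= /osc /davg /iavg.
  have r0 : 0 < 2 * n.+1%:R^-1 :> R by rewrite mulr_gt0// invr_gt0.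
  rewrite lebesgue_measure_ball; last exact: ltW.
  rewrite inver mulrn_eq0/= gt_eqF//= muleA -EFinM.
  have -> : 4 * ((2 * n.+1%:R^-1) *+ 2)^-1 = n.+1%:R :> R.
    have n0 : n.+1%:R != 0 :> R by rewrite pnatr_eq0.
    by move: n0; move: (n.+1%:R : R) => d d0; rewrite -mulr_natl; field.
  apply: lee_wpmul2l => //.
  rewrite [leRHS]integral_mkcond; apply: ge0_le_integral => //.
  - apply/measurable_EFinP; apply: measurable_funM.
      apply: (measurableT_comp _ (msub x)); apply: measurable_indic; exact: measurable_itv.
    by apply: measurableT_comp => //; apply: measurable_funB.
  - apply/(measurable_restrictT _ (measurable_ball _ _)); apply: measurable_funTS.
    by apply/measurable_EFinP; apply: measurableT_comp => //; apply: measurable_funB.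
  move=> t _; rewrite indicE patchE.
  have [/set_mem/=|_] := boolP (t - x \in `[0, n.+1%:R^-1]%classic); last first.
    by rewrite mul0r; case: ifP => _; rewrite lee_fin.
  rewrite in_itv/= => /andP[t0 t1]; rewrite mem_set ?mul1r//=.
  rewrite /ball/= distrC ger0_norm// (le_lt_trans t1)// ltr_pMl ?invr_gt0//.
  by rewrite ltr1n.
by have [_] := cvg_limn_einf_sup h1.
Qed.

Lemma right_pt_ae f : measurable_fun [set: mR] f -> (exists B, forall x, `|f x| <= B) ->
  {ae mu, forall x, right_pt f x}.
Proof.
move=> mf [B fB]; have : locally_integrable [set: R] f.
  split => //; first exact: openT.
  move=> K _ cK; have mK := compact_measurable cK.
  apply: (@le_lt_trans _ _ (\int[mu]_(x in K) B%:E)%E).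
    apply: ge0_le_integral => //.
    - by apply/measurable_EFinP; apply: measurableT_comp => //; exact: measurable_funTS.
    - by move=> x _; rewrite lee_fin.
  rewrite integral_cst//; have KF := compact_finite_measure cK.
  by rewrite lte_mul_pinfty// lee_fin (le_trans _ (fB 0)).
by move/lebesgue_differentiation; apply: ae_sub => x; exact: lebesgue_right_pt.
Qed.

(** Write [f = f x + (f - f x)]: the constant contributes [f x * m], and the remainder is at most
    [C] times [osc], because [w n] is bounded by [C] and supported on the interval over which [osc]
    averages. *)
Lemma right_pt_limit f x (w : nat -> R -> R) (B C m : R) :
  measurable_fun [set: mR] f -> (forall t, `|f t| <= B) -> right_pt f x ->
  (forall n, measurable_fun [set: mR] (w n)) -> (forall n t, `|w n t| <= C) ->
  (forall n t, ~~ (x <= t <= x + n.+1%:R^-1) -> w n t = 0) ->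
  n.+1%:R * \int[mu]_t w n t @[n --> \oo] --> m ->
  n.+1%:R * \int[mu]_t (f t * w n t) @[n --> \oo] --> f x * m.
Proof.
move=> mf fB fx mw wC w0 wm.
have nw n : nice1 (w n).
  split => //; exists C, (`|x| + 1); split => // t ht; apply: w0; apply/negP => /andP[h1 h2].
  move: ht; rewrite ltNge => /negP; apply; rewrite ler_norml.
  have := ler_norm x; have := ler_norm (- x); rewrite normrN => h3 h4.
  have h5 : n.+1%:R^-1 <= 1 :> R by rewrite invf_le1 ?ltr0n// ler1n.
  by move: (n.+1%:R^-1) h2 h5 => d h2 h5; apply/andP; split; lra.
have nfw n : nice1 (fun t => f t * w n t) by exact: (nice1M (nw n) mf fB).
have mdf : measurable_fun [set: mR] (fun t => f t - f x).
  by apply: measurable_funB => //; exact: measurable_cst.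
have ndw n : nice1 (fun t => (f t - f x) * w n t).
  apply: (@nice1M _ _ (fun t => f t - f x) (B + B) (nw n) mdf) => t.
  by apply: le_trans (ler_normB _ _) _; exact: lerD.
have E n : n.+1%:R * \int[mu]_t (f t * w n t) =
    n.+1%:R * \int[mu]_t ((f t - f x) * w n t) + f x * (n.+1%:R * \int[mu]_t w n t).
  have -> : \int[mu]_t (f t * w n t) = \int[mu]_t ((f t - f x) * w n t) + f x * \int[mu]_t w n t.
    rewrite -(nice1_intZ (f x) (nw n)) -(nice1_intD (ndw n) (nice1Z (f x) (nw n))).
    by apply: eq_Rintegral => t _; ring.
  by ring.
have h : n.+1%:R * \int[mu]_t ((f t - f x) * w n t) @[n --> \oo] --> (0 : R).
  have C0 : 0 <= C by exact: le_trans (wC 0%N 0).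
  have hb n : (`|n.+1%:R * \int[mu]_t ((f t - f x) * w n t)|%:E <= C%:E * osc f x n)%E.
    rewrite normrM (ger0_norm (_ : 0 <= n.+1%:R))// EFinM EFin_normr_Rintegral//; last first.
      exact: nice1_integrable.
    rewrite /osc muleCA; apply: lee_wpmul2l => //.
    apply: le_trans (le_abse_integral _ _ _) _ => //; first by apply/measurable_EFinP; case: (ndw n).
    have mi : measurable_fun [set: mR] (fun t : mR => (\1_(`[0, n.+1%:R^-1]%classic : set R) (t - x) : R)).
      by apply: (measurableT_comp _ (msub x)); apply: measurable_indic; exact: measurable_itv.
    have mo : measurable_fun [set: mR]
        (fun t => (\1_(`[0, n.+1%:R^-1]%classic : set R) (t - x) * `|f t - f x|)%:E).
      by apply/measurable_EFinP; apply: measurable_funM => //; apply: measurableT_comp.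
    rewrite -ge0_integralZl//.
    apply: ge0_le_integral => //.
    - by apply: measurableT_comp => //; apply/measurable_EFinP; case: (ndw n).
    - exact: measurable_funeM.
    move=> t _ /=; rewrite lee_fin normrM.
    rewrite indicE; have [_|] := boolP (t - x \in `[0, n.+1%:R^-1]%classic).
      by rewrite mul1r mulrC ler_wpM2r.
    rewrite notin_setE /= in_itv/= => ht; rewrite w0 ?normr0 ?mulr0 ?mul0r ?mulr0//.
    by apply/negP => /andP[h1 h2]; apply: ht; apply/andP; split; rewrite ?subr_ge0// lerBlDl.
  have hc : (C%:E * osc f x n)%E @[n --> \oo] --> 0%E.
    by rewrite -(mule0 C%:E); apply: cvgeM => //; [exact: cvg_cst|exact: right_pt_cvg].
  have ha : (`|n.+1%:R * \int[mu]_t ((f t - f x) * w n t)|%:E)%E @[n --> \oo] --> 0%E.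
    apply: (@squeeze_cvge _ _ _ _ (cst 0%E) _ (fun n => C%:E * osc f x n)%E) => //; last exact: cvg_cst.
    by apply: nearW => n; rewrite hb andbT lee_fin.
  apply/norm_cvg0P; have := fine_cvg ha; exact.
have hm : f x * (n.+1%:R * \int[mu]_t w n t) @[n --> \oo] --> f x * m.
  by apply: cvgM => //; exact: cvg_cst.
by rewrite (funext E) -[f x * m]add0r; exact: cvgD.
Qed.

End right_lebesgue_points.

Section plane_integrals.
Variable R : realType.
Local Notation mR := (measurableTypeR R).
Local Notation mu2 := (@leb2 R).

Lemma nice2_lin (f g : R * R -> R) (a b : R) : nice2 f -> nice2 g ->
  nice2 (fun p => a * f p + b * g p) /\
  \int[mu2]_p (a * f p + b * g p) = a * \int[mu2]_p f p + b * \int[mu2]_p g p.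
Proof.
move=> nf ng; have nf' := nice2Z a nf; have ng' := nice2Z b ng.
by split; [exact: nice2D|rewrite nice2_intD// !nice2_intZ].
Qed.

Lemma int_partial_y (F Fy : R * R -> R) : nice2 F -> nice2 Fy ->
  (forall p : R * R, is_derive p.1 1 (fun y => F (y, p.2)) (Fy p)) -> \int[mu2]_p Fy p = 0.
Proof.
move=> nF nFy dF.
have E : \int[mu2]_p (wder_y (cst 1) p * F p) = - \int[mu2]_p (cst 1 p * Fy p).
  apply: (@ibp_y R (cst 1) F Fy 0 1) => //.
  - by move=> t a b; rewrite subrr normr0 mul0r.
  - by move=> p; rewrite normr1.
have E0 : \int[mu2]_p (wder_y (cst 1) p * F p) = 0 * \int[mu2]_p F p.
  rewrite -nice2_intZ//; apply: eq_Rintegral => p _.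
  by rewrite /wder_y (derive_wder (der_cst p.1 1)).
move: E; rewrite E0 mul0r => /esym/eqP; rewrite oppr_eq0 => /eqP <-.
by apply: eq_Rintegral => p _; rewrite mul1r.
Qed.

Lemma int_partial_t (F Ft : R * R -> R) : nice2 F -> nice2 Ft ->
  (forall p : R * R, is_derive p.2 1 (fun t => F (p.1, t)) (Ft p)) -> \int[mu2]_p Ft p = 0.
Proof.
move=> nF nFt dF; rewrite -nice2_int_swap//.
apply: (@int_partial_y (fun p => F (p.2, p.1)) (fun p => Ft (p.2, p.1))).
- exact: nice2_swap.
- exact: nice2_swap.
- by move=> p; exact: (dF (p.2, p.1)).
Qed.

Lemma wder_t_vanish (u : R * R -> R) (K : set (R * R)) : closed K ->
  (forall p, ~ K p -> u p = 0) -> forall p, ~ K p -> wder_t u p = 0.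
Proof.
move=> cK u0 p Kp; rewrite /wder_t; apply: derive_wder.
apply: is_derive_near (der_cst p.2 0).
have : \forall q \near p, ~ K q by have := closed_openC cK; rewrite openE => /(_ p Kp).
case/nbhs_ballP => e /= e0 eK; apply/nbhs_ballP; exists e => //= t pt.
by apply/esym; apply: u0; apply: eK; split => //=; exact: ballxx.
Qed.

End plane_integrals.

(** * Test functions in a thin strip beside a characteristic *)

Section strip.
Variables (R : realType) (V : R * R -> R) (L M : R).
Hypotheses (VL : lip2 V L) (VM : forall p, `|V p| <= M).
Variables (X : R -> R).
Hypothesis dX : forall y : R, is_derive y 1 X (- 4 * V (y, X y)).
Variables (eta eta' : R -> R) (C : R).
Hypothesis deta : forall x : R, is_derive x 1 eta (eta' x).
Hypothesis eta0 : forall x, ~~ (0 <= x <= 1) -> eta x = 0 /\ eta' x = 0.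
Hypotheses (etaC : forall x, `|eta x| <= C) (eta'C : forall x, `|eta' x| <= C).
Hypothesis ceta' : continuous eta'.
Variables (theta theta' : R -> R) (a b B : R).
Hypothesis dtheta : forall y : R, is_derive y 1 theta (theta' y).
Hypothesis ctheta' : continuous theta'.
Hypothesis theta0 : forall y, ~~ (a <= y <= b) -> theta y = 0 /\ theta' y = 0.
Hypotheses (thetaB : forall y, `|theta y| <= B) (theta'B : forall y, `|theta' y| <= B).
Variable d : R.
Hypothesis d0 : 0 < d.
Local Notation mR := (measurableTypeR R).
Local Notation mu := (@lebesgue_measure R).
Local Notation mu2 := (@leb2 R).

Let V0 y := V (y, X y).
Let tau (p : R * R) := (p.2 - X p.1) / d.

Definition strip_set : set (R * R) := [set p | a <= p.1 <= b /\ X p.1 <= p.2 <= X p.1 + d].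
Definition strip_phi (p : R * R) := theta p.1 * eta (tau p).
Definition strip_phit (p : R * R) := theta p.1 * (eta' (tau p) / d).
Definition strip_e (p : R * R) := theta' p.1 * eta (tau p).
Definition strip_z (p : R * R) := (V p - V0 p.1) * strip_phi p.
(* [strip_h] and [strip_k] are the coefficients of e and e^2 in B(V + e strip_phi). Because
   [X] is a characteristic, the terms of size 1 / d cancel in [phi_y - 4 V_0 phi_t]; the
   rest of [- 4 (V phi)_t] is the bounded function [- 4 wder_t strip_z]. *)
Definition strip_h (p : R * R) := strip_e p - 4 * wder_t strip_z p.
Definition strip_k (p : R * R) := - 2 * wder_t (fun q => strip_phi q ^+ 2) p.

Let cX : continuous X. Proof. by move=> y; exact: der_continuous (dX y). Qed.
Let ctheta : continuous theta. Proof. by move=> y; exact: der_continuous (dtheta y). Qed.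
Let ceta : continuous eta. Proof. by move=> y; exact: der_continuous (deta y). Qed.
Let C0 : 0 <= C. Proof. exact: le_trans (etaC 0). Qed.
Let B0 : 0 <= B. Proof. exact: le_trans (thetaB 0). Qed.

Let cfst (f : R -> R) : continuous f -> continuous (fun p : R * R => f p.1).
Proof. by move=> cf p; apply: (@continuous_comp _ _ _ fst f); [exact: cvg_fst|exact: cf]. Qed.

Let ctau : continuous tau.
Proof.
move=> p; apply: cvgM; last exact: cvg_cst.
by apply: cvgB; [exact: cvg_snd|exact: (cfst cX)].
Qed.

Let cetatau (f : R -> R) : continuous f -> continuous (fun p => f (tau p)).
Proof. by move=> cf p; apply: (@continuous_comp _ _ _ tau f); [exact: ctau|exact: cf]. Qed.

Let cV : continuous V. Proof. exact: lip2_continuous VL. Qed.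

Let cV0 : continuous V0.
Proof.
move=> y; apply: (@continuous_comp _ _ _ (fun y => (y, X y)) V); last exact: cV.
have h1 : (fun z : R => z) z @[z --> y] --> y by exact: cvg_id.
exact: cvg_pair h1 (@cX y).
Qed.

Lemma strip_phi_continuous : continuous strip_phi.
Proof. by move=> p; apply: cvgM; [exact: (cfst ctheta)|exact: (cetatau ceta)]. Qed.

Let cphit : continuous strip_phit.
Proof.
move=> p; apply: cvgM; first exact: (cfst ctheta).
by apply: cvgM; [exact: (cetatau ceta')|exact: cvg_cst].
Qed.

Let ce : continuous strip_e.
Proof. by move=> p; apply: cvgM; [exact: (cfst ctheta')|exact: (cetatau ceta)]. Qed.

Lemma strip_out p : ~ strip_set p ->
  [/\ strip_phi p = 0, strip_phit p = 0 & strip_e p = 0].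
Proof.
move=> Kp; rewrite /strip_phi /strip_phit /strip_e.
have [ab|/theta0[-> ->]] := boolP (a <= p.1 <= b); last by rewrite !mul0r.
have h : ~~ (0 <= tau p <= 1).
  apply/negP => /andP[h1 h2]; apply: Kp; split => //.
  move: h1 h2; rewrite /tau pmulr_lge0 ?invr_gt0// ler_pdivrMr// mul1r => h1 h2.
  by apply/andP; split; lra.
by have [-> ->] := eta0 h; rewrite !(mulr0, mul0r).
Qed.

Lemma strip_set_compact : compact strip_set.
Proof.
have [N [_ XN]] : bounded_set (X @` `[a, b]%classic).
  apply: compact_bounded; apply: continuous_compact; last exact: segment_compact.
  exact: continuous_subspaceT.
pose N1 := N + 1.
apply: (@subclosed_compact _ _ (`[a, b]%classic `*` `[- N1, N1 + d]%classic)).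
- have -> : strip_set = [set p : R * R | p.1 \in `[a, b]] `&`
      ((fun p => p.2 - X p.1) @^-1` `[0, d]%classic).
    apply/seteqP; split => -[y t] /=; rewrite /strip_set /= !in_itv/=.
      by move=> [-> /andP[h1 h2]]; split => //; apply/andP; split; lra.
    by move=> [-> /andP[h1 h2]]; split => //; apply/andP; split; lra.
  apply: closedI.
    apply: (@closed_comp _ _ fst `[a, b]%classic); last exact: itv_closed.
    by move=> p _; exact: cvg_fst.
  apply: closed_comp; last exact: itv_closed.
  by move=> p _; apply: cvgB; [exact: cvg_snd|exact: (cfst cX)].
- by apply: compact_setX; exact: segment_compact.
- move=> [y t] [/= yab /andP[h1 h2]]; split; rewrite /= in_itv//=.
  have := XN N1; rewrite /N1 ltrDl => /(_ ltr01 (X y)) h.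
  have : `|X y| <= N1 by apply: h; exists y => //; rewrite /= in_itv.
  by rewrite ler_norml => /andP[h3 h4]; rewrite (le_trans h3 h1)/= (le_trans h2)// lerD2r.
Qed.

Let clK : closed strip_set. Proof. by apply: compact_closed => //; exact: strip_set_compact. Qed.

Lemma strip_phi_out p : ~ strip_set p -> strip_phi p = 0. Proof. by case/strip_out. Qed.

Lemma strip_phi_nice : nice2 strip_phi.
Proof. by apply: continuous_nice2 strip_phi_continuous strip_set_compact _ => p /strip_out[]. Qed.
Lemma strip_phit_nice : nice2 strip_phit.
Proof. by apply: continuous_nice2 cphit strip_set_compact _ => p /strip_out[]. Qed.
Lemma strip_e_nice : nice2 strip_e.
Proof. by apply: continuous_nice2 ce strip_set_compact _ => p /strip_out[]. Qed.

Let nice2MC (f g : R * R -> R) : continuous g -> continuous f -> 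
  (forall p, ~ strip_set p -> f p = 0) -> nice2 (fun p => g p * f p).
Proof.
move=> cg cf f0; apply: (@continuous_nice2 _ _ strip_set) => [|| p Kp]; last by rewrite f0 ?mulr0.
- by move=> p; apply: cvgM; [exact: cg|exact: cf].
- exact: strip_set_compact.
Qed.

Let dphit (p : R * R) : is_derive p.2 1 (fun t => strip_phi (p.1, t)) (strip_phit p).
Proof.
have dtau : is_derive p.2 1 (fun t => tau (p.1, t)) d^-1.
  by apply: der_eq (der_mul (der_sub (der_id p.2) (der_cst p.2 (X p.1))) (der_cst p.2 d^-1)) _; ring.
have /= h := der_scale (theta p.1) (der_comp (deta _) dtau).
by apply: der_eq h _; rewrite /strip_phit; case: p {dtau} => y t.
Qed.

(** [X' = - 4 V0] makes the rescaled variable [tau] vary with [y] at the rate [4 V0 / d]; hence the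
    term [4 V0 phi_t], which the variation cancels. *)
Let dphiy (p : R * R) : is_derive p.1 1 (fun y => strip_phi (y, p.2))
  (strip_e p + 4 * V0 p.1 * strip_phit p).
Proof.
have dtau : is_derive p.1 1 (fun y => tau (y, p.2)) (4 * V0 p.1 / d).
  have h := der_mul (der_sub (der_cst p.1 p.2) (dX p.1)) (der_cst p.1 d^-1).
  by apply: der_eq h _; rewrite /V0; ring.
apply: der_eq (der_mul (dtheta p.1) (der_comp (deta _) dtau)) _ => /=.
by rewrite /strip_e /strip_phit; case: p {dtau} => y t /=; ring.
Qed.

(** The bound does not depend on [d]: on the strip [|V - V0| <= L d], which compensates the slope
    [C / d] of the rescaled [eta]. *)
Lemma strip_z_lip y s t : `|strip_z (y, s) - strip_z (y, t)| <= B * (2 * L * C) * `|s - t|.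
Proof.
have L0 := lip2_ge0 VL.
have dist0 := normr_ge0 (s - t).
(* If neither point lies in the strip both values are 0, and if only the second does the roles are
   exchanged. *)
wlog Ks : s t dist0 / X y <= s <= X y + d.
  move=> H; have [|hs] := boolP (X y <= s <= X y + d); first exact: H.
  have [ht|ht] := boolP (X y <= t <= X y + d).
    by rewrite distrC (distrC s); exact: H.
  rewrite /strip_z !strip_phi_out ?mulr0 ?subrr ?normr0 ?mulr_ge0// => -[_]; exact/negP.
have wL : `|V (y, s) - V0 y| <= L * d.
  apply: le_trans (lip2_t VL _ _ _) _; rewrite ler_wpM2l//.
  by move: Ks => /andP[h1 h2]; rewrite ger0_norm ?subr_ge0// lerBlDl.
have eL : `|eta (tau (y, s)) - eta (tau (y, t))| <= C / d * `|s - t|.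
  have etaL u w : u <= w -> `|eta w - eta u| <= C * (w - u).
    move=> uw; have -> : C * (w - u) = C * (w - u) - C * (u - u) by rewrite subrr mulr0 subr0.
    apply: (@norm_le_of_derive _ _ eta' (fun z => C * (z - u)) (cst C)) => //.
    by move=> x _; exact: der_affine.
  have -> : C / d * `|s - t| = C * `|tau (y, s) - tau (y, t)|.
    have -> : tau (y, s) - tau (y, t) = (s - t) / d by rewrite /tau/=; ring.
    by rewrite normrM normfV (gtr0_norm d0); ring.
  have [h|h] := leP (tau (y, s)) (tau (y, t)).
    by rewrite distrC (distrC (tau _)) [X in C * X]ger0_norm ?subr_ge0//; exact: etaL.
  by rewrite [X in C * X]gtr0_norm ?subr_gt0//; apply: etaL; exact: ltW.
have -> : strip_z (y, s) - strip_z (y, t) = theta y *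
    ((V (y, s) - V0 y) * (eta (tau (y, s)) - eta (tau (y, t))) +
     (V (y, s) - V (y, t)) * eta (tau (y, t))).
  by rewrite /strip_z /strip_phi /=; ring.
rewrite normrM -mulrA; apply: ler_pM => //.
apply: le_trans (ler_normD _ _) _; rewrite !normrM.
have h1 : `|V (y, s) - V0 y| * `|eta (tau (y, s)) - eta (tau (y, t))| <= (L * d) * (C / d * `|s - t|).
  by apply: ler_pM.
have h2 : `|V (y, s) - V (y, t)| * `|eta (tau (y, t))| <= (L * `|s - t|) * C.
  by apply: ler_pM => //; exact: lip2_t VL _ _ _.
apply: le_trans (lerD h1 h2) _; apply: le_of_eq; field.
by rewrite gt_eqF.
Qed.

Lemma strip_wz_bound p : `|wder_t strip_z p| <= B * (2 * L * C).
Proof. by apply: wder_bound => s t; exact: strip_z_lip. Qed.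

Let z0 p : ~ strip_set p -> strip_z p = 0.
Proof. by move=> /strip_out[h _ _]; rewrite /strip_z h mulr0. Qed.

Let cVV0 : continuous (fun p => V p - V0 p.1).
Proof. by move=> p; apply: cvgB; [exact: cV|exact: (cfst cV0)]. Qed.

Let nz : nice2 strip_z.
Proof. by apply: nice2MC cVV0 strip_phi_continuous _ => p /strip_out[]. Qed.

Lemma strip_wz_out p : ~ strip_set p -> wder_t strip_z p = 0.
Proof. exact: wder_t_vanish clK z0 p. Qed.

Let nice2_of (u : R * R -> R) (Cu : R) : measurable_fun [set: mR * mR] u ->
  (forall p, `|u p| <= Cu) -> (forall p, ~ strip_set p -> u p = 0) -> nice2 u.
Proof.
move=> mu' uC u0; split => //; have [N NK] := compact_bounded2 strip_set_compact.
exists Cu, N; split => // p hN; apply: u0 => /NK[h1 h2].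
by move: hN; rewrite !ltNge h1 h2.
Qed.

Lemma strip_wz_nice : nice2 (wder_t strip_z).
Proof.
apply: (nice2_of _ strip_wz_bound strip_wz_out).
by apply: measurable_wder_t; case: nz.
Qed.

Lemma strip_h_nice : nice2 strip_h.
Proof.
have [h _] := nice2_lin 1 (-4) strip_e_nice strip_wz_nice.
by move: h; congr nice2; apply/funext => p; rewrite mul1r mulNr.
Qed.

Lemma strip_h_out p : ~ strip_set p -> strip_h p = 0.
Proof. by move=> Kp; have [_ _ h] := strip_out Kp; rewrite /strip_h h strip_wz_out// mulr0 subr0. Qed.

Let phiBC p : `|strip_phi p| <= B * C.
Proof. by rewrite normrM ler_pM. Qed.

Let phi2_lip y s t : `|strip_phi (y, s) ^+ 2 - strip_phi (y, t) ^+ 2| <=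
  (2 * (B * C) * (B * (C / d))) * `|s - t|.
Proof.
have phiL u w : u <= w -> `|strip_phi (y, w) - strip_phi (y, u)| <= (B * (C / d)) * (w - u).
  move=> uw; set C' := B * (C / d).
  have -> : C' * (w - u) = C' * (w - u) - C' * (u - u) by rewrite subrr mulr0 subr0.
  apply: (@norm_le_of_derive _ (fun t => strip_phi (y, t)) (fun t => strip_phit (y, t))
     (fun z => C' * (z - u)) (cst C')) => //.
  - by move=> x _; exact: (dphit (y, x)).
  - by move=> x _; exact: der_affine.
  - move=> x _; rewrite normrM ler_pM//= normrM normfV (gtr0_norm d0).
    by rewrite ler_wpM2r// invr_ge0 ltW.
have phiL' : `|strip_phi (y, s) - strip_phi (y, t)| <= B * (C / d) * `|s - t|.
  have [h|h] := leP s t.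
    by rewrite distrC (distrC s) [X in _ <= _ * X]ger0_norm ?subr_ge0//; exact: phiL.
  by rewrite [X in _ <= _ * X]gtr0_norm ?subr_gt0//; apply: phiL; exact: ltW.
rewrite subr_sqr normrM mulrC -[leRHS]mulrA; apply: ler_pM => //.
apply: le_trans (ler_normD _ _) _.
by have := phiBC (y, s); have := phiBC (y, t); lra.
Qed.

Let nphi2 : nice2 (fun q => strip_phi q ^+ 2).
Proof.
by apply: (@nice2MC strip_phi strip_phi) => [||p /strip_out[]//]; exact: strip_phi_continuous.
Qed.

Lemma strip_k_out p : ~ strip_set p -> strip_k p = 0.
Proof.
move=> Kp; rewrite /strip_k (wder_t_vanish clK _ Kp) ?mulr0// => q /strip_phi_out ->.
by rewrite expr0n.
Qed.

Lemma strip_k_nice : nice2 strip_k.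
Proof.
apply: nice2Z; apply: (@nice2_of _ (2 * (B * C) * (B * (C / d)))).
- by apply: measurable_wder_t; case: nphi2.
- by move=> p; apply: (@wder_bound _ (fun t => strip_phi (p.1, t) ^+ 2)) => s t; exact: phi2_lip.
- by apply: wder_t_vanish clK _ => q /strip_phi_out ->; rewrite expr0n.
Qed.

Section test.
Variables (Om : set (R * R)) (psi : R * R -> R).
Hypothesis tpsi : test_fun Om psi.

Lemma strip_weak_k :
  \int[mu2]_p (strip_k p * psi p) = \int[mu2]_p (2 * strip_phi p ^+ 2 * pd_t psi p).
Proof.
have [spsi [J [cJ JOm psi0]]] := tpsi.
have [c0 cy ct dy dt] := smooth_pd spsi.
have clJ : closed J by exact: compact_closed.
have n0 := continuous_nice2 c0 cJ psi0.
have nt := continuous_nice2 ct cJ (fun p Jp => partial_vanish true clJ psi0 Jp).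
have [mphi2 [M2 [_ [phi2M _]]]] := nphi2.
have := ibp_t mphi2 phi2_lip phi2M dt n0 nt => E.
have [mw _] := strip_k_nice.
have nw : nice2 (fun p => wder_t (fun q => strip_phi q ^+ 2) p * psi p).
  apply: (nice2M n0 (measurable_wder_t mphi2)) => p.
  by apply: (@wder_bound _ (fun t => strip_phi (p.1, t) ^+ 2)) => s t; exact: phi2_lip.
have nr : nice2 (fun p => strip_phi p ^+ 2 * pd_t psi p) by exact: (nice2M nt mphi2 phi2M).
transitivity (- 2 * \int[mu2]_p (wder_t (fun q => strip_phi q ^+ 2) p * psi p)).
  by rewrite -nice2_intZ//; apply: eq_Rintegral => p _; rewrite mulrA.
rewrite E mulrNN -nice2_intZ//.
by apply: eq_Rintegral => p _; rewrite mulrA.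
Qed.

(** With [phi_y = e + 4 V0 phi_t], partial integration in [y], in [t], and of the Lipschitz function
    [strip_z] gives three identities; in their combination the integral of [V0 phi psi_t] occurs
    with opposite signs and drops out. *)
Lemma strip_weak_h :
  \int[mu2]_p (strip_h p * psi p) =
  \int[mu2]_p (- strip_phi p * pd_y psi p + 4 * V p * strip_phi p * pd_t psi p).
Proof.
have [spsi [J [cJ JOm psi0]]] := tpsi.
have [c0 cy ct dy dt] := smooth_pd spsi.
have clJ : closed J by exact: compact_closed.
have n0 := continuous_nice2 c0 cJ psi0.
have nt := continuous_nice2 ct cJ (fun p Jp => partial_vanish true clJ psi0 Jp).
have o p : ~ strip_set p -> strip_phi p = 0 by exact: strip_phi_out.
have cV01 := cfst cV0.
have cM (f g : R * R -> R) : continuous f -> continuous g -> continuous (fun p => f p * g p).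
  by move=> cf cg p; apply: cvgM; [exact: cf|exact: cg].
pose E p := strip_e p * psi p.
pose P2 p := pd_y psi p * strip_phi p.
pose T1 p := (V0 p.1 * psi p) * strip_phit p.
pose T2 p := (V0 p.1 * pd_t psi p) * strip_phi p.
pose U p := (V p * pd_t psi p) * strip_phi p.
pose Z p := wder_t strip_z p * psi p.
have nE : nice2 E.
  have := @nice2MC strip_e psi c0 ce (fun p Kp => let: And3 _ _ h := strip_out Kp in h).
  by congr nice2; apply/funext => p; rewrite mulrC.
have nP2 : nice2 P2 by exact: nice2MC cy strip_phi_continuous o.
have nT1 : nice2 T1 by apply: nice2MC (cM _ _ cV01 c0) cphit _ => p /strip_out[].
have nT2 : nice2 T2 by exact: nice2MC (cM _ _ cV01 ct) strip_phi_continuous o.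
have nU : nice2 U by exact: nice2MC (cM _ _ cV ct) strip_phi_continuous o.
have nZ : nice2 Z.
  by apply: (nice2M n0 _ strip_wz_bound); apply: measurable_wder_t; case: nz.
have EP : \int[mu2]_p (1 * E p + 4 * T1 p) = - \int[mu2]_p P2 p.
  have [nE4 _] := nice2_lin 1 4 nE nT1.
  apply/eqP; rewrite -subr_eq0 opprK -nice2_intD//; apply/eqP.
  apply: (@int_partial_y _ (fun p => psi p * strip_phi p)).
  - exact: nice2MC c0 strip_phi_continuous o.
  - exact: nice2D.
  - move=> p; apply: der_eq (der_mul (dy p) (dphiy p)) _.
    by rewrite /E /P2 /T1; case: p => y t /=; ring.
have ET : \int[mu2]_p T1 p = - \int[mu2]_p T2 p.
  apply/eqP; rewrite -subr_eq0 opprK -nice2_intD//; apply/eqP.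
  apply: (@int_partial_t _ (fun p => (V0 p.1 * psi p) * strip_phi p)).
  - exact: nice2MC (cM _ _ cV01 c0) strip_phi_continuous o.
  - exact: nice2D.
  - move=> p; apply: der_eq (der_mul (der_scale (V0 p.1) (dt p)) (dphit p)) _.
    by rewrite /T1 /T2; case: p => y t /=; ring.
have EZ : \int[mu2]_p Z p = - \int[mu2]_p (1 * U p + (- 1) * T2 p).
  have [mz [Mz [_ [zM _]]]] := nz.
  rewrite /Z (ibp_t mz strip_z_lip zM dt n0 nt); congr (- _).
  by apply: eq_Rintegral => p _; rewrite /U /T2 /strip_z; ring.
rewrite (nice2_lin 1 (-1) nU nT2).2 in EZ.
rewrite (nice2_lin 1 4 nE nT1).2 in EP.
transitivity (\int[mu2]_p (1 * E p + (- 4) * Z p)).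
  by apply: eq_Rintegral => p _; rewrite /strip_h /E /Z; ring.
rewrite (nice2_lin 1 (-4) nE nZ).2 EZ.
transitivity (\int[mu2]_p ((- 1) * P2 p + 4 * U p)); last first.
  by apply: eq_Rintegral => p _; rewrite /P2 /U; ring.
by rewrite (nice2_lin (-1) 4 nP2 nU).2; lra.
Qed.

End test.

(** Completing the square: [- V phi_y + 2 V ^ 2 phi_t] equals [2 (V - V0) ^ 2 phi_t - V e - 2 V0 ^ 2
    phi_t], and the last term integrates to 0 in [t]. On the strip the square is of order [d ^ 2]
    and [phi_t] of order [1 / d], so after division by the width [d] only [- V e] survives in the
    limit. *)
Lemma strip_igrad : \int[mu2]_p (igrad V p * strip_phi p) =
  \int[mu2]_p (2 * (V p - V0 p.1) ^+ 2 * strip_phit p - V p * strip_e p).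
Proof.
have o p : ~ strip_set p -> strip_phi p = 0 by exact: strip_phi_out.
have ot p : ~ strip_set p -> strip_phit p = 0 by case/strip_out.
have oe p : ~ strip_set p -> strip_e p = 0 by case/strip_out.
have cV01 := cfst cV0.
have cM (f g : R * R -> R) : continuous f -> continuous g -> continuous (fun p => f p * g p).
  by move=> cf cg p; apply: cvgM; [exact: cf|exact: cg].
have npy : nice2 (fun p => strip_e p + 4 * V0 p.1 * strip_phit p).
  apply: nice2D strip_e_nice _; apply: (@nice2MC strip_phit (fun p => 4 * V0 p.1)) => //.
  by apply: cM => // p; exact: cvg_cst.
rewrite (igrad_weak VL VM dphiy dphit strip_phi_nice npy strip_phit_nice).
pose A p := V0 p.1 ^+ 2 * strip_phit p.
have A0 : \int[mu2]_p A p = 0.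
  apply: (@int_partial_t _ (fun p => V0 p.1 ^+ 2 * strip_phi p)).
  - exact: (@nice2MC _ (fun p => V0 p.1 ^+ 2)) (cM _ _ cV01 cV01) strip_phi_continuous o.
  - exact: (@nice2MC _ (fun p => V0 p.1 ^+ 2)) (cM _ _ cV01 cV01) cphit ot.
  - by move=> p; have /= h := der_scale (V0 p.1 ^+ 2) (dphit p); exact: h.
have nA : nice2 A by exact: (@nice2MC _ (fun p => V0 p.1 ^+ 2)) (cM _ _ cV01 cV01) cphit ot.
pose G p := 2 * (V p - V0 p.1) ^+ 2 * strip_phit p - V p * strip_e p.
have nG : nice2 G.
  apply: nice2D.
    apply: (@nice2MC strip_phit (fun p => 2 * (V p - V0 p.1) ^+ 2)) => //.
    by move=> p; apply: cvgM; [exact: cvg_cst|exact: (cM _ _ cVV0 cVV0)].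
  have := @nice2MC strip_e (fun p => - V p) _ ce oe.
  have cNV : continuous (fun p => - V p) by move=> p; apply: cvgN; exact: cV.
  by move=> /(_ cNV); congr nice2; apply/funext => p; rewrite mulNr.
transitivity (\int[mu2]_p (1 * G p + (- 2) * A p)).
  by apply: eq_Rintegral => p _; rewrite /G /A; ring.
by rewrite (nice2_lin 1 (-2) nG nA).2 A0 mulr0 addr0 mul1r.
Qed.

End strip.

Lemma itv_norm_le (R : realType) (a b y : R) : a <= y <= b -> `|y| <= `|a| + `|b|.
Proof.
move=> /andP[h1 h2]; rewrite ler_norml; have := ler_norm b; have := ler_norm (- a).
rewrite normrN => h3 h4; have := normr_ge0 a; have := normr_ge0 b => h5 h6.
by apply/andP; split; lra.
Qed.

(** * From strips to line integrals *)

Section strip_limits.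
Variable R : realType.
Local Notation mR := (measurableTypeR R).
Local Notation mu := (@lebesgue_measure R).
Local Notation mu2 := (@leb2 R).

Lemma int_wder (u : R -> R) (L p q m : R) : (forall a b, `|u a - u b| <= L * `|a - b|) ->
  p <= q -> (forall t, t <= p -> u t = 0) -> (forall t, q <= t -> u t = m) ->
  \int[mu]_t wder u t = m.
Proof.
move=> uL pq u0 um; have -> : m = u (q + 1) - u (p - 1).
  by rewrite (u0 (p - 1)) ?(um (q + 1)) ?subr0//; lra.
rewrite -(wder_FTC uL); last lra.
rewrite [RHS]Rintegral_mkcond; apply: eq_Rintegral => t _; rewrite patchE.
case: ifPn => //; rewrite notin_setE/= in_itv/= => /negP; rewrite negb_and -leNgt -ltNge => /orP[h|h].
  apply: derive_wder; apply: is_derive_near (der_cst t 0).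
  near=> s; rewrite u0//.
  suff : s < p by move/ltW.
  by near: s; apply: lt_nbhsl; lra.
apply: derive_wder; apply: is_derive_near (der_cst t m).
near=> s; rewrite um//.
suff : q < s by move/ltW.
by near: s; apply: lt_nbhsr; lra.
Unshelve. all: by end_near. Qed.

Lemma Rintegral_short (u : R -> R) (C x d : R) : nice1 u -> (forall t, `|u t| <= C) -> 0 <= d ->
  (forall t, ~~ (x <= t <= x + d) -> u t = 0) -> `|\int[mu]_t u t| <= C * d.
Proof.
move=> nu uC d0 u0; have C0 : 0 <= C by exact: le_trans (uC 0).
have mI : measurable (`[x, x + d]%classic : set mR) by exact: measurable_itv.
apply: le_trans (le_normr_Rintegral measurableT (nice1_integrable nu)) _.
have -> : C * d = \int[mu]_(t in `[x, x + d]%classic) C.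
  rewrite Rintegral_cst//= lebesgue_measure_itv/= lte_fin ltrDl.
  case: ltP => [_|]; first by congr (C * _); rewrite /=; ring.
  by move=> h; congr (C * _); apply/eqP; rewrite eq_le d0 h.
rewrite [leRHS]Rintegral_mkcond.
have nI : nice1 ((fun=> C) \_ (`[x, x + d]%classic : set R)).
  split; first by apply/(measurable_restrictT _ mI); exact: measurable_cst.
  exists C, (`|x| + d); split=> t; rewrite patchE; case: ifPn => // h.
  - by rewrite ger0_norm.
  - by rewrite normr0.
  - move: h; rewrite inE/= in_itv/= => /andP[h1 h2]; rewrite ltNge => /negP[]; rewrite ler_norml.
    have := ler_norm x; have := ler_norm (- x); rewrite normrN => h3 h4.
    by apply/andP; split; lra.
apply: le_Rintegral => //; [|exact: nice1_integrable|].
  by apply: nice1_integrable; split;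
    [apply: measurableT_comp => //; case: nu|case: nu => _ [M [N [uM uN]]]; exists M, N; split => t;
     [rewrite normr_id|move=> /uN ->; rewrite normr0]].
move=> t _; rewrite patchE; case: ifPn => [_|]; first exact: uC.
by rewrite notin_setE/= in_itv/= => /negP h; rewrite u0// normr0.
Qed.

(** Fubini reduces to slices, [right_pt_limit] gives the limit on almost every slice, and the
    constant [B C] on [[a, b]] dominates because each slice of [w n] is supported on a length of at
    most [1 / (n + 1)]. *)
Lemma slice_limit (F : R * R -> R) (X : R -> R) (w : nat -> R * R -> R) (m : R -> R) (a b B C : R) :
  measurable_fun [set: mR * mR] F -> (forall p, `|F p| <= B) -> continuous X -> a <= b ->
  {ae mu, forall y, a <= y <= b -> right_pt (fun t => F (y, t)) (X y)} ->
  (forall n, nice2 (w n)) -> (forall n p, `|w n p| <= C) ->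
  (forall n (p : R * R), ~~ ((a <= p.1 <= b) && (X p.1 <= p.2 <= X p.1 + n.+1%:R^-1)) -> w n p = 0) ->
  measurable_fun [set: mR] m -> (forall y, ~~ (a <= y <= b) -> m y = 0) ->
  (forall y, n.+1%:R * \int[mu]_t w n (y, t) @[n --> \oo] --> m y) ->
  n.+1%:R * \int[mu2]_p (F p * w n p) @[n --> \oo] --> \int[mu]_y (F (y, X y) * m y).
Proof.
move=> mF FB cX ab goodX nw wC w0 mm m0 wm.
have B0 : 0 <= B by exact: le_trans (FB (0, 0)).
have C0 : 0 <= C by exact: le_trans (wC 0%N (0, 0)).
have nFw n : nice2 (fun p => F p * w n p) by exact: (nice2M (nw n) mF FB).
pose f n (y : R) := (n.+1%:R%:E * fubini_F mu (fun p => (F p * w n p)%:E) y)%E.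
have fE n y : f n y = (n.+1%:R * \int[mu]_t (F (y, t) * w n (y, t)))%:E.
  by rewrite EFinM (EFin_Rintegral1 (nice2_slice1 y (nFw n))).
have mI : measurable (`[a, b]%classic : set mR) by exact: measurable_itv.
have mFX : measurable_fun [set: mR] (fun y => F (y, X y)).
  apply: (measurableT_comp mF); apply: measurable_fun_pair => //.
  exact: continuous_measurable_fun.
have mlim : measurable_fun [set: mR] (fun y => (F (y, X y) * m y)%:E).
  by apply/measurable_EFinP; exact: measurable_funM.
have fb n y : `|n.+1%:R * \int[mu]_t (F (y, t) * w n (y, t))| <= B * C * \1_(`[a, b]%classic) y.
  rewrite indicE; have [yab|yab] := boolP (y \in _); last first.
    have z t : F (y, t) * w n (y, t) = 0.
      rewrite w0 ?mulr0// negb_and; apply/orP; left; apply/negP => h.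
      by move: yab; rewrite notin_setE/= in_itv/= h.
    rewrite (_ : \int[mu]_t (F (y, t) * w n (y, t)) = 0) ?mulr0 ?normr0//.
    by rewrite (funext z) Rintegral_cst// mul0r.
  rewrite mulr1 normrM (ger0_norm (_ : 0 <= n.+1%:R))//.
  have h : `|\int[mu]_t (F (y, t) * w n (y, t))| <= B * C * n.+1%:R^-1.
    apply: (Rintegral_short (x := X y) (nice2_slice1 y (nFw n))) => //.
      by move=> t; rewrite normrM ler_pM.
    by move=> t h; rewrite w0 ?mulr0// negb_and h orbT.
  apply: le_trans (ler_wpM2l _ h) _ => //.
  by rewrite mulrCA divff ?mulr1// pnatr_eq0.
have nI : nice1 (fun y : R => B * C * \1_(`[a, b]%classic) y).
  split; first by apply: measurable_funM => //; apply: measurable_indic.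
  exists (B * C), (`|a| + `|b|); split => y; rewrite indicE; case: (boolP (y \in _)) => h.
  - by rewrite mulr1 ger0_norm// mulr_ge0.
  - by rewrite mulr0 normr0 mulr_ge0.
  - by move: h; rewrite inE/= in_itv/= => h; rewrite ltNge itv_norm_le.
  - by rewrite mulr0.
have fae : {ae mu, forall y, [set: mR] y -> f n y @[n --> \oo] --> (F (y, X y) * m y)%:E}.
  apply: ae_sub goodX => y gy _; rewrite (funext (fun n => fE n y)); apply: cvg_EFin; first exact: nearW.
  have [yab|yab] := boolP (a <= y <= b); last first.
    rewrite m0// mulr0; apply: cvg_near_cst; apply: nearW => n.
    by apply/eqP; rewrite -normr_le0 (le_trans (fb n y))// indicE memNset ?mulr0//= in_itv/=; exact/negP.
  apply: (right_pt_limit (B := B) (C := C) _ _ (gy yab)) => //.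
  - exact: measurable_fun_pair2.
  - by move=> n; case: (nice2_slice1 y (nw n)).
  - by move=> n t h; apply: w0; rewrite negb_and h orbT.
have gae : {ae mu, forall y, forall n, [set: mR] y ->
    (`|f n y| <= (B * C * \1_(`[a, b]%classic : set R) y)%:E)%E}.
  by apply: aeW => y n _; rewrite fE lee_fin; exact: fb.
have mf n : measurable_fun [set: mR] (f n).
  exact: measurable_funeM (measurable_fubini_F (nice2_integrable (nFw n))).
have [flim _ fcvg] := dominated_convergence measurableT mf mlim fae (nice1_integrable nI) gae.
have E n : (\int[mu]_y f n y = (n.+1%:R * \int[mu2]_p (F p * w n p))%:E)%E.
  rewrite integralZl//; last exact: (integrable_fubini_F (nice2_integrable (nFw n))).
  by rewrite (integral12_prod_meas1 (nice2_integrable (nFw n))) EFinM EFin_Rintegral2.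
have E' : (\int[mu]_y (F (y, X y) * m y)%:E = (\int[mu]_y (F (y, X y) * m y))%:E)%E.
  by rewrite /Rintegral fineK// integrable_fin_num.
rewrite E' (funext E) in fcvg.
exact: (fine_cvg fcvg).
Qed.

End strip_limits.

Definition clamp (R : realType) (a b y : R) : R := Num.max a (Num.min y b).

Lemma clamp_in (R : realType) (a b y : R) : a <= b -> a <= clamp a b y <= b.
Proof. by move=> ab; rewrite /clamp le_max lexx ge_max ab/= ge_min lexx orbT. Qed.

Lemma clamp_id (R : realType) (a b y : R) : a <= y <= b -> clamp a b y = y.
Proof. by move=> /andP[? ?]; rewrite /clamp min_l// max_r. Qed.

Lemma clamp_lip (R : realType) (a b x y : R) : `|clamp a b x - clamp a b y| <= `|x - y|.
Proof.
wlog xy : x y / x <= y.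
  by move=> wl; have [/wl//|/ltW/wl] := leP x y; rewrite distrC (distrC y).
rewrite (distrC x) (ger0_norm (_ : 0 <= y - x)) ?subr_ge0// /clamp !maxEle !minEle.
have [?|?] := leP x b; have [?|?] := leP y b; try (have [?|?] := leP a x);
  try (have [?|?] := leP a y); try (have [?|?] := leP a b);
  rewrite ler_norml; apply/andP; split; lra.
Qed.

Lemma cvg0_of_norm_le (R : realType) (f h : nat -> R) : (forall n, `|f n| <= h n) ->
  h n @[n --> \oo] --> (0 : R) -> f n @[n --> \oo] --> (0 : R).
Proof.
move=> fh h0; apply: (squeeze_cvgr (f := fun n => - h n) (h := h)) => //.
  by apply: nearW => n; rewrite -ler_norml.
by rewrite -[X in _ --> X]oppr0; exact: cvgN.
Qed.

Section scaled_profile.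
Variables (R : realType) (eta eta' H : R -> R) (c C : R).
Hypotheses (deta : forall x : R, is_derive x 1 eta (eta' x)) (dH : forall x : R, is_derive x 1 H (eta x)).
Hypothesis eta0 : forall x, ~~ (0 <= x <= 1) -> eta x = 0 /\ eta' x = 0.
Hypotheses (H0 : forall x, x <= 0 -> H x = 0) (H1 : forall x, 1 <= x -> H x = c).
Hypothesis etaC : forall x, `|eta x| <= C.
Variables (d x : R).
Hypothesis d0 : 0 < d.
Local Notation mR := (measurableTypeR R).
Local Notation mu := (@lebesgue_measure R).

Lemma profile_derive (z : R) : is_derive z 1 (fun s => d * H ((s - x) / d)) (eta ((z - x) / d)).
Proof.
have dz : is_derive z 1 (fun s => (s - x) / d) d^-1.
  by apply: der_eq (der_mul (der_sub (der_id z) (der_cst z x)) (der_cst z d^-1)) _; ring.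
have /= h := der_scale d (der_comp (dH _) dz).
by apply: der_eq h _; field; rewrite gt_eqF.
Qed.

Lemma profile_out t : ~~ (x <= t <= x + d) -> eta ((t - x) / d) = 0.
Proof.
move=> ht; apply: (eta0 _).1; apply: contra ht => /andP[].
by rewrite pmulr_lge0 ?invr_gt0// ler_pdivrMr// mul1r subr_ge0 lerBlDl => -> ->.
Qed.

Lemma profile_continuous : continuous (fun t => eta ((t - x) / d)).
Proof.
move=> t; apply: (@continuous_comp _ _ _ (fun t => (t - x) / d) eta).
  by apply: cvgM; [apply: cvgB; [exact: cvg_id|exact: cvg_cst]|exact: cvg_cst].
exact: der_continuous (deta _).
Qed.

Lemma profile_nice : nice1 (fun t => eta ((t - x) / d)).
Proof.
split; first exact: continuous_measurable_fun profile_continuous.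
exists C, (`|x| + d); split => // t ht; apply: profile_out; apply/negP => /andP[h1 h2].
move: ht; rewrite ltNge => /negP; apply; rewrite ler_norml.
have := ler_norm x; have := ler_norm (- x); rewrite normrN => h3 h4.
by apply/andP; split; move: d0; lra.
Qed.

Lemma profile_int : \int[mu]_t eta ((t - x) / d) = c * d.
Proof.
pose U t := d * H ((t - x) / d).
transitivity (\int[mu]_t wder U t).
  apply: eq_Rintegral => z _; apply/esym; apply: derive_wder; exact: profile_derive.
apply: (@int_wder R U C x (x + d)) => [s t||t tx|t tx]; last 3 first.
- by rewrite lerDl ltW.
- by rewrite /U H0 ?mulr0// pmulr_lle0 ?invr_gt0// subr_le0.
- by rewrite /U H1; [rewrite mulrC|rewrite ler_pdivlMr// mul1r lerBrDl].
wlog st : s t / t <= s.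
  move=> wl; have [st|st] := leP t s; first exact: wl.
  by rewrite distrC (distrC s); apply: wl; exact: ltW.
rewrite (ger0_norm (_ : 0 <= s - t)) ?subr_ge0//.
have -> : C * (s - t) = C * (s - t) - C * (t - t) by rewrite subrr mulr0 subr0.
apply: (@norm_le_of_derive _ U (fun s => eta ((s - x) / d)) (fun z => C * (z - t)) (cst C)) => //.
  by move=> z _; exact: profile_derive.
by move=> z _; exact: der_affine.
Qed.

End scaled_profile.

Lemma continuous_right_pt (R : realType) (f : R -> R) x : continuous f -> right_pt f x.
Proof.
move=> cf; apply: lebesgue_right_pt; first exact: continuous_measurable_fun.
apply: (@continuous_lebesgue_pt _ _ _ setT) => //; last exact: cf.
  by split; [exact: openT|].
by apply: continuous_measurable_fun.
Qed.

Lemma ae_exists_itv (R : realType) (P : R -> Prop) (a b : R) : a < b ->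
  {ae @lebesgue_measure R, forall x, P x} -> exists2 x, a < x < b & P x.
Proof.
move=> ab [N [mN N0 PN]]; apply: contrapT => nex.
have : (@lebesgue_measure R `]a, b[%classic <= 0)%E.
  rewrite -N0; apply: le_measure; [by rewrite inE; exact: measurable_itv|by rewrite inE|].
  by move=> x /=; rewrite in_itv/= => h; apply: PN => Px; apply: nex; exists x.
by rewrite lebesgue_measure_itv/= lte_fin ab -EFinB lee_fin subr_le0 leNgt ab.
Qed.

(** Du Bois-Reymond lemma, at right Lebesgue points. With [theta'] the difference of two rescaled
    profiles, one at [p] and one at [q], the weak equation equates two averages that tend to
    [f p * c] and [f q * c]. *)
Lemma const_of_weak (R : realType) (f : R -> R) (B c1 c2 : R) :
  measurable_fun [set: measurableTypeR R] f -> (forall x, `|f x| <= B) ->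
  (forall (theta theta' : R -> R) (a b C : R),
    (forall y : R, is_derive y 1 theta (theta' y)) -> continuous theta' ->
    c1 < a -> a <= b -> b < c2 ->
    (forall y, ~~ (a <= y <= b) -> theta y = 0 /\ theta' y = 0) ->
    (forall y, `|theta y| <= C) -> (forall y, `|theta' y| <= C) ->
    \int[@lebesgue_measure R]_y (f y * theta' y) = 0) ->
  forall p q, c1 < p < c2 -> c1 < q < c2 -> right_pt f p -> right_pt f q -> f p = f q.
Proof.
move=> mf fB weak; suff H p q : c1 < p -> p < q -> q < c2 ->
    right_pt f p -> right_pt f q -> f p = f q.
  move=> p q /andP[p1 p2] /andP[q1 q2] fp fq; have [pq|qp|->//] := ltgtP p q.
    exact: H.
  by apply/esym; exact: H.
move=> c1p pq qc2 fp fq.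
have [eta [eta' [H [c [C [[deta dH eta0 H0 H1] [c0 etaC eta'C ceta']]]]]]] := profile_exists R.
have C0 : 0 <= C by exact: le_trans (etaC 0).
pose dl n : R := n.+1%:R^-1.
have dl0 n : 0 < dl n by rewrite invr_gt0.
have dl1 n : n.+1%:R * dl n = 1 by rewrite divff// pnatr_eq0.
have cdl : dl n @[n --> \oo] --> (0 : R) by exact: cvg_harmonic.
have ne n x := profile_nice deta eta0 etaC x (dl0 n).
have lim x : right_pt f x ->
    n.+1%:R * \int[lebesgue_measure]_t (f t * eta ((t - x) / dl n)) @[n --> \oo] --> f x * c.
  move=> fx; apply: (right_pt_limit mf fB fx (C := C)) => [n|n t|n t|].
  - by have [] := ne n x.
  - exact: etaC.
  - exact: (profile_out eta0 (dl0 n)).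
  - apply: cvg_near_cst; apply: nearW => n.
    by rewrite (profile_int dH H0 H1 etaC _ (dl0 n)) mulrCA dl1 mulr1.
apply: (mulIf (_ : c != 0)); first by rewrite gt_eqF.
rewrite -(cvg_lim _ (lim _ fq))//; apply/esym; apply: cvg_lim => //.
apply: cvg_trans (lim _ fp); apply: near_eq_cvg.
have : \forall n \near \oo, dl n < c2 - q by apply: (cvgr_lt 0 cdl); rewrite subr_gt0.
apply: filterS => n hn; congr (_ * _).
(* Each term is a smooth step of height [c] times [dl n]; the difference is 0 again beyond
   [q + dl n], so it has compact support. *)
pose th y := dl n * H ((y - p) / dl n) - dl n * H ((y - q) / dl n).
pose th' y := eta ((y - p) / dl n) - eta ((y - q) / dl n).
have th_out y : ~~ (p <= y <= q + dl n) -> th y = 0 /\ th' y = 0.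
  move=> hy; split.
    move: hy; rewrite negb_and -!ltNge => /orP[hy|hy].
      by rewrite /th !H0 ?subrr// pmulr_lle0 ?invr_gt0// subr_le0 ltW// (lt_trans hy).
    by rewrite /th !H1 ?subrr// ler_pdivlMr// mul1r lerBrDl; move: pq hy; lra.
  by rewrite /th' !(profile_out eta0 (dl0 n)) ?subrr//; apply: contra hy => /andP[h1 h2];
    apply/andP; move: h1 h2 pq; have := dl0 n; split; lra.
have [N [_ HN]] : bounded_set (H @` `[0, 1]%classic).
  apply: compact_bounded; apply: continuous_compact; last exact: segment_compact.
  by apply: continuous_subspaceT => y; exact: der_continuous (dH y).
have HB y : `|H y| <= `|N + 1| + `|c|.
  have [y0|y0] := leP y 0; first by rewrite H0// normr0 addr_ge0.
  have [y1|y1] := leP 1 y; first by rewrite H1// lerDr.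
  apply: (@le_trans _ _ `|N + 1|); last by rewrite lerDl.
  apply: (HN `|N + 1|); last by exists y => //=; rewrite in_itv/= !ltW.
  by rewrite (lt_le_trans _ (ler_norm _))// ltrDl.
pose Bt := dl n * (`|N + 1| + `|c|) *+ 2 + C *+ 2.
have E : \int[lebesgue_measure]_y (f y * th' y) = 0.
  apply: (weak th th' p (q + dl n) Bt) => //.
  - by move=> y; apply: der_sub; exact: profile_derive.
  - move=> y; apply: cvgB; exact: profile_continuous.
  - by rewrite ltW// (lt_trans pq)// ltrDl.
  - by rewrite -ltrBrDl.
  - move=> y; rewrite /Bt; apply: (@le_trans _ _ (dl n * (`|N + 1| + `|c|) *+ 2)).
      apply: le_trans (ler_normB _ _) _; rewrite mulr2n.
      by apply: lerD; rewrite normrM (gtr0_norm (dl0 n)) ler_wpM2l// ltW.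
    by rewrite lerDl mulrn_wge0.
  - move=> y; rewrite /Bt; apply: (@le_trans _ _ (C *+ 2)).
      by apply: le_trans (ler_normB _ _) _; rewrite mulr2n; apply: lerD.
    by rewrite lerDr mulrn_wge0// mulr_ge0 ?addr_ge0// ltW.
have n1 x := nice1M (ne n x) mf fB.
have Ef y : f y * th' y = f y * eta ((y - p) / dl n) + (- 1) * (f y * eta ((y - q) / dl n)).
  by rewrite /th'; ring.
move: E; rewrite (funext Ef).
rewrite nice1_intD//; last exact: nice1Z.
by rewrite nice1_intZ// mulN1r => /subr0_eq.
Qed.

Lemma slope_energy_inj (R : realType) : injective (@slope_energy R).
Proof.
move=> a b; rewrite /slope_energy => E.
have pos (x : R) : 0 < 1 + x ^+ 2 by rewrite ltr_pwDl// sqr_ge0.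
have s0 x : 0 < Num.sqrt (1 + x ^+ 2 : R) by rewrite sqrtr_gt0.
have E1 : a * Num.sqrt (1 + b ^+ 2) = b * Num.sqrt (1 + a ^+ 2).
  have na : Num.sqrt (1 + a ^+ 2) != 0 by rewrite gt_eqF.
  have nb : Num.sqrt (1 + b ^+ 2) != 0 by rewrite gt_eqF.
  by apply/eqP; rewrite -eqr_div//; apply/eqP.
have E2 : a ^+ 2 = b ^+ 2.
  have : (a * Num.sqrt (1 + b ^+ 2)) ^+ 2 = (b * Num.sqrt (1 + a ^+ 2)) ^+ 2 by rewrite E1.
  by rewrite !exprMn !sqr_sqrtr ?ltW// => E2; lra.
by move: E1; rewrite E2; apply: mulIf; rewrite gt_eqF.
Qed.

(** * Characteristics through good points *)

Section good_curve.
Variables (R : realType) (Om : set (R * R)) (v g V : R * R -> R) (L M : R).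
Hypotheses (oOm : open Om) (cv : {within Om, continuous v}).
Hypotheses (Bvg : Bweak Om v g) (VL : lip2 V L) (VM : forall p, `|V p| <= M).
Variables (c1 c2 d1 d2 : R).
Hypotheses (QOm : `[c1, c2]%classic `*` `[d1, d2]%classic `<=` Om).
Hypothesis (vV : forall p, (`[c1, c2]%classic `*` `[d1, d2]%classic) p -> v p = V p).
Hypothesis hmin : forall (vt gt : R * R -> R) (K : set (R * R)),
  {within Om, continuous vt} -> compact K -> K `<=` Om ->
  (forall p, Om p -> ~ K p -> vt p = v p) -> Bweak Om vt gt ->
  (areaH K g <= areaH K gt)%E.
Local Notation mR := (measurableTypeR R).
Local Notation mu := (@lebesgue_measure R).
Local Notation mu2 := (@leb2 R).
Variables (X : R -> R) (d3 : R).
Hypothesis dX : forall y : R, is_derive y 1 X (- 4 * V (y, X y)).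
Hypothesis d32 : d3 < d2.
Hypothesis XQ : forall y, c1 < y < c2 -> d1 < X y <= d3.
Let D := igrad V.
Hypothesis goodD : {ae mu, forall y, c1 < y < c2 -> right_pt (fun t => D (y, t)) (X y)}.
Hypothesis goodF : {ae mu, forall y, c1 < y < c2 -> right_pt (fun t => slope_energy (D (y, t))) (X y)}.

Let cX : continuous X. Proof. by move=> y; exact: der_continuous (dX y). Qed.
Let mD : measurable_fun [set: mR * mR] D. Proof. exact: igrad_measurable VL. Qed.
Let mF : measurable_fun [set: mR * mR] (fun p => slope_energy (D p)).
Proof.
apply: measurableT_comp mD; apply: continuous_measurable_fun.
exact: slope_energy_continuous.
Qed.

Section test.
Variables (theta theta' : R -> R) (a b B : R).
Hypothesis dtheta : forall y : R, is_derive y 1 theta (theta' y).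
Hypothesis ctheta' : continuous theta'.
Hypotheses (ca : c1 < a) (ab : a <= b) (bc : b < c2).
Hypothesis theta0 : forall y, ~~ (a <= y <= b) -> theta y = 0 /\ theta' y = 0.
Hypotheses (thetaB : forall y, `|theta y| <= B) (theta'B : forall y, `|theta' y| <= B).

Let ctheta : continuous theta. Proof. by move=> y; exact: der_continuous (dtheta y). Qed.
Let inab (P : R -> Prop) : {ae mu, forall y, c1 < y < c2 -> P y} ->
  {ae mu, forall y, a <= y <= b -> P y}.
Proof.
apply: ae_sub => y h /andP[h1 h2]; apply: h.
by rewrite (lt_le_trans ca h1) (le_lt_trans h2 bc).
Qed.

(** Limits of [stationary] and of [strip_igrad], divided by the width [1 / (n + 1)] of the strip.
    The first says that [slope_energy (igrad V)] has zero weak derivative on the curve, the second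
    that [igrad V] is the weak derivative of [V] along it. The strips lie on the side [t >= X y],
    for which the margin [d2 - d3] leaves room. *)
Lemma good_curve_weak :
  \int[mu]_y (slope_energy (D (y, X y)) * theta' y) = 0 /\
  \int[mu]_y (D (y, X y) * theta y) = - \int[mu]_y (V (y, X y) * theta' y).
Proof.
have [eta [eta' [H [c [C [[deta dH eta0 H0 H1] [c0 etaC eta'C ceta']]]]]]] := profile_exists R.
have C0 : 0 <= C by exact: le_trans (etaC 0).
have B0 : 0 <= B by exact: le_trans (thetaB 0).
have L0 := lip2_ge0 VL.
pose dl n : R := n.+1%:R^-1.
have dl0 n : 0 < dl n by rewrite invr_gt0.
have dl1 n : n.+1%:R * dl n = 1 by rewrite divff// pnatr_eq0.
have int_eta n x : \int[mu]_t eta ((t - x) / dl n) = c * dl n by exact: (profile_int dH H0 H1 etaC).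
pose ph n := strip_phi X eta theta (dl n).
pose e n := strip_e X eta theta' (dl n).
pose h n := strip_h V X eta theta theta' (dl n).
pose z n := strip_z V X eta theta (dl n).
pose q n p := (2 * (V p - V (p.1, X p.1)) ^+ 2) * strip_phit X eta' theta (dl n) p.
have nph n : nice2 (ph n) by eapply strip_phi_nice; try eassumption.
have ne n : nice2 (e n) by eapply strip_e_nice; try eassumption; try exact: dl0.
have nh n : nice2 (h n) by eapply strip_h_nice; try eassumption; try exact: dl0.
have nt n : nice2 (strip_phit X eta' theta (dl n)).
  by eapply strip_phit_nice; try eassumption; try exact: dl0.
have zl n y s t : `|z n (y, s) - z n (y, t)| <= B * (2 * L * C) * `|s - t|.
  by eapply strip_z_lip; try eassumption; try exact: dl0.
have wzB n p : `|wder_t (z n) p| <= B * (2 * L * C).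
  by eapply strip_wz_bound; try eassumption; try exact: dl0.
have o n p : ~ strip_set X a b (dl n) p ->
    [/\ ph n p = 0, strip_phit X eta' theta (dl n) p = 0 & e n p = 0].
  by eapply strip_out; try eassumption; try exact: dl0.
have ho n p : ~ strip_set X a b (dl n) p -> h n p = 0.
  by eapply strip_h_out; try eassumption; try exact: dl0.
have oi n (p : R * R) : ~~ ((a <= p.1 <= b) && (X p.1 <= p.2 <= X p.1 + n.+1%:R^-1)) ->
    ~ strip_set X a b (dl n) p.
  by move=> hp [h1 h2]; move: hp; rewrite h1 h2.
have phB n p : `|ph n p| <= B * C by rewrite normrM ler_pM.
have eB n p : `|e n p| <= B * C by rewrite normrM ler_pM.
have hB n p : `|h n p| <= B * C + 4 * (B * (2 * L * C)).
  apply: le_trans (ler_normB _ _) _; apply: lerD; first exact: eB.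
  by rewrite normrM (ger0_norm (_ : 0 <= 4))// ler_wpM2l//; exact: wzB.
have zo n y t : ~~ (X y <= t <= X y + dl n) -> z n (y, t) = 0.
  move=> ht; have [|ph0 _ _] := o n (y, t); first by move=> [_ h2]; move: ht; rewrite h2.
  by rewrite /z /strip_z -/(ph n) ph0 mulr0.
have mz y : ~~ (a <= y <= b) -> c * theta y = 0 /\ c * theta' y = 0.
  by move=> /theta0[-> ->]; rewrite !mulr0.
have mtheta : measurable_fun [set: mR] (fun y => c * theta y).
  by apply: measurable_funM => //; exact: continuous_measurable_fun.
have mtheta' : measurable_fun [set: mR] (fun y => c * theta' y).
  by apply: measurable_funM => //; exact: continuous_measurable_fun.
have neta n x : nice1 (fun t => eta ((t - x) / dl n)) by exact: (profile_nice deta eta0 etaC).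
have slice n y (k : R) : n.+1%:R * \int[mu]_t (k * eta ((t - X y) / dl n)) = c * k.
  rewrite (nice1_intZ _ (neta n _)) int_eta.
  by transitivity ((n.+1%:R * dl n) * (c * k)); [ring|rewrite dl1 mul1r].
(* On a slice [wder_t] of the compactly supported [strip_z] integrates to 0, so only [strip_e]
   contributes to the weight. *)
have h_slice n y : n.+1%:R * \int[mu]_t h n (y, t) = c * theta' y.
  have wz0 : \int[mu]_t wder_t (z n) (y, t) = 0.
    apply: (@int_wder R (fun t => z n (y, t)) _ (X y - 1) (X y + dl n + 1)) => [s t||t ht|t ht].
    - exact: zl.
    - by have := dl0 n; lra.
    - by apply: zo; rewrite negb_and -!ltNge; apply/orP; left; lra.
    - by apply: zo; rewrite negb_and -!ltNge; apply/orP; right; lra.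
  have nw : nice1 (fun t => wder_t (z n) (y, t)).
    have n2 : nice2 (wder_t (z n)) by eapply strip_wz_nice; try eassumption; try exact: dl0.
    exact: (nice2_slice1 y n2).
  rewrite -(slice n y); congr (_ * _).
  transitivity (\int[mu]_t (theta' y * eta ((t - X y) / dl n) + (- 4) * wder_t (z n) (y, t))).
    by apply: eq_Rintegral => t _; rewrite /h /strip_h mulNr.
  rewrite nice1_intD; [|exact: nice1Z|exact: nice1Z].
  by rewrite (nice1_intZ _ nw) wz0 mulr0 addr0.
have ph_slice n y : n.+1%:R * \int[mu]_t ph n (y, t) = c * theta y.
  by rewrite -(slice n y (theta y)).
have e_slice n y : n.+1%:R * \int[mu]_t e n (y, t) = c * theta' y.
  by rewrite -(slice n y (theta' y)).
have lim_h : n.+1%:R * \int[mu2]_p (slope_energy (D p) * h n p) @[n --> \oo] -->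
    \int[mu]_y (slope_energy (D (y, X y)) * (c * theta' y)).
  apply: (slice_limit (B := 1) mF (fun p => slope_energy_bound (D p)) cX ab _ nh hB) => //.
  - exact: inab goodF.
  - by move=> n p /oi; exact: ho.
  - by move=> y /mz[].
  - by move=> y; apply: cvg_near_cst; apply: nearW => n; exact: h_slice.
have lim_ph : n.+1%:R * \int[mu2]_p (D p * ph n p) @[n --> \oo] -->
    \int[mu]_y (D (y, X y) * (c * theta y)).
  apply: (slice_limit mD (igrad_bound VL VM) cX ab _ nph phB) => //.
  - exact: inab goodD.
  - by move=> n p /oi /o[].
  - by move=> y /mz[].
  - by move=> y; apply: cvg_near_cst; apply: nearW => n; exact: ph_slice.
have lim_e : n.+1%:R * \int[mu2]_p (V p * e n p) @[n --> \oo] -->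
    \int[mu]_y (V (y, X y) * (c * theta' y)).
  have mV := lip2_measurable VL.
  apply: (slice_limit mV VM cX ab _ ne eB) => //.
  - apply: aeW => y _; apply: continuous_right_pt.
    by apply: (lipschitz_continuous (L := L)) => s t; exact: (lip2_t VL).
  - by move=> n p /oi /o[].
  - by move=> y /mz[].
  - by move=> y; apply: cvg_near_cst; apply: nearW => n; exact: e_slice.
pose Kq := 2 * L ^+ 2 * (B * C).
have Kq0 : 0 <= Kq by rewrite !mulr_ge0 ?sqr_ge0.
(* The square is at most [(L d) ^ 2] and the derivative of the profile [C / d]; what is left is of
   order [d] and disappears in the limit. *)
have qB n p : `|q n p| <= Kq * dl n.
  have [hp|hp] := pselect (strip_set X a b (dl n) p); last first.
    by have [_ h2 _] := o _ _ hp; rewrite /q h2 mulr0 normr0 mulr_ge0// ltW.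
  have hV : `|V p - V (p.1, X p.1)| <= L * dl n.
    rewrite [in V p](surjective_pairing p); apply: le_trans (lip2_t VL _ _ _) _.
    by rewrite ler_wpM2l//; case: hp => _ /andP[h1 h2]; rewrite ger0_norm ?subr_ge0// lerBlDl.
  have -> : Kq * dl n = (2 * (L * dl n) ^+ 2) * (B * (C / dl n)).
    by rewrite /Kq; field; rewrite gt_eqF.
  rewrite /q normrM; apply: ler_pM => //.
    by rewrite (normrM 2) normrX (ger0_norm (_ : 0 <= 2))// ler_wpM2l// lerXn2r ?nnegrE// mulr_ge0// ltW.
  rewrite /strip_phit normrM; apply: ler_pM => //.
  by rewrite normrM normfV (gtr0_norm (dl0 n)) ler_wpM2r// invr_ge0 ltW.
have dle1 n : dl n <= 1 by rewrite invf_le1 ?ltr0n// ler1n.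
have nq n : nice2 (q n).
  have mV := lip2_measurable VL.
  apply: (@nice2M _ (strip_phit X eta' theta (dl n)) (fun p => 2 * (V p - V (p.1, X p.1)) ^+ 2) (2 * (M + M) ^+ 2)) => //.
    apply: measurable_funM => //; apply: measurable_funX; apply: measurable_funB => //.
    apply: (measurableT_comp mV); apply: measurable_fun_pair; first exact: measurable_fst.
    by apply: measurableT_comp; [exact: continuous_measurable_fun|exact: measurable_fst].
  move=> p; rewrite (normrM 2) normrX (ger0_norm (_ : 0 <= 2))// ler_wpM2l//.
  have M0 := bound_ge0 VM.
  rewrite lerXn2r ?nnegrE ?addr_ge0//; apply: le_trans (ler_normB _ _) _; exact: lerD.
have cdl : dl n @[n --> \oo] --> (0 : R) by exact: cvg_harmonic.
have lim_q : n.+1%:R * \int[mu2]_p (cst 1 p * q n p) @[n --> \oo] --> \int[mu]_y (cst 1 (y, X y) * cst 0 y).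
  apply: (slice_limit (B := 1) (C := Kq) _ _ cX ab _ nq) => //.
  - by move=> p; rewrite normr1.
  - by apply: aeW => y _; apply: continuous_right_pt => t; exact: cvg_cst.
  - by move=> n p; apply: le_trans (qB _ _) _; rewrite ler_piMr.
  - by move=> n p /oi /o[_ h2 _]; rewrite /q h2 mulr0.
  - move=> y; have hb n : `|n.+1%:R * \int[mu]_t q n (y, t)| <= Kq * dl n.
      rewrite normrM (ger0_norm (_ : 0 <= n.+1%:R))//.
      apply: (@le_trans _ _ (n.+1%:R * (Kq * dl n * dl n))); last first.
        by apply: le_of_eq; transitivity ((n.+1%:R * dl n) * (Kq * dl n)); [ring|rewrite dl1 mul1r].
      apply: ler_wpM2l => //; apply: (Rintegral_short (x := X y)) => //.
      + exact: nice2_slice1.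
      + exact: ltW.
      + move=> t ht; have [|_ h2 _] := o n (y, t); last by rewrite /q h2 mulr0.
        by move=> [_ h2]; move: ht; rewrite h2.
    apply: (cvg0_of_norm_le hb).
    by rewrite -[X in _ --> X](mulr0 Kq); apply: cvgM => //; exact: cvg_cst.
have lim0 : \int[mu]_y (slope_energy (D (y, X y)) * (c * theta' y)) = 0.
  rewrite -(cvg_lim _ lim_h)//; apply: cvg_lim => //.
  (* The strips stay in the rectangle once their width is below [d2 - d3]; from there on the
     sequence is identically 0. *)
  have [N hN] : exists N, forall n, (N <= n)%N -> dl n < d2 - d3.
    have : \forall n \near \oo, dl n < d2 - d3.
      by apply: (cvgr_lt 0 cdl); rewrite subr_gt0.
    by move=> [N _ hN]; exists N.
  apply: cvg_near_cst; exists N => // n /= Nn; rewrite (_ : \int[mu2]_p _ = 0) ?mulr0//.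
  apply: (stationary oOm cv Bvg VL VM QOm vV hmin (phi := ph n) (K := strip_set X a b (dl n))
    (k := strip_k X eta theta (dl n))) => //.
  - by apply: (strip_phi_continuous dX deta dtheta).
  - by eapply strip_set_compact; try eassumption.
  - move=> p [/andP[h1 h2] /andP[h3 h4]].
    have pc : c1 < p.1 < c2 by rewrite (lt_le_trans ca h1) (le_lt_trans h2 bc).
    split; rewrite /= in_itv//=; have /andP[h5 h6] := XQ pc.
    by rewrite (lt_le_trans h5 h3)/= (le_lt_trans h4)// -ltrBrDl (lt_le_trans (hN _ Nn))// lerB.
  - by move=> p /o[].
  - exact: ho.
  - by move=> p; eapply strip_k_out; try eassumption; try exact: dl0.
  - by eapply strip_k_nice; try eassumption; try exact: dl0.
  - by move=> psi tpsi; eapply strip_weak_h; try eassumption; try exact: dl0.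
  - by move=> psi tpsi; eapply strip_weak_k; try eassumption; try exact: dl0.
have Z (f k : R -> R) : nice1 (fun y => f y * k y) ->
    \int[mu]_y (f y * (c * k y)) = c * \int[mu]_y (f y * k y).
  by move=> nf; rewrite -(nice1_intZ c nf); apply: eq_Rintegral => y _; ring.
have cnz : c != 0 by rewrite gt_eqF.
have ntheta (k : R -> R) : continuous k -> (forall y, ~~ (a <= y <= b) -> k y = 0) ->
    (forall y, `|k y| <= B) -> nice1 k.
  move=> ck k0 kB; split; first exact: continuous_measurable_fun.
  exists B, (`|a| + `|b|); split => // y; rewrite ltNge => hy; apply: k0.
  by apply: contra hy => /itv_norm_le.
have n0 : nice1 theta by apply: ntheta => // y /theta0[].
have n1 : nice1 theta' by apply: ntheta => // y /theta0[].
have mX (G : R * R -> R) : measurable_fun [set: mR * mR] G -> measurable_fun [set: mR] (fun y => G (y, X y)).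
  by move=> mG; apply: (measurableT_comp mG); apply: measurable_fun_pair => //; exact: continuous_measurable_fun.
split.
  apply: (mulfI cnz); rewrite mulr0 -Z//.
  by apply: (nice1M n1 (mX _ mF)) => y; exact: slope_energy_bound.
have E n : \int[mu2]_p (D p * ph n p) = \int[mu2]_p (cst 1 p * q n p) - \int[mu2]_p (V p * e n p).
  have := @strip_igrad R V L M VL VM X dX eta eta' deta eta0 ceta' theta theta' a b dtheta ctheta' theta0 (dl n) (dl0 n).
  rewrite -/(D) -/(ph n) => ->.
  have nVe : nice2 (fun p => V p * e n p) by exact: (nice2M (ne n) (lip2_measurable VL) VM).
  transitivity (\int[mu2]_p (1 * q n p + (- 1) * (V p * e n p))).
    by apply: eq_Rintegral => p _; rewrite /q /e; ring.
  rewrite (nice2_lin 1 (- 1) (nq n) nVe).2 mul1r mulN1r; congr (_ - _).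
  by apply: eq_Rintegral => p _; rewrite mul1r.
have lim2 : n.+1%:R * \int[mu2]_p (D p * ph n p) @[n --> \oo] -->
    \int[mu]_y (cst 1 (y, X y) * cst 0 y) - \int[mu]_y (V (y, X y) * (c * theta' y)).
  have E' n : n.+1%:R * \int[mu2]_p (D p * ph n p) =
    n.+1%:R * \int[mu2]_p (cst 1 p * q n p) - n.+1%:R * \int[mu2]_p (V p * e n p).
    by rewrite E mulrBr.
  by rewrite (funext E'); exact: cvgB.
have lim3 : \int[mu]_y (D (y, X y) * (c * theta y)) =
    \int[mu]_y (cst 1 (y, X y) * cst 0 y) - \int[mu]_y (V (y, X y) * (c * theta' y)).
  by rewrite -(cvg_lim _ lim_ph)//; apply: cvg_lim.
apply: (mulfI cnz); rewrite mulrN -!Z.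
- rewrite lim3 (_ : \int[mu]_y (cst 1 (y, X y) * cst 0 y) = 0) ?sub0r//.
  by rewrite (eq_Rintegral _ _ (g := fun=> 0)) => [|y _]; rewrite ?Rintegral_cst ?mul0r ?mulr0.
- exact: (nice1M n1 (mX _ (lip2_measurable VL)) (fun y => VM (y, X y))).
- by apply: (nice1M n0 (mX _ mD)) => y; exact: igrad_bound VL VM _.
Qed.
End test.

(** [const_of_weak] is used twice: for [slope_energy (igrad V)] along the curve, where injectivity
    then gives a constant [s], and for [V - s y], which is continuous, so that its constancy holds
    at every point. *)
Lemma good_curve_affine : c1 < c2 -> exists s : R,
  {ae mu, forall y, c1 < y < c2 -> D (y, X y) = s} /\
  forall p q, c1 < p < c2 -> c1 < q < c2 -> V (q, X q) - V (p, X p) = s * (q - p).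
Proof.
move=> c12.
have mX (G : R * R -> R) : measurable_fun [set: mR * mR] G -> measurable_fun [set: mR] (fun y => G (y, X y)).
  by move=> mG; apply: (measurableT_comp mG); apply: measurable_fun_pair => //; exact: continuous_measurable_fun.
pose f y := slope_energy (D (y, X y)).
have mf : measurable_fun [set: mR] f by exact: (mX _ mF).
have fB y : `|f y| <= 1 by exact: slope_energy_bound.
have rf : {ae mu, forall y, right_pt f y} by apply: right_pt_ae => //; exists 1.
have [y0 y0c ry0] := ae_exists_itv c12 rf.
pose s := D (y0, X y0).
have Ds : {ae mu, forall y, c1 < y < c2 -> D (y, X y) = s}.
  apply: ae_sub rf => y ry yc; apply: slope_energy_inj.
  apply: (@const_of_weak R f 1 c1 c2 mf fB _ y y0 yc y0c ry ry0).
  move=> th th' a b C dth cth' ca ab bc th0 thC th'C.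
  by have [] := good_curve_weak dth cth' ca ab bc th0 thC th'C.
exists s; split => // p q pc qc.
(* The identity function is unbounded; clamped to [[c1, c2]] it is admissible in [ibp1] and
   [const_of_weak], and nothing changes on the interval. *)
pose u := clamp c1 c2.
have uin y : c1 <= y <= c2 -> u y = y by exact: clamp_id.
have uL x y : `|u x - u y| <= 1 * `|x - y| by rewrite mul1r; exact: clamp_lip.
have cu : continuous u by exact: (lipschitz_continuous uL).
have uB y : `|u y| <= `|c1| + `|c2|.
  by apply: itv_norm_le; apply: clamp_in; exact: ltW.
have mV0 := mX _ (lip2_measurable VL).
pose f2 y := V (y, X y) - s * u y.
have mf2 : measurable_fun [set: mR] f2.
  by apply: measurable_funB => //; apply: measurable_funM => //; exact: continuous_measurable_fun.
have f2B y : `|f2 y| <= M + `|s| * (`|c1| + `|c2|).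
  apply: le_trans (ler_normB _ _) _; apply: lerD; first exact: VM.
  by rewrite normrM ler_wpM2l.
have cV0 : continuous (fun y => V (y, X y)).
  move=> y; apply: (@continuous_comp _ _ _ (fun y => (y, X y)) V); last exact: (lip2_continuous VL).
  have h1 : (fun z : R => z) z @[z --> y] --> y by exact: cvg_id.
  exact: cvg_pair h1 (@cX y).
have cf2 : continuous f2.
  by move=> y; apply: cvgB; [exact: cV0|apply: cvgM; [exact: cvg_cst|exact: cu]].
have E : f2 p = f2 q.
  apply: (@const_of_weak R f2 _ c1 c2 mf2 f2B _ p q pc qc (continuous_right_pt _ cf2) (continuous_right_pt _ cf2)).
  move=> th th' a b C dth cth' ca ab bc th0 thC th'C.
  have [_ weak] := good_curve_weak dth cth' ca ab bc th0 thC th'C.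
  have cth : continuous th by move=> y; exact: der_continuous (dth y).
  have nk (k : R -> R) : continuous k -> (forall y, ~~ (a <= y <= b) -> k y = 0) ->
      (forall y, `|k y| <= C) -> nice1 k.
    move=> ck k0 kC; split; first exact: continuous_measurable_fun.
    exists C, (`|a| + `|b|); split => // y; rewrite ltNge => hy; apply: k0.
    by apply: contra hy => /itv_norm_le.
  have n0 : nice1 th by apply: nk => // y /th0[].
  have n1 : nice1 th' by apply: nk => // y /th0[].
  have mw : measurable_fun [set: mR] (wder u) by apply: measurable_wder; exact: continuous_measurable_fun.
  have nw : nice1 (fun y => wder u y * th y).
    by apply: (nice1M n0 mw) => y; exact: wder_bound uL.
  have nu : nice1 (fun y => u y * th' y).
    by apply: (nice1M n1 _ uB); exact: continuous_measurable_fun.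
  have nV : nice1 (fun y => V (y, X y) * th' y) by exact: (nice1M n1 mV0 (fun y => VM (y, X y))).
  have ED : \int[mu]_y (D (y, X y) * th y) = s * \int[mu]_y (wder u y * th y).
    rewrite -nice1_intZ// /Rintegral; congr fine; apply: ae_eq_integral => //.
    - apply/measurable_EFinP; apply: measurable_funM; first exact: mX mD.
      exact: continuous_measurable_fun.
    - by apply/measurable_EFinP; case: (nice1Z s nw).
    apply: ae_sub Ds => y Dy _; congr EFin.
    have [yab|/th0[-> _]] := boolP (a <= y <= b); last by rewrite !mulr0.
    have yc : c1 < y < c2 by case/andP: yab => h1 h2; rewrite (lt_le_trans ca h1) (le_lt_trans h2 bc).
    rewrite Dy//; suff -> : wder u y = 1 by rewrite mul1r.
    apply: derive_wder; apply: is_derive_near (der_id (y : R)).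
    have : \forall z \near y, c1 < z < c2.
      case/andP: yc => y1 y2; near=> z; apply/andP; split; near: z; [exact: lt_nbhsr|exact: lt_nbhsl].
    by apply: filterS => z /andP[z1 z2]; rewrite uin// !ltW.
  have := ibp1 uL uB dth n0 n1; rewrite nice1_intD// => ibp.
  have Ef y : f2 y * th' y = V (y, X y) * th' y + (- s) * (u y * th' y) by rewrite /f2; ring.
  rewrite (funext Ef) nice1_intD//; last exact: nice1Z.
  rewrite nice1_intZ//; move: weak; rewrite ED => weak.
  have -> : \int[mu]_y (V (y, X y) * th' y) = - (s * \int[mu]_y (wder u y * th y)) by rewrite weak opprK.
  by move: ibp => /eqP; rewrite addrC addr_eq0 => /eqP ->; ring.
have uin' y : c1 < y < c2 -> u y = y by move=> /andP[h1 h2]; apply: uin; rewrite !ltW.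
by move: E; rewrite /f2 !uin'// => /eqP; rewrite subr_eq => /eqP ->; ring.
Unshelve. all: by end_near. Qed.

End good_curve.

(** * The flow of characteristics *)

Section null_sets.
Variable R : realType.
Local Notation mR := (measurableTypeR R).
Local Notation mu := (@lebesgue_measure R).
Local Notation mu2 := (@leb2 R).

(** The preimage of an interval of length [l] has diameter at most [E l] and so lies in an interval
    of length [2 E l]; the push-forward of Lebesgue measure is therefore absolutely continuous. *)
Lemma null_preimage (T : R -> R) (E : R) : measurable_fun [set: mR] (T : mR -> mR) ->
  (forall s s', `|s - s'| <= E * `|T s - T s'|) ->
  forall A : set mR, measurable A -> mu A = 0%E -> mu (T @^-1` A) = 0%E.
Proof.
move=> mT TE A mA A0.
have Tm : (T : mR -> mR) \in mfun by rewrite inE.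
pose nu := pushforward mu (mfun_Sub Tm).
apply: (@null_of_interval_bound R nu (2 * E)) mA A0 => a b ab.
have E0 : 0 <= E.
  have := TE 1 0; have := normr_ge0 (T 1 - T 0); rewrite subr0 normr1 => h1 h2.
  rewrite leNgt; apply/negP => E0; have : E * `|T 1 - T 0| <= 0 by rewrite nmulr_rle0.
  by move: h2; lra.
change (mu (T @^-1` `]a, b]%classic) <= (2 * E * (b - a))%:E)%E.
have [->|/set0P[s0 hs0]] := eqVneq (T @^-1` `]a, b]%classic) set0.
  by rewrite measure0 lee_fin !mulr_ge0// subr_ge0.
apply: (@le_trans _ _ (mu `[s0 - E * (b - a), s0 + E * (b - a)]%classic)).
  apply: le_measure; rewrite ?inE.
  - by rewrite -[X in measurable X]setTI; apply: mT => //; exact: measurable_itv.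
  - exact: measurable_itv.
  - move=> s /= hs; rewrite in_itv/= -ler_distl; apply: le_trans (TE _ _) _.
    rewrite ler_wpM2l//; move: hs hs0; rewrite /= !in_itv/= => /andP[h1 h2] /andP[h3 h4].
    by rewrite ler_norml; apply/andP; split; lra.
rewrite lebesgue_measure_itv/= lte_fin; case: ifP => _; rewrite lee_fin.
  by apply: le_of_eq; ring.
by rewrite !mulr_ge0// subr_ge0.
Qed.

Lemma null_xsections (A : set (mR * mR)) : measurable A ->
  {ae mu, forall y, mu (xsection A y) = 0%E} <-> mu2 A = 0%E.
Proof.
move=> mA; have mx := measurable_fun_xsection mu mA.
have [h1 h2] := @ae_eq_integral_abs _ _ _ mu setT measurableT _ mx.
have E : (\int[mu]_x `|(mu \o xsection A) x| = mu2 A)%E.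
  by rewrite /leb2 /product_measure1; apply: eq_integral => x _; rewrite gee0_abs.
split=> [h|A0].
- by rewrite -E; apply: h2; apply: ae_sub h => y.
- by apply: ae_sub (h1 _) => [y /(_ Logic.I)//|]; rewrite E.
Qed.

Lemma null_ysections (A : set (mR * mR)) : measurable A ->
  {ae mu, forall t, mu (ysection A t) = 0%E} <-> mu2 A = 0%E.
Proof.
move=> mA; have mx := measurable_fun_ysection mu mA.
have [h1 h2] := @ae_eq_integral_abs _ _ _ mu setT measurableT _ mx.
have E : (\int[mu]_x `|(mu \o ysection A) x| = mu2 A)%E.
  rewrite /leb2 /product_measure1.
  transitivity (\int[mu]_t fubini_G mu (EFin \o \1_A) t)%E.
    by apply: eq_integral => x _; rewrite gee0_abs// indic_fubini_tonelli_GE.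
  rewrite -indic_fubini_tonelli//; apply: eq_integral => x _.
  by rewrite indic_fubini_tonelli_FE.
split=> [h|A0].
- by rewrite -E; apply: h2; apply: ae_sub h => y.
- by apply: ae_sub (h1 _) => [y /(_ Logic.I)//|]; rewrite E.
Qed.

Lemma measurable_right_pt (f : R * R -> R) : measurable_fun [set: mR * mR] f ->
  measurable [set p : mR * mR | right_pt (fun t => f (p.1, t)) p.2].
Proof.
move=> mf.
have mosc n : measurable_fun [set: mR * mR] (fun p : mR * mR => osc (fun t => f (p.1, t)) p.2 n).
  apply: measurable_funeM.
  apply: (measurable_fun_fubini_tonelli_F (m2 := mu)
    (fun q : (mR * mR) * mR => (\1_(`[0, n.+1%:R^-1]%classic : set R) (q.2 - q.1.2) *
       `|f (q.1.1, q.2) - f (q.1.1, q.1.2)|)%:E)); last first.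
    by move=> q; rewrite lee_fin mulr_ge0.
  have m1 : measurable_fun [set: (mR * mR) * mR] (fun q : (mR * mR) * mR => q.1.1).
    by apply: measurableT_comp; [exact: measurable_fst|exact: measurable_fst].
  have m2 : measurable_fun [set: (mR * mR) * mR] (fun q : (mR * mR) * mR => q.1.2).
    by apply: measurableT_comp; [exact: measurable_snd|exact: measurable_fst].
  have m3 : measurable_fun [set: (mR * mR) * mR] (fun q : (mR * mR) * mR => q.2) by exact: measurable_snd.
  apply/measurable_EFinP; apply: measurable_funM.
    apply: (@measurableT_comp _ _ _ _ _ _ (\1_(`[0, n.+1%:R^-1]%classic : set R) : mR -> R)).
      apply: measurable_indic; exact: measurable_itv.
    exact: measurable_funB.
  apply: measurableT_comp => //; apply: measurable_funB.
    by apply: (measurableT_comp mf); exact: measurable_fun_pair.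
  by apply: (measurableT_comp mf); exact: measurable_fun_pair.
have ml := measurable_fun_limn_esup mosc.
have := ml measurableT _ (emeasurable_set1 0%E).
by rewrite setTI.
Qed.

End null_sets.

Section flow.
Variables (R : realType) (V : R * R -> R) (L M : R).
Hypotheses (VL : lip2 V L) (VM : forall p, `|V p| <= M).
Local Notation mR := (measurableTypeR R).
Local Notation mu := (@lebesgue_measure R).
Local Notation mu2 := (@leb2 R).

Definition charact (X : R -> R) := forall y : R, is_derive y 1 X (- 4 * V (y, X y)).

Lemma charact_exists y0 s : exists2 X, charact X & X y0 = s.
Proof.
have [||X [Xs dX]] := @ode_exists R (fun p => - 4 * V p) (4 * L) (4 * M) _ _ y0 s.
- move=> p q; rewrite -mulrBr normrM normrN (ger0_norm (_ : 0 <= 4))// -mulrA ler_wpM2l//.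
- by move=> p; rewrite normrM normrN (ger0_norm (_ : 0 <= 4))// ler_wpM2l.
by exists X.
Qed.

(** Serves three ends: uniqueness, bi-Lipschitz dependence on the starting value, and approximation
    of one characteristic by others. *)
Lemma charact_gronwall X X' a b : charact X -> charact X' ->
  `|X b - X' b| <= expR (4 * L * `|b - a|) * `|X a - X' a|.
Proof.
move=> dX dX'.
have dd (x : R) : is_derive x 1 (fun y => X y - X' y) (- 4 * V (x, X x) - (- 4 * V (x, X' x))).
  exact: der_sub (dX x) (dX' x).
have dL x : `|- 4 * V (x, X x) - (- 4 * V (x, X' x))| <= 4 * L * `|X x - X' x|.
  rewrite -mulrBr normrM normrN (ger0_norm (_ : 0 <= 4))// -mulrA ler_wpM2l//.
  exact: (lip2_t VL).
have [ab|ba] := leP a b.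
  rewrite (ger0_norm (_ : 0 <= b - a)) ?subr_ge0//.
  by have [] := gronwall ab (fun x _ => dd x) (fun x _ => dL x).
rewrite (distrC b) (gtr0_norm (_ : 0 < a - b)) ?subr_gt0//.
by have [] := gronwall (ltW ba) (fun x _ => dd x) (fun x _ => dL x).
Qed.

Lemma charact_lip X a b : charact X -> `|X a - X b| <= 4 * M * `|a - b|.
Proof.
move=> dX; wlog ab : a b / a <= b.
  by move=> wl; have [/wl//|/ltW/wl] := leP a b; rewrite distrC (distrC b).
rewrite distrC (distrC a) (ger0_norm (_ : 0 <= b - a)) ?subr_ge0//.
have -> : 4 * M * (b - a) = 4 * M * (b - a) - 4 * M * (a - a) by rewrite subrr mulr0 subr0.
apply: (@norm_le_of_derive _ X (fun y => - 4 * V (y, X y)) (fun z => 4 * M * (z - a)) (cst (4 * M))) => //.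
  by move=> x _; exact: der_affine.
by move=> x _; rewrite normrM normrN (ger0_norm (_ : 0 <= 4))// ler_wpM2l.
Qed.

Variables (chi : R -> R -> R) (y0 : R).
Hypotheses (chi_flow : forall s, charact (chi s)) (chi0 : forall s, chi s y0 = s).

Lemma flow_continuous : continuous (fun p : R * R => chi p.2 p.1).
Proof.
move=> p; have M0 := bound_ge0 VM; have E0 := expR_gt0 (4 * L * `|p.1 - y0|).
set E := expR _ in E0.
apply/cvgrPdist_le => e e0; near=> q.
have -> : chi p.2 p.1 - chi q.2 q.1 = (chi p.2 p.1 - chi q.2 p.1) + (chi q.2 p.1 - chi q.2 q.1) by ring.
apply: le_trans (ler_normD _ _) _.
have h1 : `|chi p.2 p.1 - chi q.2 p.1| <= E * `|p.2 - q.2|.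
  by apply: le_trans (charact_gronwall y0 _ (chi_flow _) (chi_flow _)) _; rewrite !chi0.
have h2 := charact_lip p.1 q.1 (chi_flow q.2).
have h3 : `|p.2 - q.2| <= e / (2 * E).
  by near: q; apply: (@cvgr_dist_le _ _ _ (nbhs p) _ snd); [exact: cvg_snd|rewrite divr_gt0// mulr_gt0].
have h4 : `|p.1 - q.1| <= e / (2 * (4 * M + 1)).
  near: q; apply: (@cvgr_dist_le _ _ _ (nbhs p) _ fst); first exact: cvg_fst.
  by rewrite divr_gt0// mulr_gt0// ltr_wpDl// mulr_ge0.
have M1 : 0 < 4 * M + 1 by rewrite ltr_wpDl// mulr_ge0.
have h5 : E * `|p.2 - q.2| <= e / 2.
  apply: le_trans (ler_wpM2l (ltW E0) h3) _; apply: le_of_eq; field.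
  by rewrite gt_eqF.
have h6 : 4 * M * `|p.1 - q.1| <= e / 2.
  apply: (@le_trans _ _ ((4 * M + 1) * `|p.1 - q.1|)).
    by rewrite ler_wpM2r// lerDl.
  apply: le_trans (ler_wpM2l (ltW M1) h4) _; apply: le_of_eq; field.
  by rewrite gt_eqF.
lra.
Unshelve. all: by end_near. Qed.

Let mflow : measurable_fun [set: mR * mR] (fun p : mR * mR => (p.2, chi p.1 p.2)).
Proof.
apply: measurable_fun_pair; first exact: measurable_snd.
have mswap : measurable_fun [set: mR * mR] (fun p : mR * mR => (p.2, p.1)).
  by apply: measurable_fun_pair; [exact: measurable_snd|exact: measurable_fst].
exact: (measurableT_comp (continuous_measurable2 flow_continuous) mswap).
Qed.

Let mslice y : measurable_fun [set: mR] (fun s : mR => (chi s y : mR)).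
Proof.
apply: continuous_measurable_fun.
apply: (lipschitz_continuous (L := expR (4 * L * `|y - y0|))) => s s'.
by have := charact_gronwall y0 y (chi_flow s) (chi_flow s'); rewrite !chi0.
Qed.

(* Fubini: each map [s |-> chi s y] is bi-Lipschitz, so it preserves null sets in both
   directions. *)
Lemma flow_null (A : set (mR * mR)) : measurable A -> mu2 A = 0%E ->
  {ae mu, forall s, {ae mu, forall y, ~ A (y, chi s y)}}.
Proof.
move=> mA A0; have := (null_xsections mA).2 A0 => Ay.
pose B : set (mR * mR) := (fun p => (p.2, chi p.1 p.2)) @^-1` A.
have mB : measurable B by rewrite -[X in measurable X]setTI; exact: mflow.
have B0 : mu2 B = 0%E.
  apply/(null_ysections mB); apply: ae_sub Ay => y Ay0.
  rewrite (_ : ysection B y = (chi^~ y) @^-1` xsection A y); last first.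
    by apply/seteqP; split => s; rewrite /ysection /xsection /= !inE.
  apply: (@null_preimage R (chi^~ y) (expR (4 * L * `|y0 - y|)) (mslice y)) Ay0 => [s s'|].
    by have := charact_gronwall y y0 (chi_flow s) (chi_flow s'); rewrite !chi0.
  exact: measurable_xsection.
apply: ae_sub ((null_xsections mB).2 B0) => s Bs.
exists (xsection B s); split => //; first exact: measurable_xsection.
by move=> y /= /contrapT Ay'; rewrite /xsection/= inE.
Qed.

(** Following the characteristic [T t] through [(y, t)] back to [y0] inverts the map from [s] to
    [chi s y]. Since [T t y0] depends on [t] in a bi-Lipschitz way, null sets of starting values
    correspond to null sets on each slice. *)
Lemma null_of_flow (A : set (mR * mR)) : measurable A ->
  {ae mu, forall s, {ae mu, forall y, ~ A (y, chi s y)}} -> mu2 A = 0%E.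
Proof.
move=> mA As.
pose B : set (mR * mR) := (fun p => (p.2, chi p.1 p.2)) @^-1` A.
have mB : measurable B by rewrite -[X in measurable X]setTI; exact: mflow.
have B0 : mu2 B = 0%E.
  apply/(null_xsections mB); apply: ae_sub As => s [N [mN N0 sN]].
  apply/eqP; rewrite eq_le measure_ge0 andbT -N0; apply: le_measure; rewrite ?inE//.
    exact: measurable_xsection.
  by move=> y; rewrite /xsection/= inE => By; apply: sN => /(_ By).
apply/(null_xsections mA); apply: ae_sub ((null_ysections mB).2 B0) => y By0.
have [T TX] := choice (fun t => let: ex_intro2 X h1 h2 := charact_exists y t in
  ex_intro (fun X => charact X /\ X y = t) X (conj h1 h2)).
have TE t t' : `|t - t'| <= expR (4 * L * `|y - y0|) * `|T t y0 - T t' y0|.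
  by have := charact_gronwall y0 y (TX t).1 (TX t').1; rewrite !(TX _).2.
have chiT t : chi (T t y0) y = t.
  apply/eqP; rewrite -subr_eq0 -normr_le0 -[X in _ - X](TX t).2.
  apply: le_trans (charact_gronwall y0 y (chi_flow _) (TX t).1) _.
  by rewrite chi0 subrr normr0 mulr0.
have mT : measurable_fun [set: mR] (fun t : mR => T t y0 : mR).
  apply: continuous_measurable_fun.
  apply: (lipschitz_continuous (L := expR (4 * L * `|y0 - y|))) => t t'.
  by have := charact_gronwall y y0 (TX t).1 (TX t').1; rewrite !(TX _).2.
rewrite (_ : xsection A y = (fun t => T t y0) @^-1` ysection B y); last first.
  by apply/seteqP; split => t; rewrite /ysection /xsection /= !inE /B/= chiT.
exact: (null_preimage mT TE (measurable_ysection _ mB) By0).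
Qed.

End flow.

(** * From almost every characteristic to all of them *)

Section affine_along_characteristics.
Variables (R : realType) (Om : set (R * R)) (v g V : R * R -> R) (L M : R).
Hypotheses (oOm : open Om) (cv : {within Om, continuous v}).
Hypotheses (Bvg : Bweak Om v g) (VL : lip2 V L) (VM : forall p, `|V p| <= M).
Variables (c1 c2 d1 d2 : R).
Hypothesis c12 : c1 < c2.
Hypotheses (QOm : `[c1, c2]%classic `*` `[d1, d2]%classic `<=` Om).
Hypothesis (vV : forall p, (`[c1, c2]%classic `*` `[d1, d2]%classic) p -> v p = V p).
Hypothesis hmin : forall (vt gt : R * R -> R) (K : set (R * R)),
  {within Om, continuous vt} -> compact K -> K `<=` Om ->
  (forall p, Om p -> ~ K p -> vt p = v p) -> Bweak Om vt gt ->
  (areaH K g <= areaH K gt)%E.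
Local Notation mR := (measurableTypeR R).
Local Notation mu := (@lebesgue_measure R).
Local Notation mu2 := (@leb2 R).

Definition slope_on (X : R -> R) (a b s : R) := forall p q, a < p < b -> a < q < b ->
  V (q, X q) - V (p, X p) = s * (q - p).

Let mD : measurable_fun [set: mR * mR] (igrad V). Proof. exact: igrad_measurable VL. Qed.
Let mF : measurable_fun [set: mR * mR] (fun p => slope_energy (igrad V p)).
Proof.
apply: measurableT_comp mD; apply: continuous_measurable_fun.
exact: slope_energy_continuous.
Qed.

Section flow.
Variables (chi : R -> R -> R) (y0 : R).
Hypotheses (chi_flow : forall s, charact V (chi s)) (chi0 : forall s, chi s y0 = s).

(** On each slice almost every point is a right point, so the bad set is null in the plane, and by
    [flow_null] almost every characteristic meets it for almost no [y]. *)
Lemma flow_right_pt (f : R * R -> R) (B : R) : measurable_fun [set: mR * mR] f ->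
  (forall p, `|f p| <= B) ->
  {ae mu, forall s, {ae mu, forall y, right_pt (fun t => f (y, t)) (chi s y)}}.
Proof.
move=> mf fB; have mG := measurable_right_pt mf.
have mA : measurable (~` [set p : mR * mR | right_pt (fun t => f (p.1, t)) p.2]) by exact: measurableC.
have A0 : mu2 (~` [set p : mR * mR | right_pt (fun t => f (p.1, t)) p.2]) = 0%E.
  apply/(null_xsections mA); apply: aeW => y.
  have [|N [mN N0 sN]] := @right_pt_ae R (fun t => f (y, t)) (measurable_fun_pair2 _ mf).
    by exists B.
  apply/eqP; rewrite eq_le measure_ge0 andbT -N0; apply: le_measure; rewrite ?inE//.
    exact: measurable_xsection.
  by move=> t; rewrite /xsection/= inE/= => h; apply: sN.
by apply: ae_sub (flow_null VL VM chi_flow chi0 mA A0) => s; apply: ae_sub => y /= /contrapT.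
Qed.

Lemma flow_slope (d3 : R) : d3 < d2 ->
  {ae mu, forall s, (forall y, c1 < y < c2 -> d1 < chi s y <= d3) ->
    exists a, {ae mu, forall y, c1 < y < c2 -> igrad V (y, chi s y) = a} /\
      slope_on (chi s) c1 c2 a}.
Proof.
move=> d32; have h1 := flow_right_pt mD (igrad_bound VL VM).
have h2 := flow_right_pt mF (fun p => slope_energy_bound (igrad V p)).
have aeI := ae_filter_ringOfSetsType mu.
apply: filterS2 h1 h2 => s s1 s2 sQ.
apply: (good_curve_affine oOm cv Bvg VL VM QOm vV hmin (chi_flow s) d32 sQ _ _ c12).
  exact: ae_sub s1.
exact: ae_sub s2.
Qed.

End flow.

(** By Gronwall, characteristics started at nearby good values converge uniformly on [[c1, c2]].
    Their slopes need not be followed: collinearity of three values of [V] is a closed condition and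
    passes to the limit. *)
Lemma charact_slope X : charact V X -> (forall y, c1 <= y <= c2 -> d1 < X y < d2) ->
  exists a, slope_on X c1 c2 a.
Proof.
move=> dX XQ.
have [chi hchi] := choice (fun s => let: ex_intro2 X h1 h2 := charact_exists VL VM c1 s in
  ex_intro (fun X => charact V X /\ X c1 = s) X (conj h1 h2)).
have chi_flow s := (hchi s).1; have chi0 s := (hchi s).2.
have cX : continuous X by move=> y; exact: der_continuous (dX y).
have L0 := lip2_ge0 VL.
have c12' := ltW c12.
(* Compactness gives a margin [m]; half of it is spent on the strips, through the level
   [d2 - m / 2], the other half on the neighbouring characteristics. *)
have [m m0 Xm] : exists2 m, 0 < m & forall y, c1 <= y <= c2 -> d1 + m <= X y <= d2 - m.
  have cXI : {within `[c1, c2], continuous X} by exact: continuous_subspaceT.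
  have [ya ya_in hya] := EVT_min c12' cXI.
  have [yb yb_in hyb] := EVT_max c12' cXI.
  have := XQ ya; have := XQ yb; move: ya_in yb_in; rewrite !in_itv/= => ha hb /(_ hb) h1 /(_ ha) h2.
  exists (Num.min (X ya - d1) (d2 - X yb)).
    by move: h1 h2 => /andP[h1 h2] /andP[h3 h4]; rewrite lt_min !subr_gt0 h3 h2.
  move=> y yc; have := hya y; have := hyb y; rewrite !in_itv/= => /(_ yc) h3 /(_ yc) h4.
  have m1 : Num.min (X ya - d1) (d2 - X yb) <= X ya - d1 by rewrite ge_min lexx.
  have m2 : Num.min (X ya - d1) (d2 - X yb) <= d2 - X yb by rewrite ge_min lexx orbT.
  by apply/andP; split; lra.
have d32 : d2 - m / 2 < d2 by rewrite ltrBlDr ltrDl divr_gt0.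
have Es := flow_slope chi_flow chi0 d32.
pose E := expR (4 * L * (c2 - c1)).
have E0 : 0 < E by exact: expR_gt0.
have near_chi s y : c1 <= y <= c2 -> `|X y - chi s y| <= E * `|X c1 - s|.
  move=> /andP[h1 h2]; apply: le_trans (charact_gronwall VL c1 y dX (chi_flow s)) _.
  rewrite chi0 ler_wpM2r// ler_expR ger0_norm ?subr_ge0//.
  by rewrite ler_wpM2l ?mulr_ge0// lerB.
have three p q r : c1 < p < c2 -> c1 < q < c2 -> c1 < r < c2 ->
    (V (r, X r) - V (p, X p)) * (q - p) = (V (q, X q) - V (p, X p)) * (r - p).
  move=> pc qc rc; have w (z : R) : c1 < z < c2 -> c1 <= z <= c2 by move=> /andP[? ?]; rewrite !ltW.
  apply/eqP; rewrite -subr_eq0 -normr_le0; apply/ler_addgt0Pr => e e0; rewrite add0r.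
  (* [K] collects the error in the collinearity relation and the distance between the curves, so
     that [dd * K] can be at most [e] and at most [m / 2] at once. *)
  pose K := L * E * (2 * (`|q - p| + `|r - p|)) + E + 1.
  have K0 : 0 < K by rewrite ltr_wpDl// addr_ge0 ?(ltW E0)// !mulr_ge0 ?addr_ge0// ltW.
  pose dd := Num.min e (m / 2) / K.
  have dd0 : 0 < dd by rewrite divr_gt0// lt_min e0 divr_gt0.
  have ddK : dd * K = Num.min e (m / 2) by rewrite divfK// gt_eqF.
  have dde : dd * K <= e by rewrite ddK ge_min lexx.
  have ddm : dd * K <= m / 2 by rewrite ddK ge_min lexx orbT.
  have [|s /andP[s1 s2] hs] := ae_exists_itv (a := X c1) (b := X c1 + dd) _ Es.
    by rewrite ltrDl.
  have sd : `|X c1 - s| <= dd by rewrite distrC gtr0_norm ?subr_gt0// lerBlDl ltW.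
  have nc y : c1 <= y <= c2 -> `|X y - chi s y| <= E * dd.
    by move=> yc; apply: le_trans (near_chi s y yc) _; rewrite ler_wpM2l// ltW.
  have EK : E * dd <= dd * K.
    rewrite mulrC ler_wpM2l ?(ltW dd0)// /K -addrA -[leLHS]add0r lerD//.
      by rewrite !mulr_ge0 ?addr_ge0// ltW.
    by rewrite lerDl.
  have [y yc|a [_ sa]] := hs.
    have := nc y (w y yc); have /andP[h1 h2] := Xm y (w y yc).
    rewrite ler_norml => /andP[h3 h4].
    by apply/andP; split; move: EK ddm h1 h2 h3 h4 m0; lra.
  have nV z : c1 < z < c2 -> `|V (z, X z) - V (z, chi s z)| <= L * (E * dd).
    move=> zc; apply: le_trans (lip2_t VL _ _ _) _.
    by rewrite ler_wpM2l// nc// w.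
  have := nV _ pc; have := nV _ qc; have := nV _ rc.
  set A := V (r, X r); set B := V (p, X p); set C := V (q, X q).
  have -> : (A - B) * (q - p) - (C - B) * (r - p) =
     ((A - V (r, chi s r)) - (B - V (p, chi s p))) * (q - p) -
     ((C - V (q, chi s q)) - (B - V (p, chi s p))) * (r - p).
    have := sa p q pc qc; have := sa p r pc rc; move=> e1 e2.
    have -> : V (r, chi s r) = V (p, chi s p) + a * (r - p) by rewrite -e1; ring.
    have -> : V (q, chi s q) = V (p, chi s p) + a * (q - p) by rewrite -e2; ring.
    by ring.
  move=> hr hq hp.
  have N (x y z k : R) : `|x| <= k -> `|y| <= k -> `|(x - y) * z| <= 2 * k * `|z|.
    move=> xk yk; rewrite normrM ler_wpM2r//; apply: le_trans (ler_normB _ _) _.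
    by rewrite mulr_natl mulr2n lerD.
  apply: le_trans (ler_normB _ _) _.
  apply: le_trans (lerD (N _ _ (q - p) _ hr hp) (N _ _ (r - p) _ hq hp)) _.
  apply: le_trans _ dde; rewrite /K.
  have -> : 2 * (L * (E * dd)) * `|q - p| + 2 * (L * (E * dd)) * `|r - p| =
    dd * (L * E * (2 * (`|q - p| + `|r - p|))) by ring.
  by rewrite ler_wpM2l ?(ltW dd0)// -addrA lerDl addr_ge0// ltW.
pose p0 := (2 * c1 + c2) / 3; pose q0 := (c1 + 2 * c2) / 3.
have c12h := c12.
have p0c : c1 < p0 < c2 by rewrite /p0; apply/andP; split; lra.
have q0c : c1 < q0 < c2 by rewrite /q0; apply/andP; split; lra.
have pq0 : q0 - p0 != 0 by rewrite /p0 /q0 gt_eqF//; lra.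
exists ((V (q0, X q0) - V (p0, X p0)) / (q0 - p0)) => p q pc qc.
have h z : c1 < z < c2 -> V (z, X z) = V (p0, X p0) + (V (q0, X q0) - V (p0, X p0)) / (q0 - p0) * (z - p0).
  move=> zc; apply: (mulIf pq0); have := three p0 q0 z p0c q0c zc => e1.
  by rewrite mulrDl mulrAC divfK// -e1; ring.
by rewrite (h q)// (h p)//; ring.
Qed.

(** On almost every characteristic that meets [W], [igrad V] equals the slope for almost every [y];
    [null_of_flow] then makes the exceptional set null in the plane. *)
Lemma slope_ae (d3 : R) (G : R * R -> R) (W : set (mR * mR)) : d3 < d2 ->
  measurable W -> measurable_fun W G ->
  (forall X y, charact V X -> W (y, X y) -> [/\ c1 < y < c2,
     forall z, c1 < z < c2 -> d1 < X z <= d3 &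
     forall a, slope_on X c1 c2 a -> G (y, X y) = a]) ->
  {ae mu2, forall p, W p -> igrad V p = G p}.
Proof.
move=> d32 mW mG WG.
have [chi hchi] := choice (fun s => let: ex_intro2 X h1 h2 := charact_exists VL VM c1 s in
  ex_intro (fun X => charact V X /\ X c1 = s) X (conj h1 h2)).
have chi_flow s := (hchi s).1; have chi0 s := (hchi s).2.
pose A : set (mR * mR) := W `&` (fun p => igrad V p - G p) @^-1` (~` [set 0]).
have mA : measurable A.
  have mDG : measurable_fun W (fun p => igrad V p - G p).
    by apply: measurable_funB => //; exact: measurable_funTS.
  by apply: mDG => //; apply: measurableC; exact: measurable_set1.
exists A; split => //.
- apply: (null_of_flow VL VM chi_flow chi0 mA).
  apply: ae_sub (flow_slope chi_flow chi0 d32) => s hs.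
  have [[y Wy]|nW] := pselect (exists y, W (y, chi s y)); last first.
    by apply: aeW => y [Wy _]; apply: nW; exists y.
  have [yc sQ _] := WG (chi s) y (chi_flow s) Wy.
  have [a [Da sa]] := hs sQ.
  apply: ae_sub Da => z Dz [Wz /= nz]; have [zc _ Ga] := WG (chi s) z (chi_flow s) Wz.
  by apply: nz; rewrite Dz// (Ga _ sa) subrr.
- move=> p /= /not_implyP[Wp DG]; split => //= h; apply: DG.
  by apply/eqP; rewrite -subr_eq0; apply/eqP.
Qed.

End affine_along_characteristics.

(** * Lipschitz continuity across the exceptional vertical lines *)

Lemma const_on_closed (R : realType) (h : R -> R) (a b K : R) : a < b ->
  (forall x y, `|h x - h y| <= K * `|x - y|) ->
  (forall p q, a < p < b -> a < q < b -> h p = h q) ->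
  forall p q, a <= p <= b -> a <= q <= b -> h p = h q.
Proof.
move=> ab hK hc; pose m := (a + b) / 2.
have mab : a < m < b by rewrite /m; apply/andP; split; lra.
suff H p : a <= p <= b -> h p = h m by move=> p q /H -> /H ->.
move=> /andP[ap pb]; apply/eqP; rewrite -subr_eq0 -normr_le0; apply/ler_addgt0Pr => e e0; rewrite add0r.
have [->|pm] := eqVneq p m; first by rewrite subrr normr0 ltW.
pose k := `|K| * `|p - m| + 1; have k0 : 0 < k by rewrite ltr_wpDl// mulr_ge0.
pose x := Num.min 1 (e / k).
have x0 : 0 < x by rewrite lt_min ltr01 divr_gt0.
have x1 : x <= 1 by rewrite ge_min lexx.
have xe : x * k <= e by rewrite -ler_pdivlMr// ge_min lexx orbT.
have q_in : a < p + x * (m - p) < b.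
  have [pm'|pm'|E] := ltgtP p m; last by rewrite E eqxx in pm.
    have h1 : 0 < x * (m - p) by rewrite mulr_gt0// subr_gt0.
    have h2 : x * (m - p) <= m - p by rewrite ler_piMl// subr_ge0 ltW.
    by move: mab => /andP[h3 h4]; apply/andP; split; lra.
  have h1 : x * (m - p) < 0 by rewrite nmulr_llt0// subr_lt0.
  have h2 : m - p <= x * (m - p).
    by rewrite -subr_ge0 -{2}[m - p]mul1r -mulrBl nmulr_lge0 ?subr_lt0// subr_le0.
  by move: mab => /andP[h3 h4]; apply/andP; split; lra.
rewrite -(hc _ _ q_in mab); apply: le_trans (hK _ _) _.
apply: le_trans _ xe; rewrite opprD addrA subrr sub0r normrN normrM (gtr0_norm x0).
rewrite mulrCA ler_wpM2l ?(ltW x0)// distrC.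
apply: (@le_trans _ _ (`|K| * `|p - m|)); first by rewrite ler_wpM2r// ler_norm.
by rewrite lerDl.
Qed.

Section box.
Variables (R : realType) (Om : set (R * R)) (v g : R * R -> R) (L M : R).
Hypotheses (oOm : open Om) (cv : {within Om, continuous v}) (Bvg : Bweak Om v g).
Hypothesis hmin : forall (vt gt : R * R -> R) (K : set (R * R)),
  {within Om, continuous vt} -> compact K -> K `<=` Om ->
  (forall p, Om p -> ~ K p -> vt p = v p) -> Bweak Om vt gt ->
  (areaH K g <= areaH K gt)%E.
Variables (c1 c2 d1 d2 : R).
Hypotheses (c12 : c1 < c2) (d12 : d1 < d2).
Local Notation Q := (`[c1, c2]%classic `*` `[d1, d2]%classic).
Hypothesis (QOm : Q `<=` Om).
Hypothesis L0 : 0 <= L.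
Hypothesis vL : forall p q, Q p -> Q q -> `|v p - v q| <= L * (`|p.1 - q.1| + `|p.2 - q.2|).
Hypothesis vM : forall p, Q p -> `|v p| <= M.

(** Clamping both coordinates extends [v] to the plane with the same bound and Lipschitz constant,
    so characteristics are global; they concern [v] as long as they stay in the rectangle. *)
Definition box_ext (p : R * R) := v (clamp c1 c2 p.1, clamp d1 d2 p.2).
Local Notation V := box_ext.

Let Qclamp p : Q (clamp c1 c2 p.1, clamp d1 d2 p.2).
Proof. by split; rewrite /= in_itv/= clamp_in// ltW. Qed.

Lemma box_ext_lip : lip2 V L.
Proof.
move=> p q; apply: le_trans (vL (Qclamp p) (Qclamp q)) _.
by rewrite ler_wpM2l//; apply: lerD; exact: clamp_lip.
Qed.

Lemma box_ext_bound p : `|V p| <= M. Proof. exact: vM (Qclamp p). Qed.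

Lemma box_extE p : Q p -> v p = V p.
Proof.
by case: p => y t [] /=; rewrite !in_itv/= => h1 h2; rewrite /box_ext /= !clamp_id.
Qed.

Let M0 : 0 <= M. Proof. exact: le_trans (box_ext_bound (0, 0)). Qed.

Lemma box_slope X : charact V X -> (forall y, c1 <= y <= c2 -> d1 < X y < d2) ->
  exists a, forall p q, c1 <= p <= c2 -> c1 <= q <= c2 -> V (q, X q) - V (p, X p) = a * (q - p).
Proof.
move=> dX XQ; have VL := box_ext_lip; have VM := box_ext_bound.
have [a sa] := charact_slope oOm cv Bvg VL VM c12 QOm box_extE hmin dX XQ.
exists a => p q pc qc.
pose h y := V (y, X y) - a * y.
have hK x y : `|h x - h y| <= (L * (1 + 4 * M) + `|a|) * `|x - y|.
  have -> : h x - h y = (V (x, X x) - V (y, X y)) - a * (x - y) by rewrite /h; ring.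
  apply: le_trans (ler_normB _ _) _; rewrite normrM mulrDl lerD2r.
  apply: le_trans (VL _ _) _; rewrite -mulrA ler_wpM2l//= mulrDl mul1r lerD2l.
  exact: (charact_lip VM x y dX).
have E : h q = h p.
  apply: (const_on_closed c12 hK) => // x y xc yc; have := sa y x yc xc.
  by rewrite /h => /eqP; rewrite subr_eq => /eqP ->; ring.
have -> : V (q, X q) - V (p, X p) = (h q - h p) + a * (q - p) by rewrite /h; ring.
by rewrite E subrr add0r.
Qed.

Lemma charact_parabola X y a : charact V X -> c1 <= y <= c2 ->
  (forall z, c1 <= z <= c2 -> V (z, X z) - V (y, X y) = a * (z - y)) ->
  forall z, c1 <= z <= c2 -> X z = X y - 4 * V (y, X y) * (z - y) - 2 * a * (z - y) ^+ 2.
Proof.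
move=> dX yc sa z zc; set w := V (y, X y).
pose k x := X x + 4 * w * (x - y) + 2 * a * (x - y) ^+ 2.
have dk (x : R) : is_derive x 1 k (- 4 * V (x, X x) + 4 * w + 4 * a * (x - y)).
  have h1 := der_scale (2 * a) (der_exp 2 (der_sub (der_id x) (der_cst x y))).
  have h2 := der_add (der_add (dX x) (der_affine x (4 * w) y)) h1.
  by apply: der_eq h2 _ => /=; rewrite expr1; ring.
have k0 x : c1 <= x <= c2 -> - 4 * V (x, X x) + 4 * w + 4 * a * (x - y) = 0.
  by move=> /sa /eqP; rewrite subr_eq -/w => /eqP ->; ring.
have ck x1 x2 : c1 <= x1 -> x1 <= x2 -> x2 <= c2 -> k x1 = k x2.
  move=> h1 h2 h3; apply: (derive0_const h2 (fun x _ => dk x)) => x /andP[h4 h5].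
  by apply: k0; rewrite (le_trans h1 h4) (le_trans h5 h3).
have E : k z = k y.
  move: yc zc => /andP[y1 y2] /andP[z1 z2]; have [yz|zy] := leP y z.
    by apply/esym; exact: ck.
  by apply: ck => //; exact: ltW.
have -> : X z = k z - 4 * w * (z - y) - 2 * a * (z - y) ^+ 2 by rewrite /k; ring.
by rewrite E /k subrr; ring.
Qed.

(** The speed is at most [4 M], so over the width of the box a characteristic moves by no more than
    the margin. *)
Lemma charact_in_box X y : charact V X -> c1 <= y <= c2 ->
  d1 + 4 * M * (c2 - c1) < X y < d2 - 4 * M * (c2 - c1) ->
  forall z, c1 <= z <= c2 -> d1 < X z < d2.
Proof.
move=> dX /andP[y1 y2] /andP[t1 t2] z /andP[z1 z2].
have := charact_lip box_ext_bound z y dX; have zy : `|z - y| <= c2 - c1.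
  by rewrite ler_norml; apply/andP; split; lra.
have : 4 * M * `|z - y| <= 4 * M * (c2 - c1) by rewrite ler_wpM2l// mulr_ge0.
move=> h1 h2; have := le_trans h2 h1; rewrite ler_norml => /andP[h3 h4].
by apply/andP; split; lra.
Qed.

Lemma box_charact y t : c1 <= y <= c2 ->
  d1 + 4 * M * (c2 - c1) < t < d2 - 4 * M * (c2 - c1) ->
  exists a, forall z, c1 <= z <= c2 ->
    let x := t - 4 * v (y, t) * (z - y) - 2 * a * (z - y) ^+ 2 in
    d1 < x < d2 /\ v (z, x) = v (y, t) + a * (z - y).
Proof.
move=> yc tc; have [X dX Xy] := charact_exists box_ext_lip box_ext_bound y t.
rewrite -Xy in tc; have XQ := charact_in_box dX yc tc.
have [a sa] := box_slope dX XQ; exists a => z zc.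
have inQ x : c1 <= x <= c2 -> Q (x, X x).
  by move=> xc; split; rewrite /= in_itv//=; have /andP[? ?] := XQ x xc; rewrite !ltW.
have vy : v (y, t) = V (y, X y) by rewrite -box_extE ?Xy// -Xy; exact: inQ.
have Xz : t - 4 * v (y, t) * (z - y) - 2 * a * (z - y) ^+ 2 = X z.
  by rewrite vy (charact_parabola dX yc (fun z zc => sa y z yc zc) zc) Xy.
rewrite /= Xz; split; first exact: XQ.
by rewrite vy (box_extE (inQ z zc)) -(sa y z yc zc); ring.
Qed.

End box.

(* The difference of two characteristics is a quadratic polynomial [D + P u + c u^2] of
   the distance [u] to the far end; a smallness bound on its logarithmic derivative at the
   far end ([u = 0]) and at the middle ([u = m]) controls it up to the near end. *)
Lemma quad_bound (R : realType) (D P c u m y1 : R) : 0 < y1 -> `|u| <= y1 ->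
  m = y1 / 2 \/ m = - (y1 / 2) -> `|P| * (8 * y1) <= `|D| ->
  `|P + 2 * c * m| * (4 * y1) <= `|D + P * m + c * m ^+ 2| ->
  `|P + 2 * c * u| * y1 <= 3 * `|D + P * u + c * u ^+ 2|.
Proof.
move=> y10 u1 hm hP hm2.
have ny1 : y1 != 0 by rewrite gt_eqF.
pose p := P * y1; pose k := c * y1 ^+ 2; pose x := u / y1.
have x1 : `|x| <= 1 by rewrite normrM normfV (gtr0_norm y10) ler_pdivrMr// mul1r.
have hp : `|p| * 8 <= `|D| by rewrite normrM (gtr0_norm y10) -mulrA (mulrC y1).
(* The condition in the middle gives [4 |p + sg k| <= |D| + |p| / 2 + |k| / 4]; with
   [|p| <= |D| / 8] this becomes [(15 / 16) |k| <= (25 / 64) |D|], whence 5/12. *)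
have hk : `|k| <= `|D| * (5 / 12).
  have [sg [sg1 E1 E2]] : exists sg : R, [/\ `|sg| = 1,
      (P + 2 * c * m) * y1 = p + sg * k & D + P * m + c * m ^+ 2 = D + sg * p / 2 + k / 4].
    case: hm => ->; [exists 1|exists (- 1)]; rewrite ?normrN normr1 /p /k; split => //; by [ring|field].
  have h1 : `|p + sg * k| * 4 <= `|D + sg * p / 2 + k / 4|.
    rewrite -E1 -E2; apply: le_trans _ hm2; rewrite (normrM _ y1) (gtr0_norm y10).
    by apply: le_of_eq; ring.
  have h2 : `|sg * k| <= `|p + sg * k| + `|p|.
    by have := ler_normB (p + sg * k) p; rewrite (addrC p) addrK.
  have h3 : `|D + sg * p / 2 + k / 4| <= `|D| + `|p| / 2 + `|k| / 4.
    apply: le_trans (ler_normD _ _) _; apply: lerD.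
      apply: le_trans (ler_normD _ _) _; rewrite lerD2l !normrM sg1 mul1r normfV.
      by rewrite (ger0_norm (_ : 0 <= 2)).
    by rewrite normrM normfV (ger0_norm (_ : 0 <= 4)).
  rewrite normrM sg1 mul1r in h2.
  lra.
have -> : `|P + 2 * c * u| * y1 = `|p + 2 * k * x|.
  have -> : p + 2 * k * x = (P + 2 * c * u) * y1 by rewrite /p /k /x; field.
  by rewrite (normrM _ y1) (gtr0_norm y10).
have -> : D + P * u + c * u ^+ 2 = D + p * x + k * x ^+ 2 by rewrite /p /k /x; field.
have h1 : `|p + 2 * k * x| <= `|p| + 2 * `|k|.
  apply: le_trans (ler_normD _ _) _; rewrite lerD2l normrM (normrM 2) (ger0_norm (_ : 0 <= 2))//.
  by rewrite ler_piMr// mulr_ge0.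
have h2 : `|D| <= `|D + p * x + k * x ^+ 2| + `|p| + `|k|.
  have e1 := ler_normB (D + p * x + k * x ^+ 2) (p * x).
  have := ler_normB (D + p * x + k * x ^+ 2 - p * x) (k * x ^+ 2).
  have -> : D + p * x + k * x ^+ 2 - p * x - k * x ^+ 2 = D by ring.
  have e2 : `|p * x| <= `|p| by rewrite normrM ler_piMr.
  have e3 : `|k * x ^+ 2| <= `|k| by rewrite normrM normrX ler_piMr// expr_le1.
  lra.
(* The constants are [|p| + 2 |k| <= (23 / 24) |D|] and [(11 / 24) |D| <= |D + p x + k x ^ 2|],
   which yield 23/11, rounded up to 3. *)
have := normr_ge0 p; have := normr_ge0 k; lra.
Qed.

Section half_box.
Variables (R : realType) (Om : set (R * R)) (v g : R * R -> R) (M : R).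
Hypotheses (oOm : open Om) (cv : {within Om, continuous v}) (Bvg : Bweak Om v g).
Hypothesis hmin : forall (vt gt : R * R -> R) (K : set (R * R)),
  {within Om, continuous vt} -> compact K -> K `<=` Om ->
  (forall p, Om p -> ~ K p -> vt p = v p) -> Bweak Om vt gt ->
  (areaH K g <= areaH K gt)%E.
Variables (y0 t0 b y1 : R).
Hypotheses (b0 : 0 < b) (y10 : 0 < y1) (y1b : y1 <= b) (My1 : 4 * M * y1 <= b / 4).
Local Notation Q := (`[y0 - b, y0 + b]%classic `*` `[t0 - b, t0 + b]%classic).
Hypothesis (QOm : Q `<=` Om).
Hypothesis vM : forall p, Q p -> `|v p| <= M.

Let M0 : 0 <= M.
Proof.
have h : Q (y0, t0) by have b0' := b0; split; rewrite /= in_itv/=; apply/andP; split; lra.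
exact: le_trans (vM h).
Qed.

Section side.
Variable sg : R.
Hypothesis sg1 : sg = 1 \/ sg = - 1.
Hypothesis side : forall rho p q, 0 < rho -> rho <= y1 -> Q p -> Q q ->
  rho <= sg * (p.1 - y0) -> rho <= sg * (q.1 - y0) ->
  `|v p - v q| <= (32 * rho)^-1 * (`|p.1 - q.1| + `|p.2 - q.2|).

Let sgsg : sg * sg = 1. Proof. by case: sg1 => ->; ring. Qed.
Let nsg : `|sg| = 1. Proof. by case: sg1 => ->; rewrite ?normrN normr1. Qed.

Let inQ u t : 0 <= u <= y1 -> `|t - t0| <= b -> Q (y0 + sg * u, t).
Proof.
move=> /andP[u0 u1]; rewrite ler_norml => /andP[t1 t2].
have y1b' := y1b; split; rewrite /= in_itv/=; last by apply/andP; split; lra.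
by case: sg1 => ->; apply/andP; split; lra.
Qed.

(** At distance at least [tau] from the line [v] is Lipschitz with some finite constant, so
    [box_charact] applies there; [My1] keeps the characteristic in the box. The sign [sg] treats the
    two sides of the line together, with [u] the distance from it. *)
Lemma half_charact tau t : 0 < tau < y1 -> `|t - t0| <= b / 2 ->
  exists a, forall u, tau <= u <= y1 ->
    let x := t - 4 * v (y0 + sg * tau, t) * (sg * (u - tau)) - 2 * a * (sg * (u - tau)) ^+ 2 in
    `|x - t0| <= b /\ v (y0 + sg * u, x) = v (y0 + sg * tau, t) + a * (sg * (u - tau)).
Proof.
move=> /andP[tau0 tau1] tb.
pose c1 := if sg == 1 then y0 + tau else y0 - y1.
pose c2 := if sg == 1 then y0 + y1 else y0 - tau.
have E : (c1 = y0 + tau /\ c2 = y0 + y1 /\ sg = 1) \/ (c1 = y0 - y1 /\ c2 = y0 - tau /\ sg = -1).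
  rewrite /c1 /c2; case: sg1 => ->; first by left; rewrite eqxx.
  right; rewrite (_ : (-1 == 1 :> R) = false)//; apply/negbTE.
  by rewrite lt_eqF// (lt_trans (ltrN10 R)).
have c12 : c1 < c2 by case: E => -[-> [-> _]]; lra.
have c21 : c2 - c1 = y1 - tau by case: E => -[-> [-> _]]; ring.
have d12 : t0 - b < t0 + b by have := b0; lra.
have Qin p : (`[c1, c2]%classic `*` `[t0 - b, t0 + b]%classic) p -> Q p /\ tau <= sg * (p.1 - y0).
  move=> [] /=; rewrite !in_itv/= => /andP[h1 h2] h3; have h4 := y1b.
  split; first (split => //; apply/andP; split).
  - by case: E => -[h5 [h6 _]]; rewrite h5 in h1; lra.
  - by case: E => -[h5 [h6 _]]; rewrite h6 in h2; lra.
  - by case: E => -[h5 [h6 ->]]; rewrite h5 in h1; rewrite h6 in h2; lra.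
have L0 : 0 <= (32 * tau)^-1 by rewrite invr_ge0 mulr_ge0// ltW.
have inc u : tau <= u <= y1 -> c1 <= y0 + sg * u <= c2.
  by move=> /andP[u1 u2]; case: E => -[-> [-> ->]]; apply/andP; split; lra.
have QcOm : `[c1, c2]%classic `*` `[t0 - b, t0 + b]%classic `<=` Om by move=> p /Qin[/QOm].
have cL p q : (`[c1, c2]%classic `*` `[t0 - b, t0 + b]%classic) p ->
    (`[c1, c2]%classic `*` `[t0 - b, t0 + b]%classic) q ->
    `|v p - v q| <= (32 * tau)^-1 * (`|p.1 - q.1| + `|p.2 - q.2|).
  by move=> /Qin[Qp hp] /Qin[Qq hq]; apply: side => //; exact: ltW.
have cM p : (`[c1, c2]%classic `*` `[t0 - b, t0 + b]%classic) p -> `|v p| <= M by move=> /Qin[/vM].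
have tc : t0 - b + 4 * M * (c2 - c1) < t < t0 + b - 4 * M * (c2 - c1).
  have h : 4 * M * (c2 - c1) <= b / 4.
    by apply: le_trans My1; rewrite ler_wpM2l ?mulr_ge0// c21 gerBl ltW.
  by move: tb b0; rewrite ler_norml => /andP[h1 h2] h3; apply/andP; split; lra.
have tau_in : tau <= tau <= y1 by rewrite lexx ltW.
have [a ha] := box_charact oOm cv Bvg hmin c12 d12 QcOm L0 cL cM (inc _ tau_in) tc.
exists a => u hu; have := ha _ (inc u hu).
have -> : y0 + sg * u - (y0 + sg * tau) = sg * (u - tau) by ring.
move=> /= [/andP[h1 h2] h3]; split => //.
by rewrite ler_norml; apply/andP; split; lra.
Qed.

(** Two characteristics are run from distance [tau] out to [y1]; their difference is a quadratic
    polynomial whose derivative is [- 4] times the difference of the values of [v]. The bounds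
    [side] at distances [y1] and [y1 / 2] are the hypotheses of [quad_bound]: [32 y1] is 4 times
    [8 y1], and [32 (y1 / 2)] is 4 times [4 y1]. The conclusion at [tau] has a constant free of
    [tau]. *)
Lemma half_lip_t tau t1 t2 : 0 < tau < y1 -> `|t1 - t0| <= b / 2 -> `|t2 - t0| <= b / 2 ->
  `|v (y0 + sg * tau, t1) - v (y0 + sg * tau, t2)| <= y1^-1 * `|t1 - t2|.
Proof.
move=> tau_in tb1 tb2; have /andP[tau0 tau1] := tau_in.
have V0 : 0 <= y1^-1 by rewrite invr_ge0 ltW.
have b2 : b / 2 <= b by have := b0; lra.
have vert rho u s1 s2 : 0 < rho -> rho <= u -> u <= y1 -> `|s1 - t0| <= b -> `|s2 - t0| <= b ->
    `|v (y0 + sg * u, s1) - v (y0 + sg * u, s2)| <= (32 * rho)^-1 * `|s1 - s2|.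
  move=> r0 ru u1 sb1 sb2.
  have := @side rho (y0 + sg * u, s1) (y0 + sg * u, s2); rewrite /= subrr normr0 add0r.
  have uin : 0 <= u <= y1 by rewrite (le_trans (ltW r0) ru).
  have E : sg * (y0 + sg * u - y0) = u by rewrite (addrC y0) addrK mulrA sgsg mul1r.
  by rewrite E; apply => //; [exact: le_trans u1|exact: inQ|exact: inQ].
(* Beyond the middle the hypothesis at [rho = y1 / 2] suffices; before it the characteristics pass
   through both [y1 / 2] and [y1]. *)
have [tau2|tau2] := leP (y1 / 2) tau.
  have y20 : 0 < y1 / 2 by rewrite divr_gt0.
  apply: le_trans (vert _ _ _ _ y20 tau2 (ltW tau1) (le_trans tb1 b2) (le_trans tb2 b2)) _.
  rewrite ler_wpM2r// lef_pV2 ?posrE ?mulr_gt0//.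
  by have := y10; lra.
have [a1 h1] := half_charact tau_in tb1; have [a2 h2] := half_charact tau_in tb2.
set w1 := v (y0 + sg * tau, t1) in h1 *; set w2 := v (y0 + sg * tau, t2) in h2 *.
have y1in : tau <= y1 <= y1 by rewrite lexx ltW.
have y2in : tau <= y1 / 2 <= y1 by rewrite ltW//=; have := y10; lra.
have := h1 _ y1in; have := h2 _ y1in; have := h1 _ y2in; have := h2 _ y2in => /=.
set x2m := (X in `|X - t0| <= b /\ v (_, X) = w2 + _); move=> [Bm2 Vm2].
set x1m := (X in `|X - t0| <= b /\ v (_, X) = w1 + _); move=> [Bm1 Vm1].
set x2e := (X in `|X - t0| <= b /\ v (_, X) = w2 + _); move=> [Be2 Ve2].
set x1e := (X in `|X - t0| <= b /\ v (_, X) = w1 + _); move=> [Be1 Ve1].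
have He := vert y1 y1 x1e x2e y10 (lexx _) (lexx _) Be1 Be2.
have y20 : 0 < y1 / 2 by rewrite divr_gt0.
have y2y1 : y1 / 2 <= y1 by have := y10; lra.
have Hm := vert (y1 / 2) (y1 / 2) x1m x2m y20 (lexx _) y2y1 Bm1 Bm2.
(* The polynomial is expanded at the far end: [D] and [P] are difference and derivative there, and
   the arguments [sg * (tau - y1)] and [- (sg * (y1 / 2))] lead back to the start and to the
   middle. *)
pose D := x1e - x2e; pose P := - 4 * (w1 - w2 + (a1 - a2) * (sg * (y1 - tau))).
pose c := - 2 * (a1 - a2).
have ny1 : y1 != 0 by rewrite gt_eqF.
have := @quad_bound R D P c (sg * (tau - y1)) (- (sg * (y1 / 2))) y1 y10.
have -> : P + 2 * c * (sg * (tau - y1)) = - 4 * (w1 - w2) by rewrite /P /c; ring.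
have -> : P + 2 * c * - (sg * (y1 / 2)) = - 4 * (w1 - w2 + (a1 - a2) * (sg * (y1 / 2 - tau))).
  by rewrite /P /c; field.
have -> : D + P * (sg * (tau - y1)) + c * (sg * (tau - y1)) ^+ 2 = t1 - t2.
  by rewrite /D /P /c /x1e /x2e; ring.
have -> : D + P * - (sg * (y1 / 2)) + c * (- (sg * (y1 / 2))) ^+ 2 = x1m - x2m.
  by rewrite /D /P /c /x1e /x2e /x1m /x2m; field.
have -> : w1 - w2 + (a1 - a2) * (sg * (y1 / 2 - tau)) = v (y0 + sg * (y1 / 2), x1m) - v (y0 + sg * (y1 / 2), x2m).
  by rewrite Vm1 Vm2; ring.
have -> : P = - 4 * (v (y0 + sg * y1, x1e) - v (y0 + sg * y1, x2e)) by rewrite /P Ve1 Ve2; ring.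
rewrite !normrM !normrN (ger0_norm (_ : 0 <= 4))//.
move=> H; have {H} : 4 * `|w1 - w2| * y1 <= 3 * `|t1 - t2|.
  apply: H.
  - by rewrite nsg mul1r distrC gtr0_norm ?subr_gt0// gerBl ltW.
  - by case: sg1 => ->; [right|left]; ring.
  - rewrite [leRHS]mulrC ler_pdivlMr ?mulr_gt0// in He; apply: le_trans _ He.
    by apply: le_of_eq; ring.
  - rewrite [leRHS]mulrC ler_pdivlMr ?mulr_gt0// in Hm; apply: le_trans _ Hm.
    by apply: le_of_eq; field.
move=> h; rewrite mulrC ler_pdivlMr//; have := normr_ge0 (t1 - t2); lra.
Qed.

(** The characteristic is followed from [tau] to [tau'], then [half_lip_t] corrects the value of
    [t]. Over a length of at least [y1 / 2] the values of [v] change by at most [2 M], so the slope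
    is at most [4 M / y1]; the drift in [t] is at most [8 M] per unit length, and
    [12 M = 4 M + 8 M]. *)
Lemma half_lip_y tau tau' t : 0 < tau <= y1 / 2 -> 0 < tau' <= y1 / 2 -> `|t - t0| <= b / 4 ->
  `|v (y0 + sg * tau, t) - v (y0 + sg * tau', t)| <= 12 * M / y1 * `|tau - tau'|.
Proof.
move=> + + tb; wlog tt : tau tau' / tau <= tau'.
  move=> wl h h'; have [tt|/ltW tt] := leP tau tau'; first exact: wl.
  by rewrite distrC (distrC tau); exact: wl.
move=> /andP[tau0 tauy] /andP[tau'0 tau'y].
have y10' := y10; have b0' := b0; have Vy : 0 <= y1^-1 by rewrite invr_ge0 ltW.
have tau_in : 0 < tau < y1 by rewrite tau0/=; lra.
have tb2 : `|t - t0| <= b / 2 by lra.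
have [a ha] := half_charact tau_in tb2.
have y1in : tau <= y1 <= y1 by rewrite lexx andbT; lra.
have Qv u s : 0 <= u <= y1 -> `|s - t0| <= b -> `|v (y0 + sg * u, s)| <= M.
  by move=> hu hs; apply: vM; exact: inQ.
have w_le : `|v (y0 + sg * tau, t)| <= M by apply: Qv; [apply/andP; split; lra|lra].
set w := v (y0 + sg * tau, t) in ha w_le *.
have aM : `|a| <= 4 * M / y1.
  have := ha _ y1in; move=> /= [hx hv].
  have h1 : `|a * (sg * (y1 - tau))| <= 2 * M.
    have -> : a * (sg * (y1 - tau)) = (w + a * (sg * (y1 - tau))) - w by ring.
    have y1_in : 0 <= y1 <= y1 by rewrite lexx andbT ltW.
    have := Qv _ _ y1_in hx; rewrite hv => hw; apply: le_trans (ler_normB _ _) _.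
    by lra.
  have yt : 0 <= y1 - tau by lra.
  rewrite normrM (normrM sg) nsg mul1r (ger0_norm yt) in h1.
  rewrite ler_pdivlMr//; have h2 : `|a| * (y1 / 2) <= `|a| * (y1 - tau).
    by rewrite ler_wpM2l//; lra.
  by lra.
have t'in : tau <= tau' <= y1 by rewrite tt; lra.
have := ha _ t'in => /=; set dz := sg * (tau' - tau); set x := t - _ - _; move=> [hx hv].
have dzE : `|dz| = `|tau - tau'| by rewrite normrM nsg mul1r distrC.
have dz0 : `|dz| <= y1 / 2 by rewrite dzE distrC ger0_norm ?subr_ge0//; lra.
have xt : `|t - x| <= 8 * M * `|dz|.
  have -> : t - x = (4 * w + 2 * a * dz) * dz by rewrite /x; ring.
  rewrite normrM ler_wpM2r//; apply: le_trans (ler_normD _ _) _.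
  rewrite (normrM 4) (normrM _ dz) (normrM 2) (ger0_norm (_ : 0 <= 4))// (ger0_norm (_ : 0 <= 2))//.
  have h1 : `|a| * `|dz| <= 4 * M / y1 * (y1 / 2) by apply: ler_pM.
  have h2 : 4 * M / y1 * (y1 / 2) = 2 * M by field; rewrite gt_eqF.
  by rewrite h2 in h1; lra.
have xb : `|x - t0| <= b / 2.
  have h1 : 8 * M * `|dz| <= 8 * M * (y1 / 2) by rewrite ler_wpM2l// mulr_ge0.
  have h2 := My1; have h3 := ler_normB (t - t0) (t - x).
  have e : t - t0 - (t - x) = x - t0 by ring.
  by rewrite e in h3; lra.
have tau'_in : 0 < tau' < y1 by rewrite tau'0/=; lra.
have h1 := half_lip_t tau'_in xb tb2.
have h2 : `|v (y0 + sg * tau', x) - w| <= 4 * M / y1 * `|dz|.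
  by rewrite hv addrAC subrr add0r normrM ler_wpM2r.
have h3 : y1^-1 * `|x - t| <= y1^-1 * (8 * M * `|dz|) by rewrite distrC ler_wpM2l.
have h4 := ler_normB (v (y0 + sg * tau', x) - w) (v (y0 + sg * tau', x) - v (y0 + sg * tau', t)).
have e : v (y0 + sg * tau', x) - w - (v (y0 + sg * tau', x) - v (y0 + sg * tau', t)) =
  - (w - v (y0 + sg * tau', t)) by ring.
rewrite e normrN in h4; rewrite -dzE; apply: le_trans h4 _.
apply: le_trans (lerD h2 (le_trans h1 h3)) _.
by apply: le_of_eq; ring.
Qed.

Let S (p : R * R) := 0 <= sg * (p.1 - y0) <= y1 / 2 /\ `|p.2 - t0| <= b / 4.
Let K := (1 + 12 * M) / y1.
Let K0 : 0 <= K. Proof. by rewrite divr_ge0 ?addr_ge0 ?mulr_ge0// ltW. Qed.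

Let SQ p : S p -> Q p.
Proof.
case: p => y t [/= /andP[h1 h2] h3].
have -> : y = y0 + sg * (sg * (y - y0)) by rewrite mulrA sgsg mul1r addrC subrK.
by have := y10; have := b0; move=> h4 h5; apply: inQ; [apply/andP; split|]; lra.
Qed.

Let openS p q : S p -> S q -> 0 < sg * (p.1 - y0) -> 0 < sg * (q.1 - y0) ->
  `|v p - v q| <= K * (`|p.1 - q.1| + `|p.2 - q.2|).
Proof.
case: p => y t; case: q => y' t' [/= /andP[_ h2] h3] [/= /andP[_ h2'] h3'] h1 h1'.
have E z : z = y0 + sg * (sg * (z - y0)) by rewrite mulrA sgsg mul1r addrC subrK.
set tau := sg * (y - y0) in h1 h2; set tau' := sg * (y' - y0) in h1' h2'.
have dy : `|y - y'| = `|tau - tau'|.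
  have -> : tau - tau' = sg * (y - y') by rewrite /tau /tau'; ring.
  by rewrite normrM nsg mul1r.
rewrite dy (E y) (E y') -/tau -/tau'.
have y10' := y10; have b0' := b0.
have A : `|v (y0 + sg * tau, t) - v (y0 + sg * tau', t)| <= 12 * M / y1 * `|tau - tau'|.
  by apply: half_lip_y => //; apply/andP.
have B : `|v (y0 + sg * tau', t) - v (y0 + sg * tau', t')| <= y1^-1 * `|t - t'|.
  by apply: half_lip_t; [apply/andP; split; lra|lra|lra].
have := ler_normD (v (y0 + sg * tau, t) - v (y0 + sg * tau', t))
  (v (y0 + sg * tau', t) - v (y0 + sg * tau', t')).
rewrite addrA subrK => h; apply: le_trans h _; apply: le_trans (lerD A B) _.
rewrite mulrDr; apply: lerD; rewrite ler_wpM2r// /K.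
  by rewrite ler_wpM2r ?invr_ge0 ?(ltW y10)// lerDr.
by rewrite -[leLHS]mul1r ler_wpM2r ?invr_ge0 ?(ltW y10)// lerDl mulr_ge0.
Qed.

(** Points on the exceptional line itself are reached by continuity of [v]: they are pushed into the
    open side with [t] unchanged. *)
Let approx p e : S p -> 0 < e -> exists p', [/\ S p', 0 < sg * (p'.1 - y0),
  p'.2 = p.2, `|p.1 - p'.1| <= e & `|v p - v p'| <= e].
Proof.
move=> Sp e0; have [pl|p0] := ltP 0 (sg * (p.1 - y0)).
  by exists p; split => //; rewrite subrr normr0 ltW.
have y10' := y10.
have Ep : p.1 = y0.
  case: Sp => /andP[h1 _] _; have h : sg * (p.1 - y0) = 0 by apply/eqP; rewrite eq_le p0 h1.
  by have := congr1 (fun x => sg * x) h; rewrite mulrA sgsg mul1r mulr0 => /subr0_eq.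
have Omp : Om p by apply: QOm; exact: SQ.
have : {for p, continuous v} by move: cv; rewrite continuous_open_subspace// => /(_ p); apply; rewrite inE.
move/cvgrPdist_le => /(_ e e0) /nbhs_ballP[d /= d0 hd].
pose u := Num.min e (Num.min (d / 2) (y1 / 2)).
have u0 : 0 < u by rewrite !lt_min e0 !divr_gt0.
have ue : u <= e by rewrite ge_min lexx.
have ud : u < d.
  apply: (@le_lt_trans _ _ (d / 2)); last by lra.
  by rewrite !ge_min lexx orbT.
have uy : u <= y1 / 2 by rewrite !ge_min lexx !orbT.
have du : `|p.1 - (p.1 + sg * u)| = u.
  by rewrite opprD addrA subrr sub0r normrN normrM nsg mul1r gtr0_norm.
have su : sg * ((p.1 + sg * u) - y0) = u by rewrite Ep (addrC y0) addrK mulrA sgsg mul1r.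
exists (p.1 + sg * u, p.2); split => //=; rewrite ?su ?du//.
- by split => /=; [rewrite su ltW|case: Sp].
- apply: hd; split => /=; last exact: ballxx.
  by rewrite /ball/= du.
Qed.

Lemma half_lip p q : S p -> S q -> `|v p - v q| <= K * (`|p.1 - q.1| + `|p.2 - q.2|).
Proof.
move=> Sp Sq; apply/ler_addgt0Pr => e e0.
pose c := 2 + 2 * K; have c0 : 0 < c by rewrite ltr_wpDr// mulr_ge0.
have [p' [Sp' p'0 E1 p1 p2]] := approx Sp (divr_gt0 e0 c0).
have [q' [Sq' q'0 E2 q1 q2]] := approx Sq (divr_gt0 e0 c0).
have h := openS Sp' Sq' p'0 q'0; rewrite E1 E2 in h.
have ec : e / c * c = e by rewrite divfK// gt_eqF.
have -> : v p - v q = (v p - v p') + (v p' - v q') - (v q - v q') by ring.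
have dd : `|p'.1 - q'.1| <= `|p.1 - q.1| + 2 * (e / c).
  have -> : p'.1 - q'.1 = (p.1 - q.1) - (p.1 - p'.1) + (q.1 - q'.1) by ring.
  apply: le_trans (ler_normD _ _) _; have := ler_normB (p.1 - q.1) (p.1 - p'.1); lra.
have h3 : K * (`|p'.1 - q'.1| + `|p.2 - q.2|) <= K * (`|p.1 - q.1| + `|p.2 - q.2|) + K * (2 * (e / c)).
  by rewrite -mulrDr ler_wpM2l//; lra.
apply: le_trans (ler_normB _ _) _; apply: le_trans (lerD (ler_normD _ _) (lexx _)) _.
have ce : 2 * (e / c) + K * (2 * (e / c)) = e.
  by transitivity (e / c * (2 + 2 * K)); [ring|exact: ec].
by lra.
Qed.

End side.

Lemma box_lip : (forall sg rho p q, sg = 1 \/ sg = -1 -> 0 < rho -> rho <= y1 -> Q p -> Q q ->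
    rho <= sg * (p.1 - y0) -> rho <= sg * (q.1 - y0) ->
    `|v p - v q| <= (32 * rho)^-1 * (`|p.1 - q.1| + `|p.2 - q.2|)) ->
  forall p q, `|p.1 - y0| <= y1 / 2 -> `|p.2 - t0| <= b / 4 ->
    `|q.1 - y0| <= y1 / 2 -> `|q.2 - t0| <= b / 4 ->
  `|v p - v q| <= (1 + 12 * M) / y1 * (`|p.1 - q.1| + `|p.2 - q.2|).
Proof.
move=> side; have P1 : 1 = 1 :> R \/ 1 = -1 :> R by left.
have N1 : - 1 = 1 :> R \/ - 1 = -1 :> R by right.
have hp := half_lip P1 (fun rho p q => side 1 rho p q P1).
have hn := half_lip N1 (fun rho p q => side (-1) rho p q N1).
move=> p q p1 p2 q1 q2.
have side_of (x : R * R) : `|x.1 - y0| <= y1 / 2 -> `|x.2 - t0| <= b / 4 ->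
    (0 <= 1 * (x.1 - y0) <= y1 / 2 /\ `|x.2 - t0| <= b / 4) \/
    (0 <= -1 * (x.1 - y0) <= y1 / 2 /\ `|x.2 - t0| <= b / 4).
  rewrite ler_norml => /andP[h1 h2] h3; have [h|h] := leP y0 x.1.
    by left; split => //; apply/andP; split; lra.
  by right; split => //; apply/andP; split; lra.
(* Points on opposite sides are joined through [x'], on the line at the level of [x]; the horizontal
   distances add up exactly, so the constant stays the same. *)
have cross (x z : R * R) (x' : R * R := (y0, x.2)) :
    0 <= 1 * (x.1 - y0) <= y1 / 2 /\ `|x.2 - t0| <= b / 4 ->
    0 <= -1 * (z.1 - y0) <= y1 / 2 /\ `|z.2 - t0| <= b / 4 ->
    `|v x - v z| <= (1 + 12 * M) / y1 * (`|x.1 - z.1| + `|x.2 - z.2|).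
  move=> hx hz; have y20 : 0 <= y1 / 2 by rewrite divr_ge0// ltW.
  have h1 := hp x x' hx (conj _ hx.2); have h2 := hn x' z (conj _ hx.2) hz.
  move: h1 h2; rewrite /= !subrr !mulr0 lexx y20 normr0 addr0 => /(_ isT) h1 /(_ isT) h2.
  rewrite -[v x - v z](subrKA (v x')); apply: le_trans (ler_normD _ _) _.
  apply: le_trans (lerD h1 h2) _; rewrite -mulrDr; apply: le_of_eq; congr (_ * _).
  rewrite addrA; congr (_ + _).
  move: hx hz => [/andP[x0 _] _] [/andP[z0 _] _]; rewrite mul1r in x0; rewrite mulN1r opprB in z0.
  have -> : x.1 - z.1 = (x.1 - y0) + (y0 - z.1) by rewrite subrKA.
  by rewrite (ger0_norm x0) (ger0_norm z0) (ger0_norm (addr_ge0 x0 z0)).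
have [Sp|Sp] := side_of p p1 p2; have [Sq|Sq] := side_of q q1 q2.
- exact: hp.
- exact: cross.
- by rewrite distrC (distrC p.1) (distrC p.2); exact: cross.
- exact: hn.
Qed.

End half_box.

(** * Reading the hypothesis on [ell] in rectangular boxes *)

Section edist.
Variable R : realType.
Implicit Types p q w : R * R.

Lemma edist_le p q : Defs.edist p q <= `|p.1 - q.1| + `|p.2 - q.2|.
Proof.
rewrite /Defs.edist -[leRHS]ger0_norm ?addr_ge0// -sqrtr_sqr ler_sqrt ?sqr_ge0//.
have e (x : R) : x ^+ 2 = `|x| ^+ 2 by rewrite real_normK ?num_real.
rewrite (e (p.1 - q.1)) (e (p.2 - q.2)) [leRHS]sqrrD lerD2r lerDl mulrn_wge0// mulr_ge0//.
Qed.

Lemma le_edist1 p q : `|p.1 - q.1| <= Defs.edist p q.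
Proof. by rewrite /Defs.edist -sqrtr_sqr ler_sqrt ?addr_ge0 ?sqr_ge0// lerDl sqr_ge0. Qed.

Lemma le_edist2 p q : `|p.2 - q.2| <= Defs.edist p q.
Proof. by rewrite /Defs.edist -sqrtr_sqr ler_sqrt ?addr_ge0 ?sqr_ge0// lerDr sqr_ge0. Qed.

Lemma edist_gt0 p q : p <> q -> 0 < Defs.edist p q.
Proof.
move=> pq; have [h|h] := ltP 0 (Defs.edist p q) => //; exfalso; apply: pq.
have h1 := le_trans (le_edist1 p q) h; have h2 := le_trans (le_edist2 p q) h.
rewrite normr_le0 subr_eq0 in h1; rewrite normr_le0 subr_eq0 in h2.
by rewrite (surjective_pairing p) (surjective_pairing q) (eqP h1) (eqP h2).
Qed.

Lemma box_in_ball (r : R) p w : 0 < r -> `|p.1 - w.1| <= r / 2 -> `|p.2 - w.2| <= r / 2 ->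
  ball_e r w p.
Proof.
move=> r0 h1 h2; rewrite /ball_e/= /Defs.edist.
rewrite -[r in ltRHS]ger0_norm ?ltW// -sqrtr_sqr ltr_sqrt ?exprn_gt0//.
have sq (x : R) : `|x| <= r / 2 -> x ^+ 2 <= r ^+ 2 / 4.
  move=> xr; rewrite -real_normK ?num_real//.
  have -> : r ^+ 2 / 4 = (r / 2) ^+ 2 by field.
  by rewrite lerXn2r ?nnegrE// divr_ge0// ltW.
by have := sq _ h1; have := sq _ h2; have : 0 < r ^+ 2; [rewrite exprn_gt0|lra].
Qed.

(** [gam] is a parabola in [s] with maximum [rho] at [s = r], so points at distance at least [rho]
    from the line are never removed. *)
Lemma Dset_thin (r rho : R) w p : 0 < r -> 0 <= rho -> Dset r rho w p -> `|p.1 - w.1| < rho.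
Proof.
move=> r0 rho0 [s [s0 s2 _ h]]; apply: lt_le_trans h _.
have -> : gam r rho s = rho * (s * (2 * r - s) / r ^+ 2) by rewrite /gam; field; rewrite gt_eqF.
rewrite ler_piMr// ler_pdivrMr ?exprn_gt0// mul1r -subr_ge0.
suff -> : r ^+ 2 - s * (2 * r - s) = (r - s) ^+ 2 by rewrite sqr_ge0.
by ring.
Qed.

(** Convergence to 0 is used through one inequality, [rho * ell < 1 / 32], which includes the
    finiteness of [ell]; the threshold is the one that [half_lip_t] takes. *)
Lemma side_bound (v : R * R -> R) (r : R) w : 0 < r ->
  ((rho%:E * ell v r rho w)%E @[rho --> 0^'+] --> 0%E) ->
  exists2 rho0, 0 < rho0 & forall sg rho p q, sg = 1 \/ sg = -1 -> 0 < rho -> rho < rho0 ->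
    ball_e r w p -> ball_e r w q -> rho <= sg * (p.1 - w.1) -> rho <= sg * (q.1 - w.1) ->
    `|v p - v q| <= (32 * rho)^-1 * (`|p.1 - q.1| + `|p.2 - q.2|).
Proof.
move=> r0 lim; pose c : R := 32^-1; have c0 : 0 < c by rewrite invr_gt0.
have : nbhs (0%E : \bar R) [set y | (y < c%:E)%E].
  by apply: open_nbhs_nbhs; split; [exact: open_ereal_lt_ereal|rewrite /= lte_fin].
move=> /lim /nbhs_ballP[rho0 /= rho00 hrho]; exists rho0 => // sg rho p q hsg rho_gt0 rho_lt bp bq sp sq.
have [->|/eqP pq] := eqVneq p q; first by rewrite !subrr !normr0 addr0 mulr0.
have dpq := edist_gt0 pq.
have lt_c : (rho%:E * ell v r rho w < c%:E)%E.
  by apply: hrho => //; rewrite /ball/= sub0r normrN gtr0_norm.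
have nD z : rho <= sg * (z.1 - w.1) -> ~ Dset r rho w z.
  move=> h /(Dset_thin r0 (ltW rho_gt0)); rewrite ltNge => /negP; apply.
  by apply: le_trans h _; case: hsg => ->; rewrite ?mul1r ?mulN1r; [exact: ler_norm|rewrite -normrN ler_norm].
have le_ell : ((`|v p - v q| / Defs.edist p q)%:E <= ell v r rho w)%E.
  rewrite /ell le_max; apply/orP; case: hsg sp sq nD => -> sp sq nD; [left|right];
    apply: ereal_sup_ubound; right; exists p, q; split=> //; split; try exact: nD; split => //.
  - by rewrite -subr_gt0; rewrite mul1r in sp; exact: lt_le_trans sp.
  - by rewrite -subr_gt0; rewrite mul1r in sq; exact: lt_le_trans sq.
  - by rewrite -subr_lt0 -oppr_gt0; rewrite mulN1r in sp; exact: lt_le_trans sp.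
  - by rewrite -subr_lt0 -oppr_gt0; rewrite mulN1r in sq; exact: lt_le_trans sq.
have : (rho%:E * (`|v p - v q| / Defs.edist p q)%:E < c%:E)%E.
  by apply: le_lt_trans lt_c; apply: lee_wpmul2l => //; rewrite lee_fin ltW.
rewrite -EFinM lte_fin mulrA ltr_pdivrMr// => h.
have h2 : rho * `|v p - v q| <= c * (`|p.1 - q.1| + `|p.2 - q.2|).
  by apply: le_trans (ltW h) _; rewrite ler_wpM2l ?(ltW c0)// edist_le.
by rewrite invfM -/c (mulrC c) -mulrA ler_pdivlMl.
Qed.

End edist.

Section local_lipschitz.
Variables (R : realType) (Om : set (R * R)) (v g : R * R -> R).
Hypotheses (oOm : open Om) (cv : {within Om, continuous v}) (Bvg : Bweak Om v g).
Hypothesis hmin : forall (vt gt : R * R -> R) (K : set (R * R)),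
  {within Om, continuous vt} -> compact K -> K `<=` Om ->
  (forall p, Om p -> ~ K p -> vt p = v p) -> Bweak Om vt gt ->
  (areaH K g <= areaH K gt)%E.
Hypothesis hell : forall w0, Om w0 -> exists r : R,
  [/\ 0 < r, ball_e r w0 `<=` Om &
      ((rho%:E * ell v r rho w0)%E @[rho --> 0^'+] --> 0%E)].

Definition cbox (w : R * R) (h k : R) : set (R * R) :=
  `[w.1 - h, w.1 + h]%classic `*` `[w.2 - k, w.2 + k]%classic.

Lemma cboxE w h k p : cbox w h k p <-> `|p.1 - w.1| <= h /\ `|p.2 - w.2| <= k.
Proof. by rewrite /cbox /= !in_itv/= -!ler_distlC !(distrC _ (w.1)) !(distrC _ (w.2)). Qed.

Lemma local_lipschitz w : Om w -> exists h k L : R, [/\ 0 < h, 0 < k, 0 <= L, cbox w h k `<=` Om &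
  forall p q, cbox w h k p -> cbox w h k q -> `|v p - v q| <= L * (`|p.1 - q.1| + `|p.2 - q.2|)].
Proof.
move=> Omw; have [r [r0 rOm rlim]] := hell Omw.
have [rho0 rho00 side] := side_bound r0 rlim.
pose b := r / 2; have b0 : 0 < b by rewrite divr_gt0.
have bball p : cbox w b b p -> ball_e r w p by move=> /cboxE[h1 h2]; exact: box_in_ball.
have bOm : cbox w b b `<=` Om by move=> p /bball /rOm.
have [M vM] : exists M, forall p, cbox w b b p -> `|v p| <= M.
  have cb : compact (cbox w b b) by apply: compact_setX; exact: segment_compact.
  have [N [_ NK]] : bounded_set (v @` cbox w b b).
    apply: compact_bounded; apply: continuous_compact => //.
    exact: continuous_subspaceW cv.
  by exists (N + 1) => p bp; apply: (NK (N + 1)); [rewrite ltrDl|exists p].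
have M0 : 0 <= M by apply: le_trans (vM w _) => //; apply/cboxE; rewrite !subrr normr0 ltW.
(* Three demands on the width: to fit in the box, to stay below [rho0], and to be so short that
   characteristics drift by at most [b / 4]. *)
pose y1 := Num.min b (Num.min (rho0 / 2) (b / 4 / (4 * M + 1))).
have M1 : 0 < 4 * M + 1 by rewrite ltr_wpDl// mulr_ge0.
have y10 : 0 < y1 by rewrite !lt_min b0 !divr_gt0.
have y1b : y1 <= b by rewrite ge_min lexx.
have y1r : y1 < rho0.
  by apply: (@le_lt_trans _ _ (rho0 / 2)); [rewrite !ge_min lexx orbT|lra].
have My1 : 4 * M * y1 <= b / 4.
  have : y1 <= b / 4 / (4 * M + 1) by rewrite !ge_min lexx !orbT.
  by rewrite ler_pdivlMr// => h; have := ltW y10; lra.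
have L0 : 0 <= (1 + 12 * M) / y1 by rewrite divr_ge0 ?addr_ge0 ?mulr_ge0// ltW.
exists (y1 / 2), (b / 4), ((1 + 12 * M) / y1); split => //; try by rewrite divr_gt0.
  by move=> p /cboxE[h1 h2]; apply: bOm; apply/cboxE; split; lra.
have := box_lip oOm cv Bvg hmin b0 y10 y1b My1 bOm vM => H.
move=> p q /cboxE[h1 h2] /cboxE[h3 h4]; apply: H => //.
move=> sg rho p' q' hsg rho_gt0 rho_le Qp Qq sp sq.
by apply: (side sg) => //; [exact: le_lt_trans y1r|exact: bball|exact: bball].
Qed.

End local_lipschitz.

(** Compactness is applied to pairs of points: near the diagonal the local Lipschitz constants work,
    and near a pair of distinct points the difference of values is bounded while the distance stays
    away from 0. *)
Lemma lipschitz_of_local (R : realType) (Om : set (R * R)) (v : R * R -> R) :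
  (forall w, Om w -> exists h L : R, 0 < h /\ forall p q, cbox w h h p -> cbox w h h q ->
    `|v p - v q| <= L * (`|p.1 - q.1| + `|p.2 - q.2|)) ->
  Lip_loc Om v.
Proof.
move=> loc K cK KOm.
pose P (L : R) (z : (R * R) * (R * R)) := `|v z.1 - v z.2| <= L * Defs.edist z.1 z.2.
have near_box w h : 0 < h -> \forall p \near w, cbox w h h p.
  move=> h0; apply/nbhs_ballP; exists h => // p [p1 p2]; apply/cboxE.
  by rewrite distrC (distrC p.2) !ltW.
have edist0 p q : 0 <= Defs.edist p q :> R by rewrite sqrtr_ge0.
have edist2 (p q : R * R) : `|p.1 - q.1| + `|p.2 - q.2| <= 2 * Defs.edist p q.
  by have := le_edist1 p q; have := le_edist2 p q; lra.
have near2 (p q : R * R) (h L : R) : 0 < h ->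
    (forall z L1, L < L1 -> cbox p h h z.1 -> cbox q h h z.2 -> P L1 z) ->
    \forall z \near (p, q) & L1 \near +oo, P L1 z.
  move=> h0 hP; exists ([set z | cbox p h h z.1 /\ cbox q h h z.2], [set L1 | L < L1]).
    split => /=; last by exists L; rewrite num_real.
    by exists (cbox p h h, cbox q h h) => //; split; exact: near_box.
  by move=> [z L1] [/= [z1 z2] LL]; exact: hP.
have : \forall L \near +oo, K `*` K `<=` P L.
  have /compact_near_coveringP := compact_setX cK cK; apply => -[p q] [/= Kp Kq].
  have [h [L [h0 hL]]] := loc p (KOm p Kp); have [h' [L' [h'0 hL']]] := loc q (KOm q Kq).
  have [pq|/eqP pq] := eqVneq p q.
    rewrite -pq; apply: (near2 _ _ h (2 * `|L|) h0) => z L1 L1L z1 z2.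
    apply: le_trans (hL _ _ z1 z2) _.
    apply: (@le_trans _ _ (`|L| * (2 * Defs.edist z.1 z.2))).
      apply: (@le_trans _ _ (`|L| * (`|z.1.1 - z.2.1| + `|z.1.2 - z.2.2|))).
        by rewrite ler_wpM2r ?addr_ge0// ler_norm.
      by rewrite ler_wpM2l.
    by rewrite mulrA (mulrC `|L|) ler_wpM2r// ltW.
  pose D := `|p.1 - q.1| + `|p.2 - q.2|.
  have D0 : 0 < D by apply: lt_le_trans (edist_gt0 pq) (edist_le p q).
  (* Moving four coordinates by at most [D / 8] leaves a sum distance of at least [D / 2], hence a
     Euclidean distance of at least [D / 4]. *)
  pose e := Num.min h (Num.min h' (D / 8)).
  have e0 : 0 < e by rewrite !lt_min h0 h'0 divr_gt0.
  have eh : e <= h by rewrite ge_min lexx.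
  have eh' : e <= h' by rewrite !ge_min lexx orbT.
  have eD : e <= D / 8 by rewrite !ge_min lexx !orbT.
  pose B := `|L| * (2 * h) + `|v p - v q| + `|L'| * (2 * h').
  have self (w : R * R) k : 0 < k -> cbox w k k w.
    by move=> k0; apply/cboxE; rewrite !subrr normr0 ltW.
  have dev (w z : R * R) k l : 0 < k ->
      (forall p q, cbox w k k p -> cbox w k k q -> `|v p - v q| <= l * (`|p.1 - q.1| + `|p.2 - q.2|)) ->
      cbox w e e z -> e <= k -> `|v z - v w| <= `|l| * (2 * k).
    move=> k0 hl /cboxE[z1 z2] ek.
    have zk : cbox w k k z by apply/cboxE; split; exact: le_trans ek.
    apply: le_trans (hl _ _ zk (self w k k0)) _.
    apply: (@le_trans _ _ (`|l| * (`|z.1 - w.1| + `|z.2 - w.2|))).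
      by rewrite ler_wpM2r ?addr_ge0// ler_norm.
    by rewrite ler_wpM2l//; lra.
  apply: (near2 _ _ e (4 * B / D) e0) => z L1 L1L z1 z2.
  have h1 := dev p z.1 h L h0 hL z1 eh; have h2 := dev q z.2 h' L' h'0 hL' z2 eh'.
  have vB : `|v z.1 - v z.2| <= B.
    have -> : v z.1 - v z.2 = (v z.1 - v p) + (v p - v q) - (v z.2 - v q) by ring.
    apply: le_trans (ler_normB _ _) _; apply: lerD => //.
    by apply: le_trans (ler_normD _ _) _; rewrite lerD2r.
  have dz : D / 4 <= Defs.edist z.1 z.2.
    have := edist2 z.1 z.2; move/cboxE: z1 => [a1 a2]; move/cboxE: z2 => [b1 b2].
    have t1 : `|p.1 - q.1| <= `|z.1.1 - p.1| + `|z.1.1 - z.2.1| + `|z.2.1 - q.1|.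
      have -> : p.1 - q.1 = - (z.1.1 - p.1) + (z.1.1 - z.2.1) + (z.2.1 - q.1) by ring.
      by apply: le_trans (ler_normD _ _) _; rewrite lerD2r (le_trans (ler_normD _ _))// normrN.
    have t2 : `|p.2 - q.2| <= `|z.1.2 - p.2| + `|z.1.2 - z.2.2| + `|z.2.2 - q.2|.
      have -> : p.2 - q.2 = - (z.1.2 - p.2) + (z.1.2 - z.2.2) + (z.2.2 - q.2) by ring.
      by apply: le_trans (ler_normD _ _) _; rewrite lerD2r (le_trans (ler_normD _ _))// normrN.
    by move: eD; rewrite /D; lra.
  apply: le_trans vB _; apply: (@le_trans _ _ (L1 * (D / 4))).
    by move: L1L; rewrite ltr_pdivrMr// => ?; lra.
  rewrite ler_wpM2l//; apply: le_trans (ltW L1L); rewrite divr_ge0 ?(ltW D0)// mulr_ge0//.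
  by rewrite !addr_ge0// !mulr_ge0// ltW.
move=> [L [_ hL]]; exists (L + 1) => p q Kp Kq.
by apply: (hL (L + 1) _ (p, q)); [rewrite ltrDl|].
Qed.

(** * The slope of the horizontal lines *)

Section slopes.
Variables (R : realType) (Om : set (R * R)) (v g : R * R -> R).
Hypotheses (oOm : open Om) (cv : {within Om, continuous v}) (Bvg : Bweak Om v g).
Hypothesis hmin : forall (vt gt : R * R -> R) (K : set (R * R)),
  {within Om, continuous vt} -> compact K -> K `<=` Om ->
  (forall p, Om p -> ~ K p -> vt p = v p) -> Bweak Om vt gt ->
  (areaH K g <= areaH K gt)%E.
Hypothesis loc : forall w, Om w -> exists h k L : R, [/\ 0 < h, 0 < k, 0 <= L, cbox w h k `<=` Om &
  forall p q, cbox w h k p -> cbox w h k q -> `|v p - v q| <= L * (`|p.1 - q.1| + `|p.2 - q.2|)].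
Local Notation mR := (measurableTypeR R).
Local Notation mu2 := (@leb2 R).

(* [a] is the slope of v along the parabola through [w] that is the projection of a
   horizontal line. *)
Definition parabola (w : R * R) (a s : R) : R * R := (w.1 + s, w.2 - 4 * v w * s - 2 * a * s ^+ 2).

Definition is_slope (w : R * R) (a : R) := exists2 e : R, 0 < e &
  forall s, `|s| < e -> Om (parabola w a s) /\ v (parabola w a s) = v w + a * s.

(** At parameter [s] the two parabolas are [2 |a - a'| s ^ 2] apart while the values of [v] on them
    differ by [|a - a'| s]; for small [s] the Lipschitz bound forces [a = a']. *)
Lemma slope_unique w a a' : Om w -> is_slope w a -> is_slope w a' -> a = a'.
Proof.
move=> Omw [e e0 ha] [e' e'0 ha']; have [h [k [L [h0 k0 L0 _ vL]]]] := loc Omw.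
pose c := 4 * `|v w| + 2 * `|a| + 2 * `|a'| + 1.
have c0 : 0 < c by rewrite ltr_wpDl// !addr_ge0// mulr_ge0.
have L1 : 0 < 2 * L + 1 by rewrite ltr_wpDl// mulr_ge0.
(* Small enough for both parabolas to be available and to stay in the Lipschitz box, and for
   [2 L s < 1]. *)
pose s := Num.min (Num.min (e / 2) (e' / 2)) (Num.min (Num.min h 1) (Num.min (k / c) ((2 * L + 1)^-1))).
have s0 : 0 < s by rewrite !lt_min !divr_gt0// h0 ltr01 invr_gt0 L1.
have se : s < e by apply: (@le_lt_trans _ _ (e / 2)); [rewrite !ge_min lexx|lra].
have se' : s < e' by apply: (@le_lt_trans _ _ (e' / 2)); [rewrite !ge_min lexx !orbT|lra].
have sh : s <= h by rewrite !ge_min lexx !orbT.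
have s1 : s <= 1 by rewrite !ge_min lexx !orbT.
have sk : s <= k / c by rewrite !ge_min lexx !orbT.
have sL : s <= (2 * L + 1)^-1 by rewrite !ge_min lexx !orbT.
have abs_s : `|s| = s by rewrite gtr0_norm.
have inb b : `|b| <= `|a| + `|a'| -> cbox w h k (parabola w b s).
  move=> hb; apply/cboxE; split => /=; first by rewrite addrAC subrr add0r abs_s.
  have -> : w.2 - 4 * v w * s - 2 * b * s ^+ 2 - w.2 = - (4 * v w * s + 2 * b * s ^+ 2) by ring.
  rewrite normrN.
  apply: (@le_trans _ _ (c * s)); last by rewrite mulrC -ler_pdivlMr.
  have -> : 4 * v w * s + 2 * b * s ^+ 2 = (4 * v w + 2 * b * s) * s by ring.
  rewrite normrM abs_s ler_wpM2r ?(ltW s0)//; apply: le_trans (ler_normD _ _) _.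
  rewrite (normrM 4) (normrM _ s) (normrM 2) abs_s (ger0_norm (_ : 0 <= 4))// (ger0_norm (_ : 0 <= 2))//.
  have : `|b| * s <= `|b| by rewrite ler_piMr.
  by rewrite /c; lra.
have [_ E] : Om (parabola w a s) /\ v (parabola w a s) = v w + a * s by apply: ha; rewrite abs_s.
have [_ E'] : Om (parabola w a' s) /\ v (parabola w a' s) = v w + a' * s by apply: ha'; rewrite abs_s.
have := vL _ _ (inb a _) (inb a' _); rewrite lerDl lerDr !normr_ge0 => /(_ isT isT).
rewrite E E' /= subrr normr0 add0r.
have -> : v w + a * s - (v w + a' * s) = (a - a') * s by ring.
have -> : w.2 - 4 * v w * s - 2 * a * s ^+ 2 - (w.2 - 4 * v w * s - 2 * a' * s ^+ 2) =
  - (2 * (a - a') * s * s) by ring.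
rewrite normrN !normrM (ger0_norm (_ : 0 <= 2))// abs_s => H.
apply/eqP; rewrite -subr_eq0 -normr_le0 leNgt; apply/negP => d0.
have H2 : `|a - a'| * s * 1 <= `|a - a'| * s * (2 * L * s) by apply: le_trans (le_trans H _); [rewrite mulr1|apply: le_of_eq; ring].
rewrite ler_pM2l ?mulr_gt0// in H2.
have : s * (2 * L + 1) <= 1 by rewrite -ler_pdivlMr// mul1r.
by move: s0 H2; lra.
Qed.

Lemma open_measurable_fun2 (W : set (R * R)) (f : R * R -> R) : open W ->
  (forall p, W p -> {for p, continuous f}) -> measurable_fun (W : set (mR * mR)) f.
Proof.
move=> oW cf; apply: (measurability _ (RGenOpens.measurableE R)).
move=> _ [_ [a [b ->] <-]]; apply: open_measurable2.
rewrite openE => p [Wp fp]; apply: filterI; first by have := oW; rewrite openE => /(_ p Wp).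
by apply: (cf p Wp); apply: open_nbhs_nbhs; split => //; exact: interval_open.
Qed.

Definition obox (w : R * R) (h : R) : set (R * R) :=
  `]w.1 - h, w.1 + h[%classic `*` `]w.2 - h, w.2 + h[%classic.

Lemma oboxE w h p : obox w h p <-> `|p.1 - w.1| < h /\ `|p.2 - w.2| < h.
Proof. by rewrite /obox /= !in_itv/= -!ltr_distlC !(distrC _ (w.1)) !(distrC _ (w.2)). Qed.

Lemma obox_open w h : open (obox w h).
Proof.
rewrite /obox; have -> : `]w.1 - h, w.1 + h[%classic `*` `]w.2 - h, w.2 + h[%classic =
    (fst @^-1` `]w.1 - h, w.1 + h[%classic) `&` (snd @^-1` `]w.2 - h, w.2 + h[%classic) by [].
by apply: openI; apply: open_comp; [move=> p _; exact: cvg_fst|exact: interval_open|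
  move=> p _; exact: cvg_snd|exact: interval_open].
Qed.

Lemma lipschitz_at (W : set (R * R)) (f : R * R -> R) (K : R) : open W ->
  (forall p q, W p -> W q -> `|f p - f q| <= K * (`|p.1 - q.1| + `|p.2 - q.2|)) ->
  forall p, W p -> {for p, continuous f}.
Proof.
move=> oW fK p Wp; apply/cvgrPdist_le => e e0.
have K1 : 0 < `|K| + 1 by rewrite ltr_wpDl.
have e1 : 0 < e / (2 * (`|K| + 1)) by rewrite divr_gt0// mulr_gt0.
near=> q; have Wq : W q by near: q; have := oW; rewrite openE => /(_ p Wp).
apply: le_trans (fK _ _ Wp Wq) _.
apply: (@le_trans _ _ (`|K| * (`|p.1 - q.1| + `|p.2 - q.2|))).
  by rewrite ler_wpM2r ?addr_ge0// ler_norm.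
have h1 : `|p.1 - q.1| <= e / (2 * (`|K| + 1)).
  by near: q; apply: (@cvgr_dist_le _ _ _ (nbhs p) _ fst) => //; exact: cvg_fst.
have h2 : `|p.2 - q.2| <= e / (2 * (`|K| + 1)).
  by near: q; apply: (@cvgr_dist_le _ _ _ (nbhs p) _ snd) => //; exact: cvg_snd.
apply: (@le_trans _ _ ((`|K| + 1) * (e / (2 * (`|K| + 1)) + e / (2 * (`|K| + 1))))).
  by apply: ler_pM; rewrite ?addr_ge0// ?lerDl// lerD.
by apply: le_of_eq; field; rewrite gt_eqF.
Unshelve. all: by end_near. Qed.

Lemma dist_chain (x y z a b c : R) : `|x - y| <= a -> `|y - z| <= b -> a + b <= c -> `|x - z| <= c.
Proof. by move=> h1 h2; apply: le_trans; apply: le_trans (ler_distD y _ _) _; exact: lerD. Qed.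

Lemma slope_chart w : Om w -> exists (d K : R) (G : R * R -> R),
  [/\ 0 < d, cbox w d d `<=` Om,
      forall p, cbox w d d p -> is_slope p (G p),
      forall p q, cbox w d d p -> cbox w d d q -> `|G p - G q| <= K * (`|p.1 - q.1| + `|p.2 - q.2|) &
      {ae mu2, forall p, obox w d p -> g p = G p}].
Proof.
move=> Omw; have [h [k [L [h0 k0 L0 bOm vL]]]] := loc Omw.
pose M := `|v w| + L * (h + k).
have M0 : 0 <= M by rewrite addr_ge0// mulr_ge0// addr_ge0// ltW.
have vM p : cbox w h k p -> `|v p| <= M.
  move=> bp; have bw : cbox w h k w by apply/cboxE; rewrite !subrr normr0 !ltW.
  have -> : v p = v w + (v p - v w) by ring.
  apply: le_trans (ler_normD _ _) _; rewrite lerD2l; apply: le_trans (vL _ _ bp bw) _.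
  by move/cboxE: bp => [? ?]; rewrite ler_wpM2l// lerD.
have M1 : 0 < 16 * M + 1 by rewrite ltr_wpDl// mulr_ge0.
(* Over the width [2 n] a characteristic moves by at most [8 M n <= k / 2], so one that passes
   within [k / 4] of the centre stays within [3 k / 4]. *)
pose n := Num.min h (k / (16 * M + 1)).
have n0 : 0 < n by rewrite lt_min h0 divr_gt0.
have nh : n <= h by rewrite ge_min lexx.
have nk : 8 * M * n <= k / 2.
  have : n <= k / (16 * M + 1) by rewrite ge_min lexx orbT.
  by rewrite ler_pdivlMr// => ?; lra.
pose c1 := w.1 - n; pose c2 := w.1 + n; pose d1 := w.2 - k; pose d2 := w.2 + k.
have c12 : c1 < c2 by rewrite /c1 /c2; lra.
have d12 : d1 < d2 by rewrite /d1 /d2; lra.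
have c21 : c2 - c1 = 2 * n by rewrite /c1 /c2; ring.
have Qb p : (`[c1, c2]%classic `*` `[d1, d2]%classic) p -> cbox w h k p.
  move=> [] /=; rewrite !in_itv/= => /andP[p1 p2] /andP[p3 p4].
  apply/cboxE; rewrite !ler_distl p3 p4 andbT; split => //.
  by rewrite (le_trans _ p1) ?(le_trans p2) ?lerD2l ?lerN2.
have QOm : `[c1, c2]%classic `*` `[d1, d2]%classic `<=` Om by move=> p /Qb /bOm.
have QL p q : (`[c1, c2]%classic `*` `[d1, d2]%classic) p -> (`[c1, c2]%classic `*` `[d1, d2]%classic) q ->
    `|v p - v q| <= L * (`|p.1 - q.1| + `|p.2 - q.2|) by move=> /Qb bp /Qb; exact: vL.
have QM p : (`[c1, c2]%classic `*` `[d1, d2]%classic) p -> `|v p| <= M by move=> /Qb /vM.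
pose V := box_ext v c1 c2 d1 d2.
have VL : lip2 V L by exact: box_ext_lip.
have VM p : `|V p| <= M by exact: box_ext_bound.
have vV p : (`[c1, c2]%classic `*` `[d1, d2]%classic) p -> v p = V p by exact: box_extE.
have [chi hchi] := choice (fun p : R * R => let: ex_intro2 X h1 h2 := charact_exists VL VM p.1 p.2 in
  ex_intro (fun X => charact V X /\ X p.1 = p.2) X (conj h1 h2)).
pose G p := (V (c2, chi p c2) - V (c1, chi p c1)) / (c2 - c1).
pose d := Num.min (n / 2) (k / 4).
have d0 : 0 < d by rewrite lt_min !divr_gt0.
have dn : d <= n / 2 by rewrite ge_min lexx.
have dk : d <= k / 4 by rewrite ge_min lexx orbT.
have dn' : d < n by apply: le_lt_trans dn _; rewrite ltr_pdivrMr// ltr_pMr// ltr1n.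
have dk' : d < k by lra.
have k34 : 3 / 4 * k < k by rewrite gtr_pMl// ltr_pdivrMr// mul1r ltr_nat.
have dk34 : k / 2 + d <= 3 / 4 * k by lra.
have c1_in : c1 <= c1 <= c2 by rewrite lexx ltW.
have c2_in : c1 <= c2 <= c2 by rewrite lexx ltW.
have inner X y : charact V X -> cbox w d d (y, X y) -> c1 < y < c2 /\
    forall z, c1 <= z <= c2 -> w.2 - 3 / 4 * k <= X z <= w.2 + 3 / 4 * k.
  move=> dX /cboxE[/= y1 y2]; split; first by rewrite -ltr_distl (le_lt_trans y1).
  move=> z; rewrite -!ler_distl => zn; apply: (dist_chain (le_trans (charact_lip VM z y dX) _) y2 dk34).
  apply: le_trans nk; rewrite (_ : 8 * M * n = 4 * M * (n + n)); last by ring.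
  rewrite ler_wpM2l ?mulr_ge0//; apply: (dist_chain zn _ (lexx _)).
  by rewrite distrC (le_trans y1)// ltW.
have XQ X y : charact V X -> cbox w d d (y, X y) -> forall z, c1 <= z <= c2 -> d1 < X z < d2.
  by move=> dX /(inner _ _ dX)[_ h1] z /h1; rewrite -ler_distl -ltr_distl => /le_lt_trans; apply.
have slopeG X y : charact V X -> cbox w d d (y, X y) ->
    forall p q, c1 <= p <= c2 -> c1 <= q <= c2 -> V (q, X q) - V (p, X p) = G (y, X y) * (q - p).
  move=> dX by_; have [a sa] := box_slope oOm cv Bvg hmin c12 d12 QOm L0 QL QM dX (XQ X y dX by_).
  suff -> : G (y, X y) = a by [].
  have [dchi chiy] := hchi (y, X y).
  have E z : chi (y, X y) z = X z.
    apply/eqP; rewrite -subr_eq0 -normr_le0; apply: le_trans (charact_gronwall VL y z dchi dX) _.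
    by rewrite [chi _ y]chiy subrr normr0 mulr0.
  by rewrite /G !E (sa c1 c2 c1_in c2_in) mulfK// subr_eq0 gt_eqF.
pose E := expR (4 * L * (2 * n)).
have E0 : 0 <= E by exact: expR_ge0.
have chiL p q c : cbox w d d p -> c1 <= c <= c2 ->
    `|chi p c - chi q c| <= E * ((1 + 4 * M) * (`|p.1 - q.1| + `|p.2 - q.2|)).
  move=> /cboxE[p1 p2] /andP[cc1 cc2]; have [dp pp] := hchi p; have [dq qq] := hchi q.
  apply: le_trans (charact_gronwall VL p.1 c dp dq) _; apply: ler_pM; rewrite ?expR_ge0//.
    have cn : `|c - w.1| <= n by rewrite ler_distl cc1.
    rewrite ler_expR ler_wpM2l ?mulr_ge0//; apply: (dist_chain cn _ (b := n)).
      by rewrite distrC (le_trans p1)// ltW.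
    by rewrite mulr_natl mulr2n.
  rewrite pp -[in leLHS](subrKA q.2) -{2}qq.
  apply: le_trans (ler_normD _ _) _.
  have h1 := charact_lip VM q.1 p.1 dq; rewrite (distrC q.1) in h1.
  rewrite mulrDl mul1r; apply: lerD; first by rewrite lerDr.
  by apply: le_trans h1 _; rewrite ler_wpM2l ?mulr_ge0// lerDl.
pose K := (c2 - c1)^-1 * (2 * (L * (E * (1 + 4 * M)))).
have main : [/\ cbox w d d `<=` Om,
    forall p, cbox w d d p -> is_slope p (G p) &
    forall p q, cbox w d d p -> cbox w d d q -> `|G p - G q| <= K * (`|p.1 - q.1| + `|p.2 - q.2|)].
  split.
- move=> p /cboxE[p1 p2]; apply: bOm; apply/cboxE.
  split; first exact: le_trans (ltW (lt_le_trans dn' nh)).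
  exact: le_trans (ltW dk').
- move=> p bp; have [dX Xp] := hchi p.
  have bX : cbox w d d (p.1, chi p p.1) by rewrite Xp -surjective_pairing.
  have [pc _] := inner _ _ dX bX; have pc' : c1 <= p.1 <= c2 by case/andP: pc => ? ?; rewrite !ltW.
  have sG := slopeG _ _ dX bX; rewrite Xp -surjective_pairing in sG.
  have inQ z : c1 <= z <= c2 -> (`[c1, c2]%classic `*` `[d1, d2]%classic) (z, chi p z).
    by move=> zc; split; rewrite /= in_itv//=; have /andP[? ?] := XQ _ _ dX bX z zc; rewrite !ltW.
  have vp : v p = V (p.1, chi p p.1) by rewrite -vV ?Xp -?surjective_pairing//; have := inQ _ pc'; rewrite Xp -surjective_pairing.
  exists (n / 2); first by rewrite divr_gt0.
  move=> s sn; have zc : c1 <= p.1 + s <= c2.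
    move: bp => /cboxE[p1 _]; rewrite -ler_distl; apply: (dist_chain _ (le_trans p1 dn) (a := n / 2)).
      by rewrite addrAC subrr add0r ltW.
    by rewrite -splitr.
  have Ez : parabola p (G p) s = (p.1 + s, chi p (p.1 + s)).
    congr pair; rewrite (charact_parabola dX pc' (fun z zc => sG p.1 z pc' zc) zc) Xp vp Xp.
    by rewrite (_ : p.1 + s - p.1 = s)//; ring.
  rewrite Ez; split; first exact/QOm/inQ.
  rewrite (vV _ (inQ _ zc)) vp; have := sG _ _ pc' zc => /eqP; rewrite subr_eq => /eqP ->.
  by ring.
- move=> p q bp bq; have cnz : c2 - c1 != 0 by rewrite subr_eq0 gt_eqF.
  have c0 : 0 < c2 - c1 by rewrite subr_gt0.
  have -> : G p - G q = (c2 - c1)^-1 * ((V (c2, chi p c2) - V (c2, chi q c2)) - (V (c1, chi p c1) - V (c1, chi q c1))).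
    by rewrite /G; field.
  rewrite normrM gtr0_norm ?invr_gt0// /K -mulrA ler_wpM2l ?invr_ge0 ?(ltW c0)//.
  have hc c : c1 <= c <= c2 -> `|V (c, chi p c) - V (c, chi q c)| <=
      L * (E * ((1 + 4 * M) * (`|p.1 - q.1| + `|p.2 - q.2|))).
    by move=> cc; apply: le_trans (lip2_t VL _ _ _) _; rewrite ler_wpM2l//; exact: chiL.
  apply: le_trans (ler_normB _ _) _; apply: le_trans (lerD (hc _ c2_in) (hc _ c1_in)) _.
  by apply: le_of_eq; ring.
have [bOm' sG GK] := main; exists d, K, G; split => //.
have oc p : obox w d p -> cbox w d d p by move=> /oboxE[? ?]; apply/cboxE; rewrite !ltW.
have mW : measurable (obox w d : set (mR * mR)) by apply: open_measurable2; exact: obox_open.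
have mG : measurable_fun (obox w d : set (mR * mR)) G.
  apply: open_measurable_fun2; first exact: obox_open.
  by apply: (lipschitz_at (K := K)); [exact: obox_open|move=> p q /oc bp /oc; exact: GK].
have aeg := gradient_ae oOm Bvg VL VM QOm vV.
have d32 : w.2 + 3 / 4 * k < d2 by rewrite ltrD2l.
have aes : {ae mu2, forall p, obox w d p -> igrad V p = G p}.
  apply: (slope_ae oOm cv Bvg VL VM c12 QOm vV hmin d32 mW mG) => X y dX /oc by_.
  have [yc Xz] := inner _ _ dX by_; split => //.
    move=> z /andP[z1 z2]; have /andP[h1 h2] : w.2 - 3 / 4 * k <= X z <= w.2 + 3 / 4 * k.
      by apply: Xz; rewrite !ltW.
    by rewrite h2 andbT (lt_le_trans _ h1)// ltrD2l ltrN2.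
  (* [slope_on] speaks of interior points only, so the slope is compared at two of them and not at
     the ends. *)
  move=> a sa; pose m := (c1 + c2) / 2; pose m' := (c1 + m) / 2.
  have [m1 m2] := midf_lt c12; have [m'1 m'2] := midf_lt m1.
  have mc : c1 < m < c2 by rewrite m1.
  have m'c : c1 < m' < c2 by rewrite m'1 (lt_trans m'2)//; case/andP: mc.
  have m'm : m - m' != 0 by rewrite subr_eq0 gt_eqF.
  apply: (mulIf m'm); rewrite -(sa m' m m'c mc) (slopeG X y dX by_)//.
    by case/andP: m'c => ? ?; rewrite !ltW.
  by case/andP: mc => ? ?; rewrite !ltW.
have aeI := ae_filter_ringOfSetsType mu2.
apply: filterS2 aeg aes => p h1 h2 bp; rewrite -h2// h1//.
move/oboxE: bp => [p1 p2]; split; rewrite /= in_itv/= -ltr_distl; first exact: lt_trans dn'.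
exact: lt_trans dk'.
Qed.

End slopes.

(** * Regularity of the slope and the foliation *)

Section conclusion.
Variables (R : realType) (Om : set (R * R)) (v g : R * R -> R).
Hypotheses (oOm : open Om) (cv : {within Om, continuous v}) (Bvg : Bweak Om v g).
Hypothesis hmin : forall (vt gt : R * R -> R) (K : set (R * R)),
  {within Om, continuous vt} -> compact K -> K `<=` Om ->
  (forall p, Om p -> ~ K p -> vt p = v p) -> Bweak Om vt gt ->
  (areaH K g <= areaH K gt)%E.
Hypothesis loc : forall w, Om w -> exists h k L : R, [/\ 0 < h, 0 < k, 0 <= L, cbox w h k `<=` Om &
  forall p q, cbox w h k p -> cbox w h k q -> `|v p - v q| <= L * (`|p.1 - q.1| + `|p.2 - q.2|)].
Local Notation mR := (measurableTypeR R).
Local Notation mu2 := (@leb2 R).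

Lemma Lip_loc_of_boxes : Lip_loc Om v.
Proof.
apply: lipschitz_of_local => w /loc[h [k [L [h0 k0 L0 _ vL]]]].
exists (Num.min h k), L; split; first by rewrite lt_min h0.
have sub p : cbox w (Num.min h k) (Num.min h k) p -> cbox w h k p.
  by move=> /cboxE[]; rewrite !le_min => /andP[? _] /andP[_ ?]; apply/cboxE.
by move=> p q /sub bp /sub bq; exact: vL.
Qed.

Variable s : R * R -> R.
Hypothesis sS : forall w, Om w -> is_slope Om v w (s w).

Lemma slope_function_chart w : Om w -> exists (d K : R), [/\ 0 < d, cbox w d d `<=` Om,
  forall p q, cbox w d d p -> cbox w d d q -> `|s p - s q| <= K * (`|p.1 - q.1| + `|p.2 - q.2|) &
  {ae mu2, forall p, obox w d p -> g p = s p}].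
Proof.
move=> Omw; have [d [K [G [d0 bOm GS GK Gae]]]] := slope_chart oOm cv Bvg hmin loc Omw.
have sG p : cbox w d d p -> s p = G p.
  by move=> bp; apply: (slope_unique loc (bOm p bp)); [exact: sS (bOm p bp)|exact: GS].
exists d, K; split => //.
  by move=> p q bp bq; rewrite !sG//; exact: GK.
apply: ae_sub Gae => p Gp bp; rewrite Gp// sG//.
by move/oboxE: bp => [? ?]; apply/cboxE; rewrite !ltW.
Qed.

Lemma slope_function_lip : Lip_loc Om s.
Proof.
apply: lipschitz_of_local => w /slope_function_chart[d [K [d0 _ sK _]]].
by exists d, K.
Qed.

(** Countably many rational boxes suffice: every point has one inside its chart, where equality
    holds almost everywhere; [good] selects such boxes and [pickle] enumerates them. *)
Lemma slope_function_ae : {ae mu2, forall p, Om p -> g p = s p}.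
Proof.
pose B (q : rat * rat * rat * rat) (p : R * R) := [&& ratr q.1.1.1 < p.1, p.1 < ratr q.1.1.2,
  ratr q.1.2 < p.2 & p.2 < ratr q.2].
pose good q := {ae mu2, forall p, B q p -> g p = s p}.
have H : {ae mu2, forall p, forall n q, unpickle n = Some q -> good q -> B q p -> g p = s p}.
  apply/ae_foralln => n; case E : (unpickle n) => [q|]; last by apply: aeW.
  have [gq|ngq] := pselect (good q); last by apply: aeW => p q' [<-] /ngq.
  by apply: ae_sub gq => p h q' [<-] _.
apply: ae_sub H => p h Omp; have [d [K [d0 _ _ dae]]] := slope_function_chart Omp.
have near_rat (x : R) : exists a b : rat, [/\ x - d < ratr a < x & x < ratr b < x + d].
  have xd : x - d < x by rewrite gtrBl.
  have dx : x < x + d by rewrite ltrDl.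
  have [a ha] := rat_in_itvoo xd; have [b hb] := rat_in_itvoo dx.
  by exists a, b; move: ha hb; rewrite !in_itv.
have [a1 [b1 [/andP[ha1 ha1'] /andP[hb1 hb1']]]] := near_rat p.1.
have [a2 [b2 [/andP[ha2 ha2'] /andP[hb2 hb2']]]] := near_rat p.2.
apply: (h (pickle (a1, b1, a2, b2)) (a1, b1, a2, b2)); first exact: pickleK.
  apply: ae_sub dae => q hq /and4P[/= h1 h2 h3 h4]; apply: hq; apply/oboxE.
  by rewrite !ltr_distl (lt_trans ha1 h1) (lt_trans h2 hb1') (lt_trans ha2 h3) (lt_trans h4 hb2').
by rewrite /B/= ha1' hb1 ha2' hb2.
Qed.

(** [s] agrees with [g] almost everywhere, so it represents the same distribution; it is the locally
    Lipschitz representative that [C11H_loc] asks for. *)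
Lemma slope_function_Bweak : Bweak Om v s.
Proof.
have [[mg gL] gB] := Bvg; have mOm : measurable (Om : set (mR * mR)) by exact: open_measurable2.
have ms : measurable_fun (Om : set (mR * mR)) s.
  apply: open_measurable_fun2 => // p /slope_function_chart[d [K [d0 _ sK _]]].
  have sK' q q' : obox p d q -> obox p d q' -> `|s q - s q'| <= K * (`|q.1 - q'.1| + `|q.2 - q'.2|).
    by move=> /oboxE[h1 h2] /oboxE[h3 h4]; apply: sK; apply/cboxE; rewrite !ltW.
  apply: (lipschitz_at (@obox_open R p d) sK').
  by apply/oboxE; rewrite !subrr normr0.
split.
  split => // K cK KOm; have mK : measurable (K : set (mR * mR)) by exact: compact_measurable2.
  rewrite (_ : (\int[leb2 (R:=R)]_(p in K) `|(s p)%:E|)%E = (\int[leb2 (R:=R)]_(p in K) `|(g p)%:E|)%E).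
    exact: gL.
  apply: ae_eq_integral => //.
  - apply: measurableT_comp => //; apply/measurable_EFinP.
    exact: (@measurable_funS _ _ (mR * mR)%type _ Om).
  - apply: measurableT_comp => //; apply/measurable_EFinP.
    exact: (@measurable_funS _ _ (mR * mR)%type _ Om).
  - by apply: ae_sub slope_function_ae => p gs Kp; rewrite gs//; exact: KOm.
move=> phi tphi; rewrite -gB//; have [sphi _] := tphi; have [c0 _ _ _ _] := smooth_pd sphi.
have mphi : measurable_fun (Om : set (mR * mR)) phi.
  by apply: measurable_funTS; exact: continuous_measurable2.
apply: ae_eq_integral => //.
- by apply/measurable_EFinP; exact: measurable_funM.
- by apply/measurable_EFinP; exact: measurable_funM.
- by apply: ae_sub slope_function_ae => p gs Omp; rewrite gs.
Qed.

(** Existence: the parabola through [w] lifts to the line with direction [s w] times [hX] plus [hY]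
    at the point. Uniqueness: another horizontal segment in the graph projects to a parabola through
    [w] of slope [a / b], and slopes are unique. *)
Lemma slope_function_foliated : foliated (Sv Om v).
Proof.
move=> _ [w Omw <-]; set p := (_, _, _).
have [e e0 he] := sS Omw; pose d : R * R * R := (s w, 1, 2 * w.1 * s w - 2 * v w).
exists d; split.
- split; first by move=> []; move=> _ /eqP; rewrite oner_eq0.
  move=> t; exists (s w), 1; rewrite /padd /pscale /hX /hY /p /d /=.
  by congr (_, _, _); ring.
- exists e; split => // t /he[h1 h2]; exists (parabola v w (s w) t) => //.
  by rewrite h2 /parabola /padd /pscale /p /d /=; congr (_, _, _); ring.
case=> [[a b] c] [dn0 /(_ 0)[a' [b' []]]]; rewrite !(mulr0, mulr1, addr0, add0r, mul0r) => Ea Eb Ec.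
rewrite /p/= in Ec; rewrite -Ea -Eb in Ec.
move=> [e' [e'0 hS]].
have key t : `|t| < e' -> Om (w.1 + t * b, w.2 - 4 * v w * (t * b) - 2 * (a * t) * (t * b)) /\
    v (w.1 + t * b, w.2 - 4 * v w * (t * b) - 2 * (a * t) * (t * b)) = v w + t * a.
  move=> /hS[[y' t'] Omw' []] /= E1 E2 E3.
  suff -> : (w.1 + t * b, w.2 - 4 * v w * (t * b) - 2 * (a * t) * (t * b)) = (y', t') by split.
  congr pair; first by rewrite E2.
  rewrite E1 E2 in E3; apply: (addIr (2 * (w.1 + t * b) * (v w + t * a))); rewrite E3 Ec.
  by ring.
(* With [b = 0] the segment would project to the single point [w], so that [v w = v w + t * a]
   forces [a = 0] and the direction vanishes. *)
have [b0|b0] := eqVneq b 0.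
  have e2 : `|e' / 2| < e' by rewrite gtr0_norm ?divr_gt0//; lra.
  have [_] := key _ e2; rewrite b0 !mulr0 !subr0 addr0 -surjective_pairing => /eqP.
  rewrite -subr_eq0 opprD addrA subrr sub0r oppr_eq0 mulf_eq0 gt_eqF ?divr_gt0//= => /eqP a0.
  by case: dn0; rewrite Ec a0 b0 !(mulr0, mul0r) addr0.
have slope_ab : is_slope Om v w (a / b).
  exists (e' * `|b|); first by rewrite mulr_gt0// normr_gt0.
  move=> t ht; have tb : `|t / b| < e' by rewrite normrM normfV ltr_pdivrMr// normr_gt0.
  have := key _ tb; rewrite /parabola divfK//.
  have -> : 2 * (a * (t / b)) * t = 2 * (a / b) * t ^+ 2 by field.
  by have -> : t / b * a = a / b * t by field.
have Es : s w = a / b by exact: (slope_unique loc Omw (sS Omw)).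
have Ed : (a, b, c) = pscale b d.
  rewrite /pscale /d/= Es Ec; congr (_, _, _); first by rewrite mulrC divfK.
    by rewrite mulr1.
  by field.
rewrite Ed /line_set; apply/seteqP; split => _ [t _ <-].
  by exists (t * b) => //; rewrite /padd /pscale/=; congr (_, _, _); ring.
by exists (t / b) => //; rewrite /padd /pscale/=; congr (_, _, _); field.
Qed.

End conclusion.

Theorem theorem5p1 (R : realType) (Om : set (R * R)) (v g : R * R -> R) :
  open Om ->
  {within Om, continuous v} ->
  Bweak Om v g -> Linf_loc Om g ->
  (forall (vt gt : R * R -> R) (K : set (R * R)),
      {within Om, continuous vt} ->
      compact K -> K `<=` Om ->
      (forall p, Om p -> ~ K p -> vt p = v p) ->
      Bweak Om vt gt ->
      (areaH K g <= areaH K gt)%E) ->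
  (forall w0, Om w0 -> exists r : R,
      [/\ 0 < r, ball_e r w0 `<=` Om &
          ((rho%:E * ell v r rho w0)%E @[rho --> 0^'+] --> 0%E)]) ->
  [/\ Lip_loc Om v, C11H_loc Om v & foliated (Sv Om v)].
Proof.
move=> oOm cv Bvg _ hmin hell.
have loc := local_lipschitz oOm cv Bvg hmin hell.
(* The implication sits under the quantifier so that choice yields a function on the whole plane,
   with the arbitrary value 0 outside [Om]. *)
have slopes w : exists a, Om w -> is_slope Om v w a.
  have [Omw|] := pselect (Om w); last by exists 0.
  have [d [K [G [d0 _ GS _ _]]]] := slope_chart oOm cv Bvg hmin loc Omw.
  by exists (G w) => _; apply: GS; apply/cboxE; rewrite !subrr normr0 ltW.
have [s sS] := choice slopes; split.
- exact: Lip_loc_of_boxes loc.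
- split => //; exists s; split; first exact: (slope_function_Bweak oOm cv Bvg hmin loc sS).
  exact: (slope_function_lip oOm cv Bvg hmin loc sS).
- exact: (slope_function_foliated loc sS).
Qed.
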